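(* Let $t\ge2$ be an integer. For every non-power $w\in\mathbf{F}$, as $N\to\infty$, $$\mathbb{E}_w[a_t]=\frac1t+O\left(\frac{1}{N^{\pi(w)}}\right).$$
   Context: $\mathbf{F}$ is the free group on $r\ge1$ generators. A word $w\in\mathbf{F}$ is a non-power if it is not of the form $u^m$ with $u\in\mathbf{F}$, $m\ge2$ (in particular $w\neq1$). For a permutation $\sigma$, $a_t(\sigma)$ is the number of cycles of length $t$ in $\sigma$. $\mathbb{E}_w[a_t]$ is the function of $N$ whose value is the average of $a_t(w(\sigma_1,\ldots,\sigma_r))$ over independent uniformly random $\sigma_1,\ldots,\sigma_r\in S_N$. An element of a free group is primitive if it belongs to some basis. The primitivity rank $\pi(w)$ is the minimal rank of a subgroup $H\le\mathbf{F}$ containing $w$ as a non-primitive element of $H$, and $\pi(w)=\infty$ if there is no such subgroup. Convention: $N^{-\infty}$ is interpreted as $0$. The implied constant may depend on $w$ and $t$. *)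

(* Defs.v *)
From HB Require Import structures.
From mathcomp Require Import all_boot all_order all_algebra all_fingroup.
From mathcomp Require Import all_classical all_reals all_analysis.

Set Implicit Arguments.
Unset Strict Implicit.
Unset Printing Implicit Defensive.

Import Order.TTheory GRing.Theory Num.Theory.
Import numFieldNormedType.Exports.

Local Open Scope group_scope.

(* A letter (i, b) is the generator i if b = false, its inverse if b = true.  *)
Section ReducedWords.
Variable I : choiceType.
Implicit Types (l : I * bool) (s u v x : seq (I * bool)).

Definition linv l : I * bool := (l.1, ~~ l.2).

Definition reduced s : bool := sorted (fun l l' => l' != linv l) s.

Definition push l s : seq (I * bool) :=
  if s is l' :: s' then if l' == linv l then s' else l :: s else [:: l].

Definition winv s : seq (I * bool) := rev (map linv s).

Lemma linvK : involutive linv.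
Proof. by case=> i b; rewrite /linv /= negbK. Qed.

Lemma reduced_behead l s : reduced (l :: s) -> reduced s.
Proof. by case: s => //= l' s /andP[]. Qed.

Lemma push_reduced l s : reduced s -> reduced (push l s).
Proof.
case: s => // l' s; rewrite /push; case: ifPn => [_|ne]; first exact: reduced_behead.
by move=> rs /=; rewrite ne.
Qed.

Lemma foldr_push_reduced u v : reduced v -> reduced (foldr push v u).
Proof. by move=> rv; elim: u => //= l u; apply: push_reduced. Qed.

Lemma pushK l s : reduced s -> push (linv l) (push l s) = s.
Proof.
case: s => [|l' s] rs /=; first by rewrite linvK eqxx.
case: ifPn => [/eqP e|ne] /=; last by rewrite linvK eqxx.
case: s rs => [|l'' s] /=; first by rewrite e.
by rewrite e => /andP[/negbTE ->].
Qed.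

Lemma pushVK l s : reduced s -> push l (push (linv l) s) = s.
Proof. by move=> rs; rewrite -{1}[l]linvK pushK. Qed.

Lemma foldr_push_push l s x :
  reduced x -> foldr push x (push l s) = push l (foldr push x s).
Proof.
move=> rx; case: s => // l' s /=; case: ifPn => // /eqP -> /=.
by rewrite pushVK // foldr_push_reduced.
Qed.

Lemma foldr_pushA u v x : reduced x ->
  foldr push x (foldr push v u) = foldr push (foldr push x v) u.
Proof.
by move=> rx; elim: u => //= l u IH; rewrite foldr_push_push // IH.
Qed.

Lemma foldr_push_nil u : reduced u -> foldr push [::] u = u.
Proof.
elim: u => //= l u IH ru; rewrite IH ?(reduced_behead ru) //.
by case: u ru {IH} => //= l' u /andP[/negbTE ->].
Qed.

Lemma winvK : involutive winv.
Proof.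
by move=> s; rewrite /winv map_rev revK -map_comp map_id_in // => l _; exact: linvK.
Qed.

Lemma winv_reduced s : reduced s -> reduced (winv s).
Proof.
rewrite /reduced /winv rev_sorted sorted_map; apply: sub_sorted => l l' /=.
by apply: contraNneq => ->; rewrite linvK.
Qed.

Lemma foldr_winv u x : reduced x -> foldr push (foldr push x u) (winv u) = x.
Proof.
rewrite /winv; elim: u x => //= l u IH x rx.
by rewrite rev_cons -cats1 foldr_cat /= pushK ?IH ?foldr_push_reduced.
Qed.

End ReducedWords.

Record free_group (I : choiceType) :=
  FreeGroup { fword :> seq (I * bool); fword_reduced : reduced fword }.

HB.instance Definition _ (I : choiceType) := [isSub for @fword I].
HB.instance Definition _ (I : choiceType) := [Choice of free_group I by <:].

Section FreeGroupTheory.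
Variable I : choiceType.
Implicit Types u v x : free_group I.

Definition fmul u v := FreeGroup (foldr_push_reduced u (fword_reduced v)).
Definition fone : free_group I := @FreeGroup I [::] isT.
Definition finvg u := FreeGroup (winv_reduced (fword_reduced u)).

Lemma fmulA : associative fmul.
Proof. by move=> u v x; apply: val_inj; rewrite /= foldr_pushA ?fword_reduced. Qed.

Lemma fmul1 : left_id fone fmul.
Proof. by move=> u; apply: val_inj. Qed.

Lemma fmulr1 : right_id fone fmul.
Proof. by move=> u; apply: val_inj; rewrite /= foldr_push_nil ?fword_reduced. Qed.

Lemma fmulV : left_inverse fone finvg fmul.
Proof.
move=> u; apply: val_inj => /=.
by rewrite -[X in foldr _ X]foldr_push_nil ?fword_reduced // foldr_winv.
Qed.

Lemma fmulrV : right_inverse fone finvg fmul.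
Proof.
move=> u; have -> : u = finvg (finvg u) by apply: val_inj; rewrite /= winvK.
have -> : finvg (finvg (finvg u)) = finvg u by apply: val_inj; rewrite /= winvK.
exact: fmulV.
Qed.

HB.instance Definition _ := isGroup.Build (free_group I)
  fmulA fmul1 fmulr1 fmulV fmulrV.

Definition fgen (i : I) : free_group I := @FreeGroup I [:: (i, false)] isT.

Variables (G : groupType) (f : I -> G).

Definition letter_val (l : I * bool) : G := if l.2 then (f l.1)^-1 else f l.1.

(* The homomorphism free_group I -> G that extends f. *)
Definition flift (w : free_group I) : G := \prod_(l <- w) letter_val l.

Lemma flift_gen i : flift (fgen i) = f i.
Proof. by rewrite /flift big_seq1. Qed.

Lemma fliftM : {morph flift : u v / u * v}.
Proof.
move=> u v; rewrite /flift /=; elim: (fword u) => [|l s IH] /=.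
  by rewrite big_nil mul1g.
rewrite big_cons -mulgA -IH; case: (foldr _ _ s) => [|l' s'] /=.
  by rewrite big_seq1 big_nil mulg1.
case: ifPn => [/eqP ->|_]; last by rewrite big_cons.
by rewrite big_cons /letter_val; case: l => i [] /=; rewrite ?mulKg ?mulVKg.
Qed.

End FreeGroupTheory.

Section PrimitivityRank.
Local Open Scope classical_set_scope.
Variable G : groupType.
Implicit Types (w x : G) (B H : set G).

Definition is_subgroup H : Prop := group_closed (mem H).

Definition is_basis B H : Prop :=
  let ev := flift (fun b : B => val b : G) in
  injective ev /\ range ev = H.

Definition primitive_in H x : Prop := exists2 B, is_basis B H & B x.

Definition has_rank H (k : nat) : Prop := exists2 B, is_basis B H & (B #= `I_k)%card.

Definition nonprimitive_in_rank w (k : nat) : Prop :=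
  exists H, [/\ is_subgroup H, has_rank H k, H w & ~ primitive_in H w].

(* None stands for an infinite primitivity rank; a subgroup of infinite rank
   cannot lower the minimum, so only finite ranks are inspected. *)
Definition primitivity_rank w : option nat :=
  if pselect (exists k, `[< nonprimitive_in_rank w k >]) is left e
  then Some (ex_minn e) else None.

Definition non_power w : Prop := ~ exists u m, (2 <= m)%N /\ w = u ^+ m.

End PrimitivityRank.

Definition cycle_count (N t : nat) (s : 'S_N) : nat :=
  #|[set c in porbits s | #|c| == t]%SET|.

(* The average over all tuples of r permutations; the word w is evaluated with
   the product of 'S_N, which composes from left to right. Reversing that
   convention replaces w(s) by the inverse of w(s^-1), hence does not change
   the average. *)
Definition expected_cycles (R : realType) (r : nat) (w : free_group 'I_r)
    (t N : nat) : R :=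
  ((\sum_(s : {ffun 'I_r -> 'S_N}) (cycle_count t (flift s w))%:R)
     / #|{ffun 'I_r -> 'S_N}|%:R)%R.

(* N ^ (- p), where N ^ (- oo) is 0. *)
Definition inv_pow (R : realType) (p : option nat) (N : nat) : R :=
  if p is Some k then (N%:R ^- k)%R else 0%R.

(* Main.v *)
(**
Up to conjugation [w] is a cyclically reduced word of length [L]. A point on a [t]-cycle of
[w(sigma)] is a closed walk reading [w^t], that is a labelling [y] of [t * L] positions by points
which is injective on each of the [L] strands. Hence [t * E_w[a_t]] is the sum over [y] of a
product over the letters of conditional probabilities; the one of the [k]-th letter depends on
the set of earlier letters with the same generator. Moebius inversion in these sets writes the
expectation as a sum of terms [R_D], where [D] chooses a set of earlier letters for each letter,
and [D] determines a subgroup [K_D] generated by [w] and by one element for each chosen pair.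

If [w] is primitive in [K_D], the terms [R_D'] with [K_D'] contained in [K_D] sum to 1: they compute
the same expectation for a random homomorphism from [K_D] to [S_N], under which [w] is uniform.
If [w] is not primitive in [K_D], then [R_D = O(N^-m)] where [m], the rank of [K_D], is at least the
primitivity rank: the term of [y] is [O(N^-d)] with [d] at least [m] plus the number of values of
[y], by Euler characteristic counts in the graph whose vertices are pairs (coset of [K_D], point)
and in its quotient by the strands. The two counts are compared by merging the strands one at a
time in the order of a stacking of the cyclic word, which exists as [w] is not a power.
The terms [R_D] over a down-closed family thus sum to 1, or to 0 for the empty family, up to
[O(N^-pi(w))], by induction on the family.
*)
Require Import Defs.
From mathcomp Require Import all_boot all_order all_algebra all_fingroup.
From mathcomp Require Import all_classical all_reals all_analysis.
From mathcomp Require Import zify ring lra.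
Import numFieldNormedType.Exports.
Set Implicit Arguments.
Unset Strict Implicit.
Unset Printing Implicit Defensive.
Import Order.TTheory GRing.Theory Num.Theory.

(** * Free groups and their subgroups *)

(** For fixed points, t = 1, the error has order N^(1 - pi(w)). The extra power of N is what shapes
    the proof, and it is gained only for t at least 2. Counting labellings of a graph with V
    vertices and E edges gives the exponent E - V, while its loops bound the rank only by E - V + 1.
    The missing 1 is found in one of two ways. Either merging the strands loses more vertices than
    the count predicts, or some edge is used once; then [w] replaces the loop lost by deleting this
    edge, and being non-primitive it cannot belong to a generating set as small as the rank.

    Subgroups of free groups are studied through their homomorphisms to finite groups. A labelling
    of the edges of a Schreier graph by elements of a finite group is such a homomorphism up to
    gauge. Counting labellings gives bases, bounds on ranks and the uniform values of primitive
    elements, and labellings by permutations are also what the sums of the R_D average over. *)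

Section Subgroups.
Local Open Scope group_scope.
Local Open Scope classical_set_scope.
Variable G : groupType.
Implicit Types (H X : set G) (x y : G).

Lemma is_subgroupP H :
  is_subgroup H <-> H 1 /\ forall x y, H x -> H y -> H (x * y^-1).
Proof.
split=> [[H1 HD]|[H1 HD]].
  split; first by move: H1; rewrite inE.
  by move=> x y Hx Hy; have := HD x y; rewrite !inE; apply.
by split=> [|x y]; rewrite ?inE // => Hx Hy; exact: HD.
Qed.

Section InSubgroup.
Variables (H : set G) (gH : is_subgroup H).

Lemma subgroup1 : H 1. Proof. by case/is_subgroupP: gH. Qed.

Lemma subgroup_div x y : H x -> H y -> H (x * y^-1).
Proof. by case/is_subgroupP: gH => _; apply. Qed.

Lemma subgroupV x : H x -> H x^-1.
Proof. by move=> Hx; rewrite -[_^-1]mul1g; apply: subgroup_div => //; exact: subgroup1. Qed.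

Lemma subgroupM x y : H x -> H y -> H (x * y).
Proof. by move=> Hx Hy; rewrite -[y]invgK; apply: subgroup_div => //; exact: subgroupV. Qed.

Lemma subgroupVE x : H x^-1 -> H x.
Proof. by move=> /subgroupV; rewrite invgK. Qed.

Lemma subgroupX x n : H x -> H (x ^+ n).
Proof. by move=> Hx; elim: n => [|n IH]; [exact: subgroup1|rewrite expgS; exact: subgroupM]. Qed.

Lemma subgroup_divC x y : H (x * y^-1) -> H (y * x^-1).
Proof. by move=> Hxy; apply: subgroupVE; rewrite invgM invgK. Qed.

Lemma subgroup_div_trans x y z : H (x * y^-1) -> H (y * z^-1) -> H (x * z^-1).
Proof. by move=> Hxy Hyz; rewrite -(mulgKV y x) -mulgA; exact: subgroupM. Qed.

End InSubgroup.

Definition gensub X : set G := [set x | forall H, is_subgroup H -> X `<=` H -> H x].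

Lemma gensub_subgroup X : is_subgroup (gensub X).
Proof.
apply/is_subgroupP; split=> [H gH _|x y Xx Xy H gH XH]; first exact: subgroup1.
by apply: subgroup_div => //; [exact: Xx|exact: Xy].
Qed.

Lemma sub_gensub X : X `<=` gensub X.
Proof. by move=> x Xx H _; apply. Qed.

Lemma gensub_min X H : is_subgroup H -> X `<=` H -> gensub X `<=` H.
Proof. by move=> gH XH x; apply. Qed.

End Subgroups.

Section FreeHom.
Local Open Scope group_scope.
Local Open Scope classical_set_scope.

Lemma flift1 (I : choiceType) (G : groupType) (f : I -> G) : flift f 1 = 1.
Proof. by rewrite /flift big_nil. Qed.

Lemma fliftV (I : choiceType) (G : groupType) (f : I -> G) (w : free_group I) :
  flift f w^-1 = (flift f w)^-1.
Proof.
by apply: (mulgI (flift f w)); rewrite -fliftM !mulgV flift1.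
Qed.

Lemma eq_flift (I : choiceType) (G : groupType) (f g : I -> G) :
  f =1 g -> flift f =1 flift g.
Proof.
by move=> fg w; apply: eq_bigr => l _; rewrite /letter_val fg.
Qed.

Lemma flift_gensub (I : choiceType) (G : groupType) (f : I -> G) (H : set G) :
  is_subgroup H -> (forall i, H (f i)) -> forall w, H (flift f w).
Proof.
move=> gH Hf w; rewrite /flift; elim: (fword w) => [|l s IH].
  by rewrite big_nil; exact: subgroup1.
rewrite big_cons; apply: subgroupM => //; rewrite /letter_val.
by case: ifP => _ //; exact: subgroupV.
Qed.

(** Multiplicativity is asked on [K] only, because coordinates in a basis and holonomies are total
    functions that are homomorphisms only there. *)
Lemma flift_hom (I : choiceType) (G H : groupType) (f : I -> G) (K : set G)
    (h : G -> H) : is_subgroup K -> (forall i, K (f i)) ->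
  (forall x y, K x -> K y -> h (x * y) = h x * h y) ->
  forall w, h (flift f w) = flift (h \o f) w.
Proof.
move=> gK Kf hM w.
have h1 : h 1 = 1.
  by apply: (mulgI (h 1)); rewrite mulg1 -hM ?mulg1 //; exact: subgroup1.
have hV x : K x -> h x^-1 = (h x)^-1.
  by move=> Kx; apply: (mulgI (h x)); rewrite -hM ?mulgV //; exact: subgroupV.
rewrite /flift.
suff: K (\prod_(l <- w) letter_val f l) /\
   h (\prod_(l <- w) letter_val f l) = \prod_(l <- w) letter_val (h \o f) l by case.
elim: (fword w) => [|l s [Ks IH]]; first by rewrite !big_nil; split=> //; exact: subgroup1.
have Kl : K (letter_val f l) by rewrite /letter_val; case: ifP => _ //; exact: subgroupV.
rewrite !big_cons; split; first exact: subgroupM.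
by rewrite hM // IH; congr (_ * _); rewrite /letter_val; case: ifP => _ /=; rewrite ?hV.
Qed.

Lemma setT_subgroup (G : groupType) : is_subgroup [set: G].
Proof. exact/is_subgroupP. Qed.

Lemma flift_comp (I : choiceType) (G H : groupType) (f : I -> G) (h : G -> H) :
  {morph h : x y / x * y} -> forall w, h (flift f w) = flift (h \o f) w.
Proof. by move=> hM w; apply: (@flift_hom _ _ _ f setT) => //; exact: setT_subgroup. Qed.

Lemma flift_inj (I : choiceType) (G : groupType) (f : I -> G) :
  (forall w, flift f w = 1 -> w = 1) -> injective (flift f).
Proof.
move=> f1 u v uv; have: u * v^-1 = 1 by apply: f1; rewrite fliftM fliftV uv mulgV.
exact: divg1_eq.
Qed.

Variable I : choiceType.
Implicit Types (w x : free_group I) (l : I * bool) (s : seq (I * bool)).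

Definition lval l : free_group I := letter_val (@fgen I) l.

Lemma fword_lval l : fword (lval l) = [:: l].
Proof. by case: l => i []. Qed.

Lemma lval_linv l : lval (linv l) = (lval l)^-1.
Proof. by case: l => i []; rewrite /lval /letter_val /= ?invgK. Qed.

Lemma fwordM w x : fword (w * x) = foldr (@push I) x w.
Proof. by []. Qed.

Lemma fword_prod s : fword (\prod_(l <- s) lval l) = foldr (@push I) [::] s.
Proof.
elim: s => [|l s IH]; first by rewrite big_nil.
by rewrite big_cons fwordM fword_lval /= IH.
Qed.

Lemma prod_lval w : \prod_(l <- w) lval l = w.
Proof. by apply: val_inj; rewrite /= fword_prod foldr_push_nil // fword_reduced. Qed.

Lemma flift_lval (G : groupType) (f : I -> G) l : flift f (lval l) = letter_val f l.
Proof. by rewrite /flift fword_lval big_seq1. Qed.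

Lemma flift_prod (G : groupType) (f : I -> G) s :
  flift f (\prod_(l <- s) lval l) = \prod_(l <- s) letter_val f l.
Proof.
elim: s => [|l s IH]; first by rewrite !big_nil flift1.
by rewrite !big_cons fliftM flift_lval IH.
Qed.

End FreeHom.

(** * Loops of a quotient of a path *)

Section PathGenerators.
Local Open Scope group_scope.
Local Open Scope classical_set_scope.
Variables (G : groupType) (V E : eqType) (A : nat -> G) (v : nat -> V) (e : nat -> E).

Definition path_colors (C : eqType) (c : nat -> C) (r : seq nat) := size (undup (map c r)).

Lemma path_colors_rcons (C : eqType) (c : nat -> C) r p :
  path_colors c (rcons r p) = (path_colors c r + (c p \notin map c r))%N.
Proof.
rewrite /path_colors map_rcons; elim: r => //= x r; rewrite mem_rcons in_cons.
case: (c x == c p) / eqP => [->|/eqP ne] /=.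
  rewrite in_cons eqxx /=; case: ifP => mem -> /=; rewrite ?mem ?addn0 ?addn1 //=.
by rewrite in_cons (eq_sym (c p)) (negbTE ne) /=; case: ifP => //= _ ->; rewrite addSn.
Qed.

(** The alternatives are a second passage in the same and in the opposite direction; the label of an
    edge is the increment of [A]. *)
Definition edge_sound (p q : nat) : Prop :=
  [/\ v p = v q, v p.+1 = v q.+1 & (A p)^-1 * A p.+1 = (A q)^-1 * A q.+1] \/
  [/\ v p = v q.+1, v p.+1 = v q & (A p)^-1 * A p.+1 = (A q.+1)^-1 * A q].

(* An Euler characteristic: a connected graph with vertex set the colours [v] and
   edge set the colours [e] has first Betti number E - V + 1. *)
Lemma path_generators (m T : nat) :
  (forall p q, m <= p < m + T -> m <= q < m + T -> e p = e q -> edge_sound p q)%N ->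
  exists gs : seq G,
    [/\ (size gs + path_colors v (iota m T.+1) <= path_colors e (iota m T) + 1)%N,
        (forall g, g \in gs -> exists p q, [/\ (m <= p <= m + T)%N, (m <= q <= m + T)%N,
            v p = v q & g = A p * (A q)^-1]) &
        forall p q, (m <= p <= m + T)%N -> (m <= q <= m + T)%N -> v p = v q ->
          gensub [set x | x \in gs] (A p * (A q)^-1)].
Proof.
elim: T => [|T IH] sound.
  exists [::]; split=> //= p q; rewrite !addn0 -!eqn_leq => /eqP <- /eqP <- _.
  by rewrite mulgV; exact: subgroup1 (gensub_subgroup _).
have [|gs [szgs gsP gsgen]] := IH.
  by move=> p q hp hq; apply: sound; lia.
rewrite -[in path_colors v _]addn1 iotaD cats1 path_colors_rcons addnS.
rewrite -[in path_colors e _]addn1 iotaD cats1 path_colors_rcons.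
set q0 := (m + T)%N.
have gg := gensub_subgroup [set x | x \in gs].
have oldE : e q0 \in map e (iota m T) -> exists2 q', (m <= q' < m + T)%N & edge_sound q0 q'.
  case/mapP=> q'; rewrite mem_iota => hq' eq'; exists q' => //; apply: sound => //; lia.
have inV p : (m <= p <= q0)%N -> v p \in map v (iota m T.+1).
  by move=> hp; apply: map_f; rewrite mem_iota; lia.
have spl p : (m <= p <= q0.+1)%N -> p = q0.+1 \/ (m <= p <= q0)%N by lia.
(* An old edge ends at an old vertex and adds no loop. A new edge closes a loop, at the cost of one
   generator, if its end is an old vertex; otherwise it enlarges the spanning tree. *)
have [eold|enew] := boolP (e q0 \in map e (iota m T)).
  have [q' hq' sq'] := oldE eold.
  have vold : v q0.+1 \in map v (iota m T.+1).
    by case: sq' => [[_ -> _]|[_ -> _]]; apply: inV; rewrite /q0; lia.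
  exists gs; rewrite vold !addn0; split=> //.
  - by move=> g /gsP[p [q [hp hq e1 e2]]]; exists p, q; split=> //; lia.
  - have last q : (m <= q <= q0)%N -> v q0.+1 = v q ->
        gensub [set x | x \in gs] (A q0.+1 * (A q)^-1).
      move=> hq vq; case: sq' => [[v1 v2 av]|[v1 v2 av]].
        apply: (subgroup_div_trans gg (y := A q'.+1)); last by apply: gsgen; rewrite -?v2 //; lia.
        have -> : A q0.+1 = A q0 * ((A q')^-1 * A q'.+1) by rewrite -av mulVKg.
        rewrite -!mulgA mulgV mulg1; apply: gsgen => //; rewrite /q0; lia.
      apply: (subgroup_div_trans gg (y := A q')); last by apply: gsgen; rewrite -?v2 //; lia.
      have -> : A q0.+1 = A q0 * ((A q'.+1)^-1 * A q') by rewrite -av mulVKg.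
      rewrite -!mulgA mulgV mulg1; apply: gsgen => //; rewrite /q0; lia.
    move=> p q /(spl p)[->|hp] /(spl q)[->|hq].
    + by rewrite mulgV => _; exact: subgroup1.
    + exact: last.
    + by move=> vpq; apply: (subgroup_divC gg); apply: last.
    + exact: gsgen.
have [vold|vnew] := boolP (v q0.+1 \in map v (iota m T.+1)).
  case/mapP: vold => p0; rewrite mem_iota => hp0 vp0.
  exists (A q0.+1 * (A p0)^-1 :: gs); split.
  - by move: szgs => /=; lia.
  - move=> g; rewrite in_cons => /orP[/eqP->|/gsP[p [q [hp hq e1 e2]]]].
      by exists q0.+1, p0; split => //; rewrite /q0; lia.
    by exists p, q; split => //; lia.
  - have gg' := gensub_subgroup [set x | x \in A q0.+1 * (A p0)^-1 :: gs].
    have lift x : gensub [set x | x \in gs] x ->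
        gensub [set x | x \in A q0.+1 * (A p0)^-1 :: gs] x.
      apply: gensub_min => // y /= ygs; apply: sub_gensub => /=.
      by rewrite in_cons ygs orbT.
    have last q : (m <= q <= q0)%N -> v q0.+1 = v q ->
        gensub [set x | x \in A q0.+1 * (A p0)^-1 :: gs] (A q0.+1 * (A q)^-1).
      move=> hq vq; apply: (subgroup_div_trans gg' (y := A p0)).
        by apply: sub_gensub; rewrite /= in_cons eqxx.
      by apply: lift; apply: gsgen; rewrite -?vq //; lia.
    move=> p q /(spl p)[->|hp] /(spl q)[->|hq].
    + by rewrite mulgV => _; exact: subgroup1.
    + exact: last.
    + by move=> vpq; apply: (subgroup_divC gg'); apply: last.
    + by move=> vpq; apply: lift; apply: gsgen.
exists gs; split.
- by move: szgs; lia.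
- by move=> g /gsP[p [q [hp hq e1 e2]]]; exists p, q; split => //; lia.
- move=> p q /(spl p)[->|hp] /(spl q)[->|hq].
  + by rewrite mulgV => _; exact: subgroup1.
  + by move=> vq; case/negP: vnew; rewrite vq; apply: inV.
  + by move=> vq; case/negP: vnew; rewrite -vq; apply: inV.
  + exact: gsgen.
Qed.

End PathGenerators.

(** * Residual finiteness of free groups *)

Section PartialInjections.
Local Open Scope group_scope.
Variable T : finType.
Implicit Types (Q : {set T * T}) (s : {perm T}).

Definition pinj Q := [forall a in Q, forall b in Q, (a.1 == b.1) == (a.2 == b.2)].

Lemma pinjP Q : reflect {in Q &, forall a b, (a.1 == b.1) = (a.2 == b.2)} (pinj Q).
Proof.
apply: (iffP forallP) => [H a b aQ bQ|H a]; last first.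
  by apply/implyP => aQ; apply/forallP => b; apply/implyP => bQ; rewrite H.
by have /implyP/(_ aQ)/forallP/(_ b)/implyP/(_ bQ)/eqP := H a.
Qed.

Definition extends s Q := [forall a in Q, s a.1 == a.2].

Lemma extendsP s Q : reflect {in Q, forall a, s a.1 = a.2} (extends s Q).
Proof.
apply: (iffP forallP) => [H a aQ|H a]; first by have /implyP/(_ aQ)/eqP := H a.
by apply/implyP => aQ; rewrite H.
Qed.

Lemma extends_pinj s Q : extends s Q -> pinj Q.
Proof.
move/extendsP=> sQ; apply/pinjP => a b aQ bQ.
by rewrite -!sQ // (inj_eq perm_inj).
Qed.

Lemma pinj_sub Q Q' : Q' \subset Q -> pinj Q -> pinj Q'.
Proof.
move/fintype.subsetP=> sub /pinjP H; apply/pinjP => a b aQ bQ.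
by apply: H; exact: sub.
Qed.

(** By induction: an extension of the other pairs is corrected at one source by a transposition. *)
Lemma pinj_extends Q : pinj Q -> exists s, extends s Q.
Proof.
have [n] := ubnP #|Q|; elim: n Q => // n IH Q; rewrite ltnS => szQ pQ.
have [->|[a aQ]] := set_0Vmem Q.
  by exists 1; apply/extendsP => a; rewrite inE.
have [||s /extendsP sP] := IH (Q :\ a).
- by move: szQ; rewrite (cardsD1 a Q) aQ.
- by apply: pinj_sub pQ; exact: subD1set.
exists (s * tperm (s a.1) a.2); apply/extendsP => b bQ; rewrite permM.
have [->|ba] := eqVneq b a; first by rewrite tpermL.
have bQ' : b \in Q :\ a by rewrite in_setD1 ba.
have /pinjP/(_ a b aQ bQ) ab := pQ.
have ne : a.1 != b.1.
  apply: contraNneq ba => e1; have: (a.1 == b.1) by rewrite e1.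
  by rewrite [a]surjective_pairing [b]surjective_pairing xpair_eqE
    [b.2 == _]eq_sym -ab eq_sym => ->.
rewrite (sP b) // tpermD //; last by rewrite -ab.
by rewrite -(sP b) // (inj_eq perm_inj).
Qed.

(** Dividing by one fixed extension turns the others into the permutations that fix every source of
    [Q]. *)
Lemma card_extends Q : pinj Q -> #|[set s | extends s Q]| = (#|T| - #|Q|)`!.
Proof.
move=> pQ; have [s0 /extendsP s0Q] := pinj_extends pQ.
have injQ : {in Q &, injective (fun a : T * T => a.1)}.
  move=> a b aQ bQ /= e1; have /pinjP/(_ a b aQ bQ) := pQ.
  rewrite e1 eqxx => /esym/eqP e2.
  by rewrite [a]surjective_pairing [b]surjective_pairing e1 e2.
pose X := [set a.1 | a in Q].
have cX : #|X| = #|Q| by rewrite card_in_imset.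
have -> : [set s | extends s Q] = [set t * s0 | t in [set t | perm_on (~: X) t]].
  apply/setP => s; apply/idP/imsetP => [|[t]]; rewrite !inE.
    move/extendsP=> sQ; exists (s * s0^-1); last by rewrite mulgKV.
    rewrite inE; apply/fintype.subsetP => x; rewrite !inE permM; apply: contraNN.
    by move=> /imsetP[a aQ ->]; rewrite sQ // -s0Q // permK.
  move=> /fintype.subsetP tX ->; apply/extendsP => a aQ; rewrite permM -s0Q //.
  congr (s0 _); apply/eqP; apply: contraT => ne.
  by have := tX a.1; rewrite !inE ne => /(_ isT)/negP[]; apply: imset_f.
by rewrite card_imset; [rewrite cardsE card_perm cardsCs finset.setCK cX|exact: mulIg].
Qed.

End PartialInjections.

Section ResidualFiniteness.
Local Open Scope group_scope.
Variable I : choiceType.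

(* The letters of [w] prescribe partial injections of the positions along [w],
   which extend to permutations moving the first position to the last. *)
Lemma free_group_residually_finite (w : free_group I) : w <> 1 ->
  exists N (f : I -> 'S_N), flift f w <> 1.
Proof.
move=> w1; pose s := fword w; pose n := size s.
have n0 : (0 < n)%N.
  rewrite lt0n; apply/negP => /nilP s0; apply: w1; apply: val_inj; exact: s0.
have [l0 _] : exists l : I * bool, True.
  by rewrite /n in n0; case: {+}s n0 => // l *; exists l.
pose l k := nth l0 s k.
pose o k : 'I_n.+1 := inord k.
pose Q (i : I) : {set 'I_n.+1 * 'I_n.+1} :=
  [set a | [exists k : 'I_n, ((l k).1 == i) &&
     (a == if (l k).2 then (o k.+1, o k) else (o k, o k.+1))]].
have red k : (k.+1 < n)%N -> l k.+1 != linv (l k).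
  by move=> hk; have /(sortedP l0) := fword_reduced w; apply.
have ok k : (k <= n)%N -> val (o k) = k by move=> hk; rewrite /= inordK.
have oE k k' : (k <= n)%N -> (k' <= n)%N -> (o k == o k') = (k == k').
  by move=> hk hk'; rewrite -val_eqE !ok.
(* Distinct pairs of [Q i] could share a coordinate only where a letter is followed by its
   inverse. *)
have pQ i : pinj (Q i).
  apply/pinjP => a b; rewrite !inE => /existsP[k /andP[/eqP ki /eqP->]].
  move=> /existsP[k' /andP[/eqP ki' /eqP->]].
  have := ltn_ord k; have := ltn_ord k' => hk' hk.
  have r1 := red k; have r2 := red k'.
  case E : (l k).2; case E' : (l k').2 => /=; rewrite !oE ?eqSS //; try lia.
    apply/idP/idP => /eqP e.
      by move: r1; rewrite e => /(_ hk')/eqP[]; rewrite /linv ki E [l k']surjective_pairing ki' E'.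
    by move: r2; rewrite -e => /(_ hk)/eqP[]; rewrite /linv ki' E' [l k]surjective_pairing ki E.
  apply/idP/idP => /eqP e.
    by move: r2; rewrite -e => /(_ hk)/eqP[]; rewrite /linv ki' E' [l k]surjective_pairing ki E.
  by move: r1; rewrite e => /(_ hk')/eqP[]; rewrite /linv ki E [l k']surjective_pairing ki' E'.
have [f fQ] := boolp.choice (fun i => pinj_extends (pQ i)).
exists n.+1, f => fw1.
have step k : (k <= n)%N -> (\prod_(a <- take k s) letter_val f a) (o 0%N) = o k.
  elim: k => [|k IH] hk; first by rewrite take0 big_nil perm1.
  rewrite (take_nth l0) // -cats1 big_cat big_seq1 /= permM IH; last exact: ltnW.
  have /extendsP fQk := fQ (l k).1.
  rewrite /letter_val -/(l k); case: ifP => E.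
    have kQ : (o k.+1, o k) \in Q (l k).1.
      by rewrite inE; apply/existsP; exists (Ordinal hk); rewrite eqxx E eqxx.
    by have /= <- := fQk _ kQ; rewrite permK.
  have kQ : (o k, o k.+1) \in Q (l k).1.
    by rewrite inE; apply/existsP; exists (Ordinal hk); rewrite eqxx E eqxx.
  by have /= -> := fQk _ kQ.
have := step n (leqnn n); rewrite take_size -/(flift f w) fw1 perm1 => /eqP.
by rewrite oE // => /eqP e; rewrite -e in n0.
Qed.

End ResidualFiniteness.

(** * Bases of subgroups of free groups *)

Section Representatives.
Variables (T : finType) (R : rel T).
Hypotheses (Rxx : reflexive R) (Rsym : symmetric R) (Rtr : transitive R).

(** The quotient is realised inside [T] by an idempotent map, so that classes are counted as its
    fixed points. *)
Definition class_rep p := odflt p [pick q | R p q].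

Lemma class_rep_rel p : R p (class_rep p).
Proof. by rewrite /class_rep; case: pickP => //=. Qed.

Lemma class_repP p q : (class_rep p == class_rep q) = R p q.
Proof.
apply/eqP/idP => [e|Rpq].
  by apply: (Rtr (class_rep_rel p)); rewrite e Rsym class_rep_rel.
have E : R p =1 R q.
  by move=> x; apply/idP/idP; apply: Rtr => //; rewrite Rsym.
rewrite /class_rep (eq_pick E); case: pickP => //= /(_ q); by rewrite Rxx.
Qed.

Lemma class_rep_idem p : class_rep (class_rep p) = class_rep p.
Proof. by apply/eqP; rewrite class_repP Rsym class_rep_rel. Qed.

End Representatives.

Lemma path_colors_rep n (R : rel 'I_n) (C : eqType) (c : nat -> C) :
  reflexive R -> symmetric R -> transitive R ->
  (forall p q : 'I_n, (c p == c q) = R p q) ->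
  path_colors c (iota 0 n) = #|[set p | class_rep R p == p]|.
Proof.
move=> Rxx Rsym Rtr cR; rewrite /path_colors -val_enum_ord -map_comp.
rewrite cardE -(size_map (c \o val)); apply/perm_size/uniq_perm.
- exact: undup_uniq.
- rewrite map_inj_in_uniq ?enum_uniq // => p q; rewrite !mem_enum !inE.
  move=> /eqP ep /eqP eq /= /eqP; rewrite cR -(class_repP Rxx Rsym Rtr) ep eq.
  by move/eqP.
move=> x; rewrite mem_undup; apply/mapP/mapP => [[p _ ->]|[p _ ->]].
  exists (class_rep R p); first by rewrite mem_enum inE class_rep_idem.
  by apply/eqP; rewrite /= cR class_rep_rel.
by exists p; rewrite ?mem_enum.
Qed.

Lemma sum_leq_eq (X : finType) (F : X -> nat) M :
  (forall x, F x <= M)%N -> (\sum_x F x = #|X| * M)%N -> forall x, F x = M.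
Proof.
move=> FM sF x; apply/eqP; rewrite eqn_leq FM leqNgt; apply/negP => lt.
have : (\sum_x F x < \sum_(x : X) M)%N.
  rewrite [ltnLHS](bigD1 x) //= [ltnRHS](bigD1 x) //= -addSn leq_add //.
  by apply: leq_sum.
by rewrite sum_nat_const sF ltnn.
Qed.

Section SchreierPath.
Local Open Scope group_scope.
Local Open Scope classical_set_scope.
Variables (I : choiceType) (lett : nat -> I * bool) (A : nat -> free_group I).
Hypothesis AS : forall p, A p.+1 = A p * lval (lett p).

(* [A] is a path in the Cayley graph with successive labels [lett]; its [p]-th edge,
   oriented along the generator [lgen p], runs from [A (lsrc p)] to [A (ltgt p)].
   [vrel] and [erel] identify the vertices and edges with the same image in the
   Schreier graph of [K]. *)
Definition lsrc p := (p + (lett p).2)%N.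
Definition ltgt p := (p + ~~ (lett p).2)%N.
Definition lgen p := (lett p).1.

Lemma A_ltgt p : A (ltgt p) = A (lsrc p) * fgen (lgen p).
Proof.
rewrite /ltgt /lsrc /lgen; have := AS p; rewrite /lval /letter_val.
by case: (lett p) => i [] /= e; rewrite ?addn0 ?addn1 e // mulgVK.
Qed.

Variables (K : set (free_group I)) (T : nat).
Hypothesis gK : is_subgroup K.

Definition erel (p q : nat) :=
  (lgen p == lgen q) && `[< K (A (lsrc p) * (A (lsrc q))^-1) >].
Definition vrel (p q : nat) := `[< K (A p * (A q)^-1) >].

Lemma vrelxx : reflexive vrel.
Proof. by move=> p; apply/asboolP; rewrite mulgV; exact: subgroup1. Qed.
Lemma vrel_sym : symmetric vrel.
Proof. by move=> p q; apply/asboolP/asboolP; exact: subgroup_divC. Qed.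
Lemma vrel_trans : transitive vrel.
Proof. by move=> q p r /asboolP h1 /asboolP h2; apply/asboolP; exact: subgroup_div_trans h1 h2. Qed.

Lemma erelE p q : erel p q = (lgen p == lgen q) && vrel (lsrc p) (lsrc q).
Proof. by []. Qed.
Lemma erelxx : reflexive erel.
Proof. by move=> p; rewrite erelE eqxx vrelxx. Qed.
Lemma erel_sym : symmetric erel.
Proof. by move=> p q; rewrite !erelE eq_sym vrel_sym. Qed.
Lemma erel_trans : transitive erel.
Proof.
move=> q p r; rewrite !erelE => /andP[/eqP-> h1] /andP[-> h2]; exact: vrel_trans h1 h2.
Qed.

Lemma erel_tgt p q : erel p q -> vrel (ltgt p) (ltgt q).
Proof.
move=> /andP[/eqP e /asboolP h]; apply/asboolP; rewrite !A_ltgt e invgM.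
by rewrite -mulgA (mulgA (fgen _)) mulgV mul1g.
Qed.

Lemma erel_sound p q (C : eqType) (c : nat -> C) :
  (lgen p = lgen q) -> c (lsrc p) = c (lsrc q) -> c (ltgt p) = c (ltgt q) ->
  edge_sound A c p q.
Proof.
rewrite /lgen /lsrc /ltgt; have := AS p; have := AS q; rewrite /lval /letter_val.
case: (lett p) (lett q) => [i b] [j b'] /= aq ap eij; rewrite eij in ap * => {i eij}.
case: b ap => ap; case: b' aq => aq; rewrite ?addn0 ?addn1 => c1 c2.
- by left; split=> //; rewrite aq ap !mulKg.
- by right; split=> //; rewrite aq ap mulKg invgM -mulgA mulVg mulg1.
- by right; split=> //; rewrite aq ap mulKg invgM invgK -mulgA mulVg mulg1.
- by left; split=> //; rewrite aq ap !mulKg.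
Qed.

Section Cocycle.
Variables (Q : groupType) (sg : 'I_T -> Q).

Definition ecolor : 'I_T -> 'I_T := class_rep (fun p q : 'I_T => erel p q).

Lemma ecolorP (p q : 'I_T) : (ecolor p == ecolor q) = erel p q.
Proof.
apply: class_repP => [p'|p' q'|q' p' r'].
- exact: erelxx.
- exact: erel_sym.
- exact: erel_trans.
Qed.

(* Edges of the Schreier graph which the path does not traverse are labelled by 1. *)
Definition ext_color (x : free_group I) (i : I) : Q :=
  if [pick p : 'I_T | (i == lgen p) && `[< K (x * (A (lsrc p))^-1) >]] is Some p
  then sg (ecolor p) else 1.

(** A letter read from the coset of [x] contributes the label of the edge that it crosses, inverted
    if the edge is crossed backwards. *)
Definition cocycle1 x (l : I * bool) : Q :=
  if l.2 then (ext_color (x * (fgen l.1)^-1) l.1)^-1 else ext_color x l.1.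

Fixpoint cocycle_seq x (w : seq (I * bool)) : Q :=
  if w is l :: w' then cocycle1 x l * cocycle_seq (x * lval l) w' else 1.

Definition cocycle x (w : free_group I) := cocycle_seq x (fword w).

Lemma ext_colorK h x i : K h -> ext_color (h * x) i = ext_color x i.
Proof.
move=> Kh; rewrite /ext_color; set P := (X in [pick p | X p]).
suff E : P =1 (fun p : 'I_T => (i == lgen p) && `[< K (x * (A (lsrc p))^-1) >]).
  by rewrite (eq_pick E).
move=> p; rewrite /P; congr (_ && _); apply/asboolP/asboolP; rewrite -mulgA => Kx.
  by rewrite -[X in K X](mulKg h); apply: subgroupM => //; exact: subgroupV.
exact: subgroupM.
Qed.

Lemma cocycle1K h x l : K h -> cocycle1 (h * x) l = cocycle1 x l.
Proof.
by move=> Kh; rewrite /cocycle1 -mulgA (ext_colorK _ _ Kh) (ext_colorK _ _ Kh).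
Qed.

Lemma cocycle_seqK h x w : K h -> cocycle_seq (h * x) w = cocycle_seq x w.
Proof.
by move=> Kh; elim: w x => //= l w IH x; rewrite cocycle1K // -mulgA IH.
Qed.

Lemma cocycle1_linv x l : cocycle1 x l * cocycle1 (x * lval l) (linv l) = 1.
Proof.
by case: l => i []; rewrite /cocycle1 /lval /letter_val /linv /= ?mulgK ?mulVg ?mulgV.
Qed.

(** A letter and its inverse cross one edge in both directions, so free reduction does not change
    the value. *)
Lemma cocycle_push x l w : cocycle_seq x (push l w) = cocycle_seq x (l :: w).
Proof.
case: w => //= l' w; case: eqP => [->|//].
by rewrite mulgA cocycle1_linv mul1g lval_linv mulgK.
Qed.

Lemma cocycleM x w w' : cocycle x (w * w') = cocycle x w * cocycle (x * w) w'.
Proof.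
rewrite /cocycle fwordM -{3}(prod_lval w); elim: (fword w) x => [|l s IH] x /=.
  by rewrite big_nil mul1g mulg1.
by rewrite cocycle_push /= IH big_cons !mulgA.
Qed.

Lemma cocycle_lval x l : cocycle x (lval l) = cocycle1 x l.
Proof. by rewrite /cocycle fword_lval /= mulg1. Qed.

(** The conjugation moves the base point to [A 0]: from the coset of [A 0] the conjugated word is a
    closed walk exactly when [h] is in [K]. *)
Definition holonomy h := cocycle (A 0) ((A 0)^-1 * h * A 0).

Lemma holonomyM h h' : K h -> holonomy (h * h') = holonomy h * holonomy h'.
Proof.
move=> Kh; rewrite /holonomy.
have -> : (A 0)^-1 * (h * h') * A 0 = ((A 0)^-1 * h * A 0) * ((A 0)^-1 * h' * A 0).
  by rewrite !mulgA mulgK.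
rewrite cocycleM; congr (_ * _).
by rewrite -mulgA mulVKg; exact: cocycle_seqK.
Qed.

Definition gauge p := cocycle (A 0) ((A 0)^-1 * A p).

Lemma gauge0 : gauge 0 = 1.
Proof. by rewrite /gauge mulVg. Qed.

(** The gauge is thus the partial product of the labels along the path, which later identifies the
    holonomy of the word with a product of random permutations. *)
Lemma gaugeS (p : 'I_T) : gauge p.+1 =
  gauge p * (if (lett p).2 then (sg (ecolor p))^-1 else sg (ecolor p)).
Proof.
rewrite /gauge AS mulgA cocycleM mulVKg cocycle_lval; congr (_ * _).
have key x : x = A (lsrc p) -> ext_color x (lgen p) = sg (ecolor p).
  move=> ->; rewrite /ext_color; case: pickP => [q /andP[/eqP e /asboolP h]|/(_ p)].
    congr sg; apply/eqP; rewrite eq_sym ecolorP erelE e eqxx; exact/asboolP.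
  by rewrite eqxx /= (introT (asboolP _)) // mulgV; exact: subgroup1.
have := AS p; rewrite /lsrc /lgen /lval /letter_val /cocycle1 in key *.
case: (lett p) key => i [] /= key e; rewrite key ?addn0 //.
by rewrite addn1 e.
Qed.

Lemma gauge_vrel p q : vrel p q -> gauge p = holonomy (A p * (A q)^-1) * gauge q.
Proof.
move=> /asboolP h; rewrite /gauge /holonomy.
have -> : (A 0)^-1 * A p = ((A 0)^-1 * (A p * (A q)^-1) * A 0) * ((A 0)^-1 * A q).
  by rewrite !mulgA mulgK mulgKV.
rewrite cocycleM; congr (_ * _).
by rewrite -mulgA mulVKg; exact: cocycle_seqK.
Qed.

End Cocycle.

(** That these generate [K] means that the traversed part of the Schreier graph carries its whole
    fundamental group. *)
Definition path_loops : set (free_group I) :=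
  [set x | exists p q, [/\ (p <= T)%N, (q <= T)%N, K (A p * (A q)^-1) & x = A p * (A q)^-1]].

Hypothesis Kgen : K `<=` gensub path_loops.

Definition vcolor (p : 'I_T.+1) : 'I_T.+1 := class_rep (fun p q : 'I_T.+1 => vrel p q) p.

Lemma vcolorP (p q : 'I_T.+1) : (vcolor p == vcolor q) = vrel p q.
Proof.
apply: class_repP => [p'|p' q'|q' p' r'].
- exact: vrelxx.
- exact: vrel_sym.
- exact: vrel_trans.
Qed.

Lemma vrel_vcolor (p : 'I_T.+1) : vrel p (vcolor p).
Proof. exact: (@class_rep_rel _ (fun p q : 'I_T.+1 => vrel p q) (fun q => vrelxx q)). Qed.

Lemma vcolor_idem (p : 'I_T.+1) : vcolor (vcolor p) = vcolor p.
Proof. by apply/eqP; rewrite vcolorP vrel_sym vrel_vcolor. Qed.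

Lemma path_loop_generators : exists gs : seq (free_group I),
  [/\ (size gs + #|[set p | vcolor p == p]%SET| <= #|[set p | ecolor p == p]%SET| + 1)%N,
      (forall x, x \in gs -> K x) & K `<=` gensub [set x | x \in gs]].
Proof.
(* Positions outside the path get the colour [None]; they are never compared. *)
pose c p := omap vcolor (insub p); pose d p := omap ecolor (insub p).
have cE (p q : nat) : (p <= T)%N -> (q <= T)%N -> (c p == c q) = vrel p q.
  by rewrite -ltnS => hp; rewrite -ltnS => hq; rewrite /c !insubT /=; exact: vcolorP.
have dE (p q : nat) : (p < T)%N -> (q < T)%N -> (d p == d q) = erel p q.
  move=> hp hq; rewrite /d !insubT /=; exact: ecolorP.
have ltS b : (b <= 1)%N -> forall p, (p < T)%N -> (p + b <= T)%N by lia.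
have [|gs [szgs gsP gsgen]] := @path_generators _ _ _ A c d 0 T.
  rewrite add0n => p q /= hp hq /eqP; rewrite dE // => epq.
  have hb b : ((b : bool) <= 1)%N by case: b.
  apply: erel_sound; first by have /andP[/eqP] := epq.
    apply/eqP; rewrite cE; first by have /andP[] := epq.
      exact: ltS.
    exact: ltS.
  apply/eqP; rewrite cE; first exact: erel_tgt.
    exact: ltS.
  exact: ltS.
exists gs; split.
- move: szgs; rewrite (@path_colors_rep _ (fun p q : 'I_T.+1 => vrel p q)); last first.
  + by move=> p q; rewrite cE // -ltnS.
  + by move=> q p r; exact: vrel_trans.
  + by move=> p q; exact: vrel_sym.
  + by move=> p; exact: vrelxx.
  rewrite (@path_colors_rep _ (fun p q : 'I_T => erel p q)); last first.
  + by move=> p q; rewrite dE.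
  + by move=> q p r; exact: erel_trans.
  + by move=> p q; exact: erel_sym.
  + by move=> p; exact: erelxx.
  exact: id.
- move=> x /gsP[p [q [/= hp hq /eqP + ->]]]; rewrite add0n in hp hq.
  by rewrite cE // => /asboolP.
move=> x /Kgen; apply: gensub_min; first exact: gensub_subgroup.
move=> _ [p [q [hp hq Kpq ->]]]; apply: gsgen; rewrite ?add0n //.
by apply/eqP; rewrite cE //; exact/asboolP.
Qed.

(* The path generates [K] by E - V + 1 = k loops. Gauge fixing bounds each fibre of
   [sg |-> holonomy sg] by |Q|^(T - k), and there are only |Q|^k fibres, so all bounds
   are equalities. Hence any k values in any finite group are attained by a
   homomorphism, and residual finiteness makes the k generators free. *)
Theorem schreier_basis : exists k (b : 'I_k -> free_group I),
  [/\ injective (flift b), range (flift b) = K &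
   forall (Q : finGroupType) (tau : {ffun 'I_k -> Q}),
     (#|[set sg : {ffun 'I_T -> Q} | [forall i, holonomy sg (b i) == tau i]]%SET|
        * #|Q| ^ k = #|Q| ^ T)%N].
Proof.
have [gs [szgs gsK Kgs]] := path_loop_generators.
pose k := size gs; pose b (i : 'I_k) := nth 1 gs i.
have bK i : K (b i) by apply: gsK; exact: mem_nth.
have uni (Q : finGroupType) (tau : {ffun 'I_k -> Q}) :
   (#|[set sg : {ffun 'I_T -> Q} | [forall i, holonomy sg (b i) == tau i]]%SET|
        * #|Q| ^ k = #|Q| ^ T)%N.
  pose F (t : {ffun 'I_k -> Q}) :=
    [set sg : {ffun 'I_T -> Q} | [forall i, holonomy sg (b i) == t i]]%SET.
  pose v0 := vcolor ord0.
  (* [D] indexes data that determine [sg] once the holonomy is known: the labels of the edges that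
     do not represent their class, which no walk sees, and the gauge at one vertex per class except
     that of position 0, where it is already determined. There are (T - E) + (V - 1) of them. *)
  pose D := [predU [pred x : 'I_T + 'I_T.+1 | if x is inl p then ecolor p != p else false] &
     [pred x | if x is inr p then (vcolor p == p) && (p != v0) else false]].
  have DE : (#|D| + k <= T)%N.
    have -> : #|D| = (#|[set p | ecolor p != p]%SET| + #|[set p | vcolor p == p]%SET :\ v0|)%N.
      rewrite -!sum1_card big_sumType /=.
      congr (_ + _)%N; apply: eq_bigl => p; rewrite !inE ?orbF //= andbC //.
    have := cardsD1 v0 [set p | vcolor p == p]%SET; rewrite inE.
    have -> : vcolor v0 == v0 by rewrite vcolor_idem.
    have := cardsC [set p | ecolor p == p]%SET; rewrite card_ord.
    have -> : ~: [set p | ecolor p == p]%SET = [set p | ecolor p != p]%SET.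
      by apply/setP => p; rewrite !inE.
    by move: szgs; rewrite -/k; lia.
  have inj t : (#|F t| <= #|Q| ^ #|D|)%N.
    pose h (sg : {ffun 'I_T -> Q}) : {ffun 'I_T + 'I_T.+1 -> Q} :=
      [ffun x => if x \in D then
         (match x with inl p => sg p | inr p => gauge sg p end) else 1].
    have <- : #|pffun_on (1 : Q) D predT| = (#|Q| ^ #|D|)%N by rewrite card_pffun_on.
    rewrite -(card_in_imset (f := h)); last first.
      move=> s1 s2; rewrite !inE => /forallP h1 /forallP h2 /ffunP e12.
      have hol x : K x -> holonomy s1 x = holonomy s2 x.
        have gH : is_subgroup [set x | K x /\ holonomy s1 x = holonomy s2 x].
          apply/is_subgroupP; split.
            split; first exact: subgroup1.
            by rewrite /holonomy mulg1 mulVg.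
          move=> y z [Ky ey] [Kz ez].
          have Kz' : K z^-1 by exact: subgroupV.
          split; first exact: subgroupM.
          rewrite !holonomyM // ey; congr (_ * _).
          apply: (mulgI (holonomy s1 z)); rewrite {2}ez -!holonomyM // mulgV.
          by rewrite /holonomy mulg1 mulVg.
        move=> /Kgs gx; suff sub : [set y | y \in gs] `<=`
            [set y | K y /\ holonomy s1 y = holonomy s2 y].
          by case: (gensub_min gH sub gx).
        move=> _ /(nthP 1)[i hi <-].
        split; first by apply: gsK; exact: mem_nth.
        by have := h1 (Ordinal hi); have := h2 (Ordinal hi); rewrite /b /= => /eqP-> /eqP->.
      have g12 p : (p <= T)%N -> gauge s1 p = gauge s2 p.
        rewrite -ltnS => hp; pose p' := Ordinal hp; rewrite -[p]/(val p').
        have vr : vrel p' (vcolor p').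
          exact: vrel_vcolor.
        rewrite (gauge_vrel s1 vr) (gauge_vrel s2 vr) hol; last exact/asboolP.
        congr (_ * _); have [e0|ne] := eqVneq (vcolor p') v0.
          have vr0 : vrel (ord0 : 'I_T.+1) v0 by exact: vrel_vcolor.
          rewrite e0; apply: (mulgI (holonomy s1 (A 0 * (A v0)^-1))).
          rewrite -(gauge_vrel s1 vr0) hol; last exact/asboolP.
          by rewrite -(gauge_vrel s2 vr0) !gauge0.
        have := e12 (inr (vcolor p')); rewrite !ffunE !inE /=.
        by rewrite vcolor_idem eqxx ne.
      apply/ffunP => p; have [ep|ne] := eqVneq (ecolor p) p; last first.
        by have := e12 (inl p); rewrite !ffunE !inE /= ne.
      have := g12 p.+1 (ltn_ord p); rewrite !gaugeS g12 ?(ltnW (ltn_ord p)) // ep.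
      by move/mulgI; case: ifP => _ // /invg_inj.
    apply: subset_leq_card; apply/fintype.subsetP => _ /imsetP[sg _ ->].
    apply/pffun_onP; split; last by [].
    apply/fintype.subsetP => x; rewrite inE ffunE; case: ifP => //=.
    by rewrite eqxx.
  have sF : (\sum_t #|F t| = #|Q| ^ T)%N.
    have -> : (#|Q| ^ T = \sum_(sg : {ffun 'I_T -> Q}) 1)%N.
      by rewrite sum1_card card_ffun card_ord.
    rewrite (partition_big (fun sg : {ffun 'I_T -> Q} => [ffun i => holonomy sg (b i)])
      predT) //=.
    apply: eq_bigr => t _; rewrite -sum1_card; apply: eq_bigl => sg; rewrite inE.
    apply/forallP/eqP => [H|<- i]; last by rewrite ffunE.
    by apply/ffunP => i; rewrite ffunE; apply/eqP.
  have Q0 : (0 < #|Q|)%N by apply/card_gt0P; exists 1.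
  have DkT : (#|Q| ^ T <= #|Q| ^ #|D| * #|Q| ^ k)%N.
    rewrite -sF; have -> : (#|Q| ^ k = #|{ffun 'I_k -> Q}|)%N by rewrite card_ffun card_ord.
    rewrite mulnC -sum_nat_const.
    by apply: leq_sum => t _; exact: inj.
  have eT : (#|Q| ^ T = #|Q| ^ #|D| * #|Q| ^ k)%N.
    apply/eqP; rewrite eqn_leq DkT -expnD /= leq_pexp2l //.
  have -> : #|[set sg : {ffun 'I_T -> Q} | [forall i, holonomy sg (b i) == tau i]]%SET|
     = (#|Q| ^ #|D|)%N; last by rewrite eT.
  apply: (sum_leq_eq (F := fun t => #|F t|)); first exact: inj.
  by rewrite sF eT card_ffun card_ord mulnC.
exists k, b; split=> //.
  apply: flift_inj => w fw; apply: contrapT => /free_group_residually_finite[N [f fw1]].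
  pose tau := [ffun i => f i : 'S_N].
  have : (0 < #|[set sg : {ffun 'I_T -> 'S_N} | [forall i, holonomy sg (b i) == tau i]]%SET|)%N.
    rewrite lt0n; apply/negP => /eqP e0; have := uni _ tau; rewrite e0 mul0n.
    move=> eT; have : (0 < #|'S_N| ^ T)%N by rewrite expn_gt0; apply/orP; left;
      apply/card_gt0P; exists 1.
    by rewrite -eT.
  case/card_gt0P => sg; rewrite inE => /forallP sgP; apply: fw1.
  have := flift_hom gK bK (h := holonomy sg) (fun x y Kx _ => holonomyM sg y Kx) w.
  rewrite fw (eq_flift (g := f)) => [<-|i]; last by rewrite /= (eqP (sgP i)) ffunE.
  by rewrite /holonomy mulg1 mulVg.
apply/seteqP; split=> [_ [w _ <-]|x /Kgs]; first exact: flift_gensub.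
apply: gensub_min.
  apply/is_subgroupP; split; first by exists 1; rewrite // flift1.
  by move=> _ _ [y _ <-] [z _ <-]; exists (y * z^-1); rewrite // fliftM fliftV.
move=> _ /(nthP 1)[i hi <-]; exists (fgen (Ordinal hi)) => //.
by rewrite flift_gen.
Qed.

End SchreierPath.

Section BasesAndTuples.
Local Open Scope group_scope.
Local Open Scope classical_set_scope.

Lemma flift_reindex (I J : choiceType) (G : groupType) (f : I -> G) (h : J -> I)
    (h' : I -> J) : cancel h h' -> cancel h' h ->
  (injective (flift f) -> injective (flift (f \o h))) /\
  range (flift (f \o h)) = range (flift f).
Proof.
move=> hK h'K.
have E w : flift (f \o h) w = flift f (flift (fgen (I:=I) \o h) w).
  by rewrite (flift_comp _ (fliftM f)); apply: eq_flift => j /=; rewrite flift_gen.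
have E' w : flift (fgen (I:=J) \o h') (flift (fgen (I:=I) \o h) w) = w.
  rewrite (flift_comp _ (fliftM _)) -[RHS]prod_lval; apply: eq_bigr => l _.
  by rewrite /lval /letter_val /= flift_gen /= hK.
have E'' w : flift (fgen (I:=I) \o h) (flift (fgen (I:=J) \o h') w) = w.
  rewrite (flift_comp _ (fliftM _)) -[RHS]prod_lval; apply: eq_bigr => l _.
  by rewrite /lval /letter_val /= flift_gen /= h'K.
split=> [fI u v|]; first by rewrite !E => /fI e; rewrite -(E' u) e E'.
apply/seteqP; split=> _ [w _ <-]; first by exists (flift (fgen (I:=I) \o h) w).
by exists (flift (fgen (I:=J) \o h') w) => //; rewrite E E''.
Qed.

Lemma tuple_basis (G : groupType) (k : nat) (b : 'I_k -> G) (K : set G) :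
  injective (flift b) -> range (flift b) = K ->
  has_rank K k /\ forall i, primitive_in K (b i).
Proof.
move=> bI bK.
have b_inj : injective b.
  move=> i j bij; have : fgen i = fgen j by apply: bI; rewrite !flift_gen.
  by move/(congr1 (@fword _)) => [].
pose B := range b.
have /boolp.choice[h hP] : forall x : B, exists i, b i = val x.
  by move=> x; have := valP x; rewrite inE => -[i _ <-]; exists i.
pose h' i : B := SigSub (mem_set (imageT b i)).
have hK : cancel h h' by move=> x; apply: val_inj; rewrite /= hP.
have h'K : cancel h' h by move=> i; apply: b_inj; rewrite hP.
have basis : is_basis B K.
  have [inj rg] := flift_reindex b hK h'K.
  have E : (fun x : B => val x : G) = b \o h by apply/funext => x /=; rewrite hP.
  by rewrite /is_basis E; split; [exact: inj|rewrite rg].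
split; last by move=> i; exists B => //; exists i.
exists B => //; have /card_eq_trans : (B #= [set: 'I_k])%card.
  by apply: inj_card_eq => i j _ _; exact: b_inj.
by apply; rewrite card_eq_sym; exact: card_II.
Qed.

End BasesAndTuples.

Section Coordinates.
Local Open Scope group_scope.
Local Open Scope classical_set_scope.
Variables (G : groupType) (J : choiceType) (b : J -> G) (K : set G).
Hypotheses (bI : injective (flift b)) (bK : range (flift b) = K).

Lemma coordinates : exists c : G -> free_group J,
  [/\ (forall x, K x -> flift b (c x) = x), (forall w, c (flift b w) = w),
      (forall i, c (b i) = fgen i) &
      forall x y, K x -> K y -> c (x * y) = c x * c y].
Proof.
have /boolp.choice[c cP] : forall x, exists w, K x -> flift b w = x.
  move=> x; have [Kx|nKx] := pselect (K x); last by exists 1.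
  by have := Kx; rewrite -bK => -[w _ <-]; exists w.
have Kr w : K (flift b w) by rewrite -bK; exists w.
have cK w : c (flift b w) = w by apply: bI; rewrite cP.
exists c; split=> // [i|x y Kx Ky]; first by rewrite -(flift_gen b) cK.
by rewrite -{1}(cP _ Kx) -{1}(cP _ Ky) -fliftM cK.
Qed.

End Coordinates.

Section PrimitiveUniform.
Local Open Scope group_scope.
Local Open Scope classical_set_scope.
Variables (G : groupType) (k : nat) (b : 'I_k -> G) (K : set G) (w0 : G).
Hypotheses (gK : is_subgroup K) (bI : injective (flift b)) (bK : range (flift b) = K).
Hypothesis prim : primitive_in K w0.

(* Multiplying the value of [w0] in a basis containing it permutes the homomorphisms. *)
Lemma primitive_word_uniform (x : free_group 'I_k) (Q : finGroupType) (q : Q) :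
  flift b x = w0 ->
  (#|[set tau : {ffun 'I_k -> Q} | flift tau x == q]%SET| * #|Q| = #|Q| ^ k)%N.
Proof.
case: prim => B [BI BK] Bw0 xw0.
set ev := fun c : B => val c : G in BI BK.
have [c [cP cK cb cM]] := coordinates bI bK.
have [d [dP dK db dM]] := coordinates BI BK.
have Kb i : K (b i) by rewrite -bK; exists (fgen i); rewrite ?flift_gen.
have KB (i : B) : K (ev i) by rewrite -BK; exists (fgen i); rewrite ?flift_gen.
pose w0B : B := SigSub (mem_set Bw0).
(* In the basis [B] the homomorphism is kept except at [w0], whose value is multiplied by [r] on the
   right. *)
pose f r (t : {ffun 'I_k -> Q}) (i : B) := flift t (c (ev i)) * (if i == w0B then r else 1).
pose shift r t : {ffun 'I_k -> Q} := [ffun i => flift (f r t) (d (b i))].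
have shiftE r t y : K y -> flift (shift r t) (c y) = flift (f r t) (d y).
  move=> Ky; rewrite -{2}(cP y Ky).
  rewrite (flift_hom gK Kb (h := fun y => flift (f r t) (d y))).
    by apply: eq_flift => i; rewrite ffunE.
  by move=> y1 y2 K1 K2; rewrite dM // fliftM.
have cx : c w0 = x by rewrite -xw0 cK.
have shift_val r t : flift (shift r t) x = flift t x * r.
  rewrite -cx shiftE; last by rewrite -xw0 -bK; exists x.
  have -> : w0 = ev w0B by [].
  by rewrite db flift_gen /f eqxx.
have shiftK r : cancel (shift r) (shift r^-1).
  move=> t; apply/ffunP => i; rewrite ffunE.
  have -> : t i = flift t (c (b i)) by rewrite cb flift_gen.
  rewrite -[b i in RHS](dP _ (Kb i)).
  rewrite (flift_hom gK KB (h := fun y => flift t (c y))).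
    apply: eq_flift => j; rewrite /f /= shiftE // db flift_gen /f.
    by case: eqP => _; rewrite ?mulg1 ?mulgK.
  by move=> y1 y2 K1 K2; rewrite cM // fliftM.
pose n q := #|[set tau : {ffun 'I_k -> Q} | flift tau x == q]%SET|.
have nle q1 r : (n q1 <= n (q1 * r)%g)%N.
  rewrite /n -(card_imset _ (can_inj (shiftK r))); apply/subset_leq_card.
  apply/fintype.subsetP => y /imsetP[t]; rewrite inE => /eqP tq ->.
  by rewrite inE shift_val tq.
have nE q1 : n q1 = n q.
  apply/eqP; rewrite eqn_leq; apply/andP; split.
    by have := nle q1 (q1^-1 * q); rewrite mulVKg.
  by have := nle q (q^-1 * q1); rewrite mulVKg.
have <- : #|{ffun 'I_k -> Q}| = (#|Q| ^ k)%N by rewrite card_ffun card_ord.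
rewrite -[RHS]sum1_card (partition_big (fun t : {ffun 'I_k -> Q} => flift t x) predT) //=.
rewrite (eq_bigr (fun=> n q)) => [|q1 _]; first by rewrite sum_nat_const mulnC.
by rewrite -(nE q1) /n -sum1_card; apply: eq_bigl => t; rewrite inE.
Qed.

End PrimitiveUniform.

Section RankOfGenerated.
Local Open Scope group_scope.
Local Open Scope classical_set_scope.
Variables (I : choiceType) (l0 : I * bool).

(* The path reading the concatenation of all the words yields a basis; counting
   homomorphisms to finite groups bounds its size by [size gs], and in case of equality
   shows that [gs] is a basis. *)
Theorem rank_gensub (gs : seq (free_group I)) :
  let K := gensub [set x | x \in gs] in
  exists m, [/\ has_rank K m, (m <= size gs)%N &
    m = size gs -> forall w, w \in gs -> primitive_in K w].
Proof.
move=> K; have gK : is_subgroup K by exact: gensub_subgroup.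
pose s := flatten [seq fword g | g <- gs].
pose lett p := nth l0 s p.
pose A p := \prod_(0 <= i < p) lval (lett i).
have AS p : A p.+1 = A p * lval (lett p) by rewrite /A big_nat_recr.
have Atake p : (p <= size s)%N -> A p = \prod_(l <- take p s) lval l.
  move=> hp; rewrite [in RHS](big_nth l0) size_takel // /A.
  by apply: eq_big_nat => i /andP[_ hi]; rewrite nth_take.
(* The path is in [K] at the end of each word, so every word is a quotient of two loops. *)
have Kgen : K `<=` gensub (path_loops A K (size s)).
  apply: gensub_min; first exact: gensub_subgroup.
  move=> _ /(nthP 1)[i hi <-].
  pose n j := size (flatten [seq fword g | g <- take j gs]).
  have sE j : s = flatten [seq fword g | g <- take j gs] ++ flatten [seq fword g | g <- drop j gs].
    by rewrite -flatten_cat -map_cat cat_take_drop.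
  have nS j : (n j <= size s)%N by rewrite (sE j) size_cat leq_addr.
  have An j : A (n j) = \prod_(g <- take j gs) g.
    rewrite Atake // (sE j) take_size_cat //.
    elim: (take j gs) => [|g r IH] /=; first by rewrite !big_nil.
    by rewrite big_cat big_cons /= IH prod_lval.
  have KA j : K (A (n j)).
    rewrite An; elim: j => [|j IH]; first by rewrite take0 big_nil; exact: subgroup1.
    have [hj|hj] := ltnP j (size gs); last by move: IH; rewrite !take_oversize // leqW.
    rewrite (take_nth 1) // -cats1 big_cat big_seq1 /=; apply: (subgroupM gK) => //.
    by apply: sub_gensub; exact: mem_nth.
  have gg := gensub_subgroup (path_loops A K (size s)).
  have LA j : gensub (path_loops A K (size s)) (A (n j)).
    apply: sub_gensub; exists (n j), 0%N; rewrite [A 0%N]big_geq // invg1 mulg1.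
    by split.
  have -> : nth 1 gs i = (A (n i))^-1 * A (n i.+1).
    by rewrite !An (take_nth 1) // -cats1 big_cat big_seq1 /= mulKg.
  by apply: (subgroupM gg) => //; exact: (subgroupV gg).
have [m [b [bI bK _]]] := schreier_basis AS gK Kgen.
have Kb i : K (b i) by rewrite -bK; exists (fgen i); rewrite ?flift_gen.
have [c [cP cK cb cM]] := coordinates bI bK.
pose k := size gs; pose g (i : 'I_k) := nth 1 gs i.
have Kg i : K (g i) by apply: sub_gensub; exact: mem_nth.
(* Restriction to [gs] of the homomorphism given by [t] on the basis; it is injective because [gs]
   generates [K]. *)
pose h (Q : finGroupType) (t : {ffun 'I_m -> Q}) : {ffun 'I_k -> Q} :=
  [ffun i => flift t (c (g i))].
have hM (Q : finGroupType) (t : {ffun 'I_m -> Q}) x y : K x -> K y ->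
    flift t (c (x * y)) = flift t (c x) * flift t (c y).
  by move=> Kx Ky; rewrite cM // fliftM.
have hI Q : injective (@h Q).
  move=> t t' /ffunP htt'.
  have gH : is_subgroup [set x | K x /\ flift t (c x) = flift t' (c x)].
    have c1 : c 1 = 1 by rewrite -[1 in LHS](flift1 b) cK.
    apply/is_subgroupP; split; first by split; [exact: (subgroup1 gK)|rewrite c1 !flift1].
    move=> x y [Kx ex] [Ky ey]; have Ky' : K y^-1 by exact: (subgroupV gK).
    split; first exact: (subgroupM gK).
    rewrite !hM // ex; congr (_ * _); apply: (mulgI (flift t (c y))).
    by rewrite {2}ey -!hM // mulgV c1 !flift1.
  have sub : [set x | x \in gs] `<=` [set x | K x /\ flift t (c x) = flift t' (c x)].
    move=> _ /(nthP 1)[i hi <-]; split; first by apply: sub_gensub; exact: mem_nth.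
    by have := htt' (Ordinal hi); rewrite !ffunE.
  apply/ffunP => i; have [_] := gensub_min gH sub (Kb i).
  by rewrite cb !flift_gen.
have mk : (m <= k)%N.
  (* A group of order 2 turns the comparison of |Q|^m with |Q|^k into one of exponents. *)
  have := leq_card _ (hI 'S_2 : injective (@h 'S_2)).
  by rewrite !card_ffun !card_ord card_Sn /= leq_exp2l.
exists m; split=> //; first by have [] := tuple_basis bI bK.
move=> mk' w /(nthP 1)[i hi <-].
have gI : injective (flift g).
  apply: flift_inj => x gx; apply: contrapT => /free_group_residually_finite[N [f]].
  (* When the sizes agree, all values on [gs] extend to [K], so a relation among [gs] would hold in
     every symmetric group. *)
  have [h' hK h'K] : bijective (@h 'S_N).
    by apply: inj_card_bij; [exact: hI|rewrite !card_ffun !card_ord mk'].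
  apply; pose t := h' [ffun i => f i].
  have -> : flift f x = flift t (c (flift g x)).
    rewrite (flift_hom gK Kg (h := fun y => flift t (c y))) //.
      apply: eq_flift => j /=; have /ffunP/(_ j) := h'K [ffun i => f i].
      by rewrite !ffunE => ->.
    exact: hM.
  by rewrite gx -(flift1 b) cK flift1.
have gK' : range (flift g) = K.
  apply/seteqP; split=> [_ [x _ <-]|x]; first exact: flift_gensub.
  apply: gensub_min.
    apply/is_subgroupP; split; first by exists 1; rewrite // flift1.
    by move=> _ _ [y _ <-] [z _ <-]; exists (y * z^-1); rewrite // fliftM fliftV.
  move=> _ /(nthP 1)[j hj <-]; exists (fgen (Ordinal hj)) => //.
  by rewrite flift_gen.
by have [_ /(_ (Ordinal hi))] := tuple_basis gI gK'.
Qed.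

End RankOfGenerated.

(** * Stackings *)

Section CountColors.
Variable X : eqType.

Lemma size_undup_map_le (C D : eqType) (g : X -> C) (h : X -> D) (s : seq X) :
  {in s &, forall x y, g x = g y -> h x = h y} ->
  (size (undup (map h s)) <= size (undup (map g s)))%N.
Proof.
elim: s => //= x s IH gh.
have {}IH : (size (undup (map h s)) <= size (undup (map g s)))%N.
  by apply: IH => y z ys zs; apply: gh; rewrite in_cons ?ys ?zs orbT.
have [gx|gx] := boolP (g x \in map g s); case: ifP => hx //=; last exact: leqW.
case/mapP: gx => y ys gy; case/negP: hx.
by rewrite (gh x y) ?in_cons ?eqxx ?ys ?orbT //; exact: map_f.
Qed.

Lemma size_undup_map_eq (C D : eqType) (g : X -> C) (h : X -> D) (s : seq X) :
  {in s &, forall x y, (g x == g y) = (h x == h y)} ->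
  size (undup (map h s)) = size (undup (map g s)).
Proof.
move=> gh; apply/eqP; rewrite eqn_leq !size_undup_map_le // => x y xs ys /eqP.
  by rewrite -gh // => /eqP.
by rewrite gh // => /eqP.
Qed.

End CountColors.

Section Merging.
Variables (T K : finType) (st : T -> K) (p0 : K -> T) (C : eqType).
Hypothesis p0K : cancel p0 st.
Implicit Types (q : T -> C) (k : K) (S : {set K}).

Definition ncolors (D : eqType) (q : T -> D) := size (undup (map q (enum T))).
Lemma card_image_ncolors (D : finType) (q : T -> D) : #|[set q p | p : T]| = ncolors q.
Proof.
rewrite cardE; apply/perm_size/uniq_perm; rewrite ?enum_uniq ?undup_uniq // => x.
rewrite mem_enum mem_undup; apply/imsetP/mapP => -[p _ ->]; exists p => //.
by rewrite mem_enum.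
Qed.

Definition strand_colors (D : eqType) (q : T -> D) k :=
  size (undup [seq q p | p <- enum T & st p == k]).

(* All colours met by strand [k] are replaced by the one of its point [p0 k]. *)
Definition merge q k : T -> C :=
  fun x => if q x \in [seq q p | p <- enum T & st p == k] then q (p0 k) else q x.

Lemma ncolors_merge q k : (ncolors (merge q k) + strand_colors q k = ncolors q + 1)%N.
Proof.
set S := [seq q p | p <- enum T & st p == k]; set U := map q (enum T).
have SU : {subset S <= U}.
  by move=> c /mapP[p]; rewrite mem_filter => /andP[_ pT] ->; exact: map_f.
have q0S : q (p0 k) \in S by apply: map_f; rewrite mem_filter p0K eqxx mem_enum.
have -> : ncolors (merge q k) = size (q (p0 k) :: [seq c <- undup U | c \notin S]).
  apply/perm_size/uniq_perm => /=; first exact: undup_uniq.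
    by rewrite mem_filter q0S /= filter_uniq // undup_uniq.
  move=> c; rewrite mem_undup in_cons mem_filter mem_undup.
  apply/mapP/orP => [[x _ ->]|].
    rewrite /merge -/S; case: ifP => xS; [by left|right].
    by rewrite xS; apply: map_f; rewrite mem_enum.
  case=> [/eqP->|/andP[cS /mapP[x _ cx]]].
    by exists (p0 k); rewrite ?mem_enum // /merge -/S q0S.
  by exists x; rewrite ?mem_enum // /merge -/S -cx (negbTE cS).
have -> : strand_colors q k = count (mem S) (undup U).
  rewrite -size_filter; apply/perm_size/uniq_perm; rewrite ?undup_uniq ?filter_uniq ?undup_uniq //.
  move=> c; rewrite mem_undup mem_filter mem_undup; apply/idP/andP => [cS|[]//].
  by split=> //; exact: SU.
rewrite /= size_filter /ncolors -/U -(count_predC (mem S) (undup U)) addn1 addSn addnC.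
by congr (_ + _).+1; apply: eq_count.
Qed.

Definition mergeS q S : T -> C := foldl merge q (enum S).

(** Merging generates the smallest equivalence containing the old classes and the strand, so a map
    constant on both factors through it. *)
Lemma merge_min q k (D : eqType) (h : T -> D) :
  (forall x y, q x = q y -> h x = h y) ->
  (forall x y, st x = k -> st y = k -> h x = h y) ->
  forall x y, merge q k x = merge q k y -> h x = h y.
Proof.
move=> qh kh.
have E x : exists2 y, merge q k x = q y & h x = h y.
  rewrite /merge; case: ifP => [/mapP[p]|_]; last by exists x.
  rewrite mem_filter => /andP[/eqP pk _] qxp; exists (p0 k) => //.
  by rewrite (qh _ _ qxp); apply: kh.
by move=> x y; have [x' -> ->] := E x; have [y' -> ->] := E y; exact: qh.
Qed.

Lemma mergeS_min q S (D : eqType) (h : T -> D) :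
  (forall x y, q x = q y -> h x = h y) ->
  (forall k x y, k \in S -> st x = k -> st y = k -> h x = h y) ->
  forall x y, mergeS q S x = mergeS q S y -> h x = h y.
Proof.
move=> + Sh; have {}Sh : forall k x y, k \in enum S -> st x = k -> st y = k -> h x = h y.
  by move=> k x y; rewrite mem_enum; exact: Sh.
rewrite /mergeS; elim: (enum S) q Sh => //= k r IH q Sh qh.
apply: IH => [k' x y k'r|]; first by apply: Sh; rewrite in_cons k'r orbT.
by apply: merge_min => // x y; apply: Sh; rewrite mem_head.
Qed.

Lemma merge_strand q k x y : st x = k -> st y = k -> merge q k x = merge q k y.
Proof.
move=> xk yk; rewrite /merge !ifT //; apply: map_f;
  by rewrite mem_filter ?xk ?yk eqxx mem_enum.
Qed.

Lemma merge_color q k x y : q x = q y -> merge q k x = merge q k y.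
Proof. by rewrite /merge => ->. Qed.

Lemma mergeS_color q S x y : q x = q y -> mergeS q S x = mergeS q S y.
Proof.
rewrite /mergeS; elim: (enum S) q => //= k r IH q qxy.
by apply: IH; exact: merge_color.
Qed.

Lemma mergeS_strand q S k x y : k \in S -> st x = k -> st y = k ->
  mergeS q S x = mergeS q S y.
Proof.
rewrite -mem_enum /mergeS => + xk yk; elim: (enum S) q => //= k' r IH q.
rewrite in_cons => /orP[/eqP <-|kr]; last exact: IH.
elim: r (merge q k) (merge_strand q xk yk) {IH} => //= k'' r IH q' q'xy.
by apply: IH; exact: merge_color.
Qed.

(** The order of merging affects the colour that names a class but not the classes, hence the
    comparison of equalities. *)
Lemma mergeSU1 q S k x y :
  (merge (mergeS q S) k x == merge (mergeS q S) k y) =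
  (mergeS q (k |: S) x == mergeS q (k |: S) y).
Proof.
apply/eqP/eqP.
  apply: merge_min => [x' y'|x' y' xk yk].
    apply: mergeS_min => [x1 y1|k' x1 y1 k'S xk yk]; first exact: mergeS_color.
    by apply: (mergeS_strand _ _ xk yk); rewrite !inE k'S orbT.
  by apply: (mergeS_strand _ _ xk yk); rewrite !inE eqxx.
apply: mergeS_min => [x1 y1 q1|k' x1 y1]; first by apply/merge_color/mergeS_color.
rewrite !inE => /orP[/eqP->|k'S] xk yk; first exact: merge_strand.
by apply/merge_color; exact: (mergeS_strand _ k'S).
Qed.

Variable f : K -> nat.
Hypothesis f_inj : injective f.

Definition below k := [set j | (f j < f k)%N].

(* Merging the strands in the order [f] loses, at strand [k], the number of colours of
   [k] that are still distinct, minus one. *)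
Lemma ncolors_mergeS q :
  (ncolors (mergeS q [set: K]%SET) + \sum_k strand_colors (mergeS q (below k)) k = ncolors q + #|K|)%N.
Proof.
pose S n := [set j | (f j < n)%N].
have main n : (ncolors (mergeS q (S n)) +
    \sum_(k in S n) strand_colors (mergeS q (below k)) k = ncolors q + #|S n|)%N.
  elim: n => [|n IH].
    have -> : S 0%N = finset.set0 by apply/setP => j; rewrite !inE.
    by rewrite big_set0 cards0 /mergeS enum_set0.
  have [k /eqP kn|none] := pickP (fun k => f k == n); last first.
    suff -> : S n.+1 = S n by [].
    by apply/setP => j; have := none j; rewrite !inE ltnS leq_eqVlt => ->.
  have Sk : S n = below k by apply/setP => j; rewrite !inE kn.
  have kS : k \notin S n by rewrite inE kn ltnn.
  have -> : S n.+1 = k |: S n.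
    by apply/setP => j; rewrite !inE ltnS leq_eqVlt -kn (inj_eq f_inj).
  rewrite big_setU1 //= cardsU1 kS.
  have <- : ncolors (merge (mergeS q (S n)) k) = ncolors (mergeS q (k |: S n)).
    by apply/esym/size_undup_map_eq => x y _ _; exact: mergeSU1.
  by have := ncolors_merge (mergeS q (S n)) k; rewrite -Sk; move: IH; lia.
have ST : S (\max_j f j).+1 = [set: K]%SET by apply/setP => j; rewrite !inE ltnS leq_bigmax.
have := main (\max_j f j).+1; rewrite ST cardsT => <-; congr (_ + _)%N.
by apply: eq_bigl => k; rewrite inE.
Qed.

End Merging.

Section StackedCycle.
Variables (T K : finType) (st : T -> K) (p0 : K -> T) (t : nat).
Hypotheses (p0K : cancel p0 st) (t2 : (1 < t)%N).
Hypothesis size_strand : forall k, #|[set p | st p == k]| = t.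
Variables (V E : eqType) (qv : T -> V) (qe : T -> E).
Variables (src tgt : T -> T) (ssrc stgt nx : K -> K) (LG : eqType) (lg : K -> LG).
Hypotheses (st_src : forall p, st (src p) = ssrc (st p))
           (st_tgt : forall p, st (tgt p) = stgt (st p)).
Hypotheses (src_onto : forall k p, st p = ssrc k -> exists2 p', st p' = k & src p' = p)
           (tgt_onto : forall k p, st p = stgt k -> exists2 p', st p' = k & tgt p' = p).
Hypothesis qe_sound : forall p p', qe p = qe p' ->
  [/\ lg (st p) = lg (st p'), qv (src p) = qv (src p') & qv (tgt p) = qv (tgt p')].
Hypothesis qe_inj : forall p p', st p = st p' -> qe p = qe p' -> p = p'.
Variables (fV fE : K -> nat).
Hypotheses (fV_inj : injective fV) (fE_inj : injective fE).
Hypothesis fE_src : forall k j, lg k = lg j -> (fE k < fE j)%N -> (fV (ssrc k) < fV (ssrc j))%N.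
Hypothesis fE_tgt : forall k j, lg k = lg j -> (fE k < fE j)%N -> (fV (stgt k) < fV (stgt j))%N.
Hypothesis ends : forall k, (ssrc k = k /\ stgt k = nx k) \/ (ssrc k = nx k /\ stgt k = k).
Hypothesis nx_trans : forall k j, exists n, iter n nx k = j.
Variable k1 : K.

Let cV k := strand_colors st (mergeS st p0 qv (below fV k)) k.
Let cE k := strand_colors st (mergeS st p0 qe (below fE k)) k.

(** Edge strands merged before [k] with the same generator have ends merged before that of [k].
    Hence edges of [k] that have become equal have ends that have become equal. *)
Lemma strand_colors_end (sd : T -> T) (ssd : K -> K) k :
  (forall p, st (sd p) = ssd (st p)) ->
  (forall p, st p = ssd k -> exists2 p', st p' = k & sd p' = p) ->
  (forall p p', qe p = qe p' -> qv (sd p) = qv (sd p')) ->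
  (forall j, lg j = lg k -> (fE j < fE k)%N -> (fV (ssd j) < fV (ssd k))%N) ->
  (cV (ssd k) <= cE k)%N.
Proof.
move=> st_sd onto sound low; rewrite /cV /cE /strand_colors.
set q := mergeS _ _ qv _; set P := [seq p <- enum T | st p == k].
have -> : size (undup [seq q p | p <- enum T & st p == ssd k]) =
          size (undup [seq q (sd p) | p <- P]).
  apply/perm_size/uniq_perm; rewrite ?undup_uniq // => c.
  rewrite !mem_undup; apply/mapP/mapP => -[p]; rewrite mem_filter => /andP[/eqP pk _] ->.
    have [p' p'k <-] := onto _ pk; exists p' => //.
    by rewrite mem_filter p'k eqxx mem_enum.
  by exists (sd p) => //; rewrite mem_filter st_sd pk eqxx mem_enum.
apply: size_undup_map_le => x y; rewrite !mem_filter => /andP[/eqP xk _] /andP[/eqP yk _] exy.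
(* Strands of other generators may be merged earlier without any constraint on their ends; [None]
   absorbs them. *)
pose h x := if lg (st x) == lg k then Some (q (sd x)) else None.
have : h x = h y.
  move: exy; apply: mergeS_min => [//|x' y' exy|k' x' y'].
    rewrite /h; have [-> _ _] := qe_sound exy; case: eqP => // _; congr Some.
    by apply: mergeS_color; exact: sound.
  rewrite inE => lt xk' yk'; rewrite /h xk' yk'; case: eqP => // lk; congr Some.
  by apply: (@mergeS_strand _ _ _ _ _ _ _ (ssd k')); rewrite ?st_sd ?xk' ?yk' // inE low.
by rewrite /h xk yk eqxx => -[].
Qed.

(* At its turn an edge strand has at least as many colours as its end strands, since the
   order is compatible with the ends. If all these inequalities are equalities then, the
   cycle being connected, every edge strand still has its initial [t] colours. A count
   then gives ncolors qe > #|T| / 2, so that some edge colour is used only once. *)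
Theorem stacked_cycle :
  (ncolors qv + ncolors (mergeS st p0 qe [set: K]%SET) <
     ncolors (mergeS st p0 qv [set: K]%SET) + ncolors qe)%N \/
  exists p1, forall p, qe p = qe p1 -> p = p1.
Proof.
have HV := ncolors_mergeS p0K fV_inj qv; have HE := ncolors_mergeS p0K fE_inj qe.
have cVs k : (cV (ssrc k) <= cE k)%N.
  apply: (strand_colors_end (sd := src)) => // [p /src_onto//|p p' /qe_sound[]//|j].
  exact: fE_src.
have cVt k : (cV (stgt k) <= cE k)%N.
  apply: (strand_colors_end (sd := tgt)) => // [p /tgt_onto//|p p' /qe_sound[]//|j].
  exact: fE_tgt.
have cVk k : (cV k <= cE k)%N.
  by have := cVs k; have := cVt k; case: (ends k) => -[-> ->].
have cVnx k : (cV (nx k) <= cE k)%N.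
  by have := cVs k; have := cVt k; case: (ends k) => -[-> ->].
have [lt|ge] := ltnP (\sum_k cV k) (\sum_k cE k); first by left; rewrite /cV /cE in lt; lia.
right; apply: contrapT => none.
have eqVE k : cV k = cE k.
  apply/eqP; rewrite eqn_leq cVk leqNgt; apply/negP => lt; move: ge.
  rewrite leqNgt => /negP; apply; rewrite [ltnLHS](bigD1 k) //= [ltnRHS](bigD1 k) //= -addSn.
  by apply: leq_add => //; apply: leq_sum => j _; exact: cVk.
have cEnx k n : (cE (iter n nx k) <= cE k)%N.
  by elim: n => //= n IH; rewrite -eqVE; apply: leq_trans (cVnx _) IH.
have size_st k : size [seq p <- enum T | st p == k] = t.
  rewrite -(size_strand k) cardE.
  apply/perm_size/uniq_perm; rewrite ?filter_uniq -?enumT ?enum_uniq // => p.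
  by rewrite mem_filter !mem_enum !inE andbT.
have cEt k : (cE k <= t)%N.
  by rewrite /cE /strand_colors (leq_trans (size_undup _)) // size_map size_st.
have cE1 k : cE k = t.
  apply/eqP; rewrite eqn_leq cEt /=.
  (* At the turn of the first strand nothing has been merged, and [nx] leads to it from any
     strand. *)
  pose kb := [arg min_(j < k1) fE j].
  have [n e] := nx_trans k kb.
  apply: leq_trans (cEnx k n); rewrite e /cE.
  have -> : below fE kb = finset.set0.
    apply/setP => j; rewrite !inE; apply/negbTE; rewrite -leqNgt /kb.
    by case: arg_minnP => // i _; apply.
  rewrite /strand_colors /mergeS enum_set0 /= undup_id ?size_map ?size_st //.
  rewrite map_inj_in_uniq ?filter_uniq -?enumT ?enum_uniq // => x y.
  rewrite !mem_filter => /andP[/eqP xk _] /andP[/eqP yk _] /qe_inj; apply.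
  by rewrite xk yk.
have {}HE : (ncolors (mergeS st p0 qe [set: K]%SET) + #|K| * t = ncolors qe + #|K|)%N.
  by rewrite -HE -sum_nat_const; congr (_ + _)%N; apply: eq_bigr => k _; exact: esym (cE1 k).
have cT : (#|T| = #|K| * t)%N.
  rewrite -sum1_card (partition_big st predT) //= -sum_nat_const; apply: eq_bigr => k _.
  by rewrite sum1_card -(size_strand k); apply: eq_card => p; rewrite !inE.
have two : (2 * ncolors qe <= #|T|)%N.
  have -> : #|T| = (\sum_(c <- undup (map qe (enum T))) #|[set p | qe p == c]|)%N.
    rewrite -sum1_card (eq_bigr (fun p => \sum_(c <- undup (map qe (enum T)) | c == qe p) 1)%N).
      rewrite (exchange_big_dep xpredT) //=; apply: eq_bigr => c _; rewrite -sum1_card.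
      by apply: eq_bigl => p; rewrite inE eq_sym.
    move=> p _; rewrite sum1_count count_uniq_mem ?undup_uniq // mem_undup map_f //.
    by rewrite mem_enum.
  rewrite /ncolors mulnC -sum1_size big_distrl /= big_seq [leqRHS]big_seq.
  apply: leq_sum => c; rewrite mem_undup => /mapP[p _ ->]; rewrite mul1n.
  have [p' /andP[p'p /eqP e]] : exists p', (p' != p) && (qe p' == qe p).
    apply: contrapT => np; apply: none; exists p => p' e; apply/eqP; apply: contraT => p'p.
    by case: np; exists p'; rewrite p'p e eqxx.
  apply: (@leq_trans #|[set p; p']|); first by rewrite cards2 eq_sym p'p.
  by apply/subset_leq_card/fintype.subsetP => x; rewrite !inE => /orP[]/eqP->; rewrite ?e.
have ne0 : (0 < ncolors (mergeS st p0 qe [set: K]%SET))%N.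
  rewrite /ncolors; set q := mergeS _ _ _ _.
  have : q (p0 k1) \in undup (map q (enum T)) by rewrite mem_undup map_f // mem_enum.
  by case: (undup _).
have K0 : (0 < #|K|)%N by apply/card_gt0P; exists k1.
move: HE two ne0 K0 t2; rewrite cT; set ne := ncolors (mergeS _ _ _ _) => HE two ne0 K0 _.
(* By [HE] and [ne0] there are at least #|K| * (t - 1) + 1 edge colours, which for t at least 2 is
   more than half of #|K| * t and contradicts [two]. *)
have : (#|K| * 2 <= #|K| * t)%N by rewrite leq_mul2l t2 orbT.
lia.
Qed.

End StackedCycle.

Section StackOrder.
Variables (I : choiceType) (L : nat) (l : nat -> I * bool).
Hypothesis L0 : (0 < L)%N.
Hypothesis lL : forall p, l (p + L)%N = l p.
Hypothesis l_red : forall p, l p.+1 != linv (l p).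
Hypothesis l_aper : forall d, (0 < d < L)%N -> ~ forall p, l (p + d)%N = l p.

(* A stacking of the cyclic word [l], in the sense of Louder and Wilton: the order of two
   edges with the same generator agrees with the order of their origins and ends. *)
Definition stack_consistent (f : nat -> nat) :=
  [/\ forall p, f (p + L)%N = f p,
      forall p q, l p = l q -> (f p < f q)%N = (f p.+1 < f q.+1)%N &
      forall p q, l p = linv (l q) -> (f p < f q.+1)%N = (f p.+1 < f q)%N].

Lemma linv_neq (a : I * bool) : linv a != a.
Proof. by case: a => i []; rewrite /linv xpair_eqE eqxx. Qed.

Lemma linv_sym (a b : I * bool) : a = linv b -> b = linv a.
Proof. by move=> ->; rewrite linvK. Qed.

Section Consistent.
Variables (f : nat -> nat) (fc : stack_consistent f).

Lemma stack_period p n : f (p + n * L)%N = f p.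
Proof. by case: fc => fL _ _; elim: n => [|n IH]; rewrite ?addn0 // mulSn addnCA addnC fL. Qed.

Lemma stack_eq p q : l p = l q -> (f p == f q) = (f p.+1 == f q.+1).
Proof.
case: fc => _ S _ e; have := S _ _ e; have := S _ _ (esym e).
by case: (ltngtP (f p) (f q)); case: (ltngtP (f p.+1) (f q.+1)).
Qed.

Lemma stack_eqV p q : l p = linv (l q) -> (f p == f q.+1) = (f p.+1 == f q).
Proof.
case: fc => _ _ R e; have := R _ _ e; have := R _ _ (linv_sym e).
by case: (ltngtP (f p) (f q.+1)); case: (ltngtP (f p.+1) (f q)).
Qed.

Let src p := (p + (l p).2)%N.
Let tgt p := (p + ~~ (l p).2)%N.
Definition edge_color p := ((l p).1, f (src p)).
Let pos := iota 0 L.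
(** Ties of [f] are allowed: they define a quotient graph of the cycle, whose vertices and edges are
    counted here. *)
Definition nvert := size (undup (map f pos)).
Definition nedge := size (undup (map edge_color pos)).

Lemma mem_pos_mod p : (p %% L)%N \in pos.
Proof. by rewrite mem_iota /= ltn_mod. Qed.

Lemma stack_mod p : f (p %% L) = f p.
Proof. by rewrite {2}(divn_eq p L) addnC stack_period. Qed.

Lemma letter_mod p : l (p %% L) = l p.
Proof.
rewrite {2}(divn_eq p L) addnC; elim: (p %/ L) => [|n IH]; first by rewrite addn0.
by rewrite mulSn addnCA addnC lL.
Qed.

Lemma edge_colorP p q : edge_color p = edge_color q ->
  (l p = l q /\ f p = f q) \/ (l p = linv (l q) /\ f p = f q.+1).
Proof.
rewrite /edge_color /src; case E : (l p) => [i b]; case E' : (l q) => [j b'] /= [eij].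
rewrite -{j}eij in E' *; case: b E; case: b' E' => E' E; rewrite ?addn0 ?addn1 => /eqP.
- by rewrite -stack_eq ?E ?E' // => /eqP; left.
- by rewrite -stack_eqV ?E ?E' // => /eqP; right.
- by move=> /eqP; right.
- by move=> /eqP; left.
Qed.

Let out p := (l p, f p).
Let inn p := (linv (l p), f p.+1).

Lemma out_neq_inn p : out p.+1 != inn p.
Proof. by rewrite /out /inn xpair_eqE negb_and l_red. Qed.

(** [out p] and [inn p] are the half-edges by which the walk leaves [f p] and reaches [f p.+1], each
    recorded with the letter read away from the vertex; an edge has two of them. *)
Lemma half_edges_bound (hs : seq ((I * bool) * nat)) :
  uniq hs -> (forall x, x \in hs -> exists p, x = out p \/ x = inn p) ->
  (size hs <= 2 * nedge)%N.
Proof.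
move=> uhs hsP.
pose H := undup ([seq (((l p).1, false), f (src p)) | p <- pos] ++
            [seq (((l p).1, true), f (tgt p)) | p <- pos]).
apply: (@leq_trans (size H)); last first.
  apply: leq_trans (_ : nedge + nedge <= _)%N; last by rewrite mul2n addnn.
  rewrite /H undup_cat size_cat leq_add //.
    rewrite size_filter (leq_trans (count_size _ _)) //.
    by apply: size_undup_map_le => p q _ _; rewrite /edge_color => -[-> ->].
  apply: size_undup_map_le => p q _ _ /edge_colorP; rewrite /tgt => -[[e /eqP]|[e /eqP]].
    by rewrite e; case E : (l q).2; rewrite ?addn0 ?addn1; [move/eqP->|rewrite stack_eq // => /eqP->].
  rewrite e; case E : (l q).2 => /=; rewrite ?addn0 ?addn1 ?negbK ?E /=.
    by rewrite addn1 stack_eqV // => /eqP->.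
  by rewrite addn0 => /eqP ->.
apply: uniq_leq_size => // x /hsP[p xp]; rewrite mem_undup mem_cat.
have {}xp : x = out (p %% L)%N \/ x = inn (p %% L)%N.
  have f1 : f (p %% L).+1 = f p.+1 by rewrite -[LHS]stack_mod -addn1 modnDml addn1 stack_mod.
  by rewrite /out /inn f1 stack_mod letter_mod.
have := mem_pos_mod p; move: xp; move: (p %% L)%N => {p} p.
have [S1 S2] : ((l p).2 -> src p = p.+1) /\ (~~ (l p).2 -> src p = p).
  by rewrite /src; case: (l p).2; rewrite ?addn0 ?addn1.
have [T1 T2] : ((l p).2 -> tgt p = p) /\ (~~ (l p).2 -> tgt p = p.+1).
  by rewrite /tgt; case: (l p).2; rewrite ?addn0 ?addn1.
case=> -> pL; case E : (l p).2.
- apply/orP; right; apply/mapP; exists p => //; rewrite T1 // /out.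
  by move: E; case: (l p) => i b /= ->.
- apply/orP; left; apply/mapP; exists p => //; rewrite S2 ?E // /out.
  by move: E; case: (l p) => i b /= ->.
- apply/orP; left; apply/mapP; exists p => //; rewrite S1 ?E // /inn.
  by move: E; case: (l p) => i b /= ->.
- apply/orP; right; apply/mapP; exists p => //; rewrite T2 ?E // /inn.
  by move: E; case: (l p) => i b /= ->.
Qed.

(** The walk does not backtrack, so every vertex has two different half-edges. If there are no more
    edges than vertices, none has a third. *)
Lemma valence2 : (nedge <= nvert)%N -> forall p q, f p.+1 = f q ->
  out q = out p.+1 \/ out q = inn p.
Proof.
move=> EV p q fpq.
(* A position just before a visit of [v], forced to be [p] at the vertex in question; adding [L]
   avoids the predecessor of 0. *)
pose prev (v : nat) := if v == f p.+1 then p else (index v (map f pos) + L).-1.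
pose Vs := undup (map f pos).
have prevP v : v \in Vs -> f (prev v).+1 = v.
  rewrite /prev; case: eqP => [->//|_]; rewrite mem_undup => vV.
  rewrite prednK ?addn_gt0 ?L0 ?orbT //; case: fc => fL _ _; rewrite fL.
  have vi : (index v (map f pos) < L)%N by rewrite -[X in (_ < X)%N](size_iota 0) -(size_map f) index_mem.
  have := nth_index 0%N vV; rewrite (nth_map 0%N) ?size_iota // nth_iota //.
pose hs := [seq out (prev v).+1 | v <- Vs] ++ [seq inn (prev v) | v <- Vs].
apply: contrapT => /not_orP[ne1 ne2].
have fV p' : f p' \in Vs by rewrite mem_undup -stack_mod map_f // mem_pos_mod.
have prevp : prev (f p.+1) = p by rewrite /prev eqxx.
have oVs : out q \notin hs.
  rewrite mem_cat negb_or; apply/andP; split; apply/mapP => -[v vV e].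
    have ev : v = f p.+1 by rewrite -(prevP v) // fpq; move: e => [_ <-].
    by apply: ne1; rewrite e ev prevp.
  have ev : v = f p.+1 by rewrite -(prevP v) // fpq; move: e => [_ <-].
  by apply: ne2; rewrite e ev prevp.
have uhs : uniq (out q :: hs).
  rewrite /= oVs cat_uniq !map_inj_in_uniq ?undup_uniq /= ?andbT.
  - apply/hasPn => _ /mapP[v vV ->]; apply/mapP => -[v' v'V e].
    have ev : v = v' by rewrite -(prevP v) // -(prevP v') //; move: e => [_].
    by have := out_neq_inn (prev v); rewrite e ev eqxx.
  - by move=> v v' vV v'V [_]; rewrite !prevP.
  - by move=> v v' vV v'V [_]; rewrite !prevP.
have := half_edges_bound uhs; rewrite /= size_cat !size_map -/nvert => H.
have {H} : (nvert + nvert < 2 * nedge)%N.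
  apply: H => x; rewrite in_cons mem_cat => /orP[/eqP->|/orP[]]; first by exists q; left.
    by case/mapP=> v _ ->; exists (prev v).+1; left.
  by case/mapP=> v _ ->; exists (prev v); right.
by move: EV; lia.
Qed.

(** With all valences two, a visit determines the next one. Two visits of a vertex in the same
    direction would give [l] a period below [L]. In opposite directions they would meet, at a
    backtrack or at a letter equal to its inverse. *)
Lemma stack_injective : (nedge <= nvert)%N -> forall p q, f p = f q -> p = q %[mod L].
Proof.
move=> EV.
have caseA p q : out p = out q -> forall n, out (p + n)%N = out (q + n)%N.
  move=> pq; elim=> [|n IH]; rewrite ?addn0 // !addnS.
  have e1 : l (p + n)%N = l (q + n)%N by case: IH.
  have e2 : f (p + n).+1 = f (q + n).+1.
    by apply/eqP; rewrite -stack_eq //; case: IH => _ ->.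
  have [//|e] := valence2 EV e2.
  by case/negP: (out_neq_inn (q + n)); rewrite e /inn e1 e2.
have caseB p q : out p != inn q.
  wlog pq : p q / (p <= q)%N.
    move=> H; have -> : inn q = inn (q + p * L)%N.
      by rewrite /inn -addSn stack_period -[in RHS]letter_mod addnC modnMDl letter_mod.
    by apply: H; rewrite (leq_trans (leq_pmulr p L0)) // leq_addl.
  apply/negP => /eqP e0.
  have step n : (n <= q)%N -> out (p + n)%N = inn (q - n)%N.
    elim: n => [|n IH] hn; first by rewrite addn0 subn0.
    have {IH} e := IH (ltnW hn).
    have el : l (p + n)%N = linv (l (q - n)%N) by case: e.
    have qn : (q - n = (q - n.+1).+1)%N by lia.
    have ef : f (q - n.+1).+1 = f (p + n).+1.
      by apply/eqP; rewrite -qn eq_sym -stack_eqV // ; case: e => _ ->.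
    rewrite addnS; have [e'|//] := valence2 EV ef.
    case/negP: (out_neq_inn (p + n)); rewrite e' /out /inn -ef -qn.
    by rewrite (linv_sym el).
  have hq : ((q - p)./2 <= q)%N by lia.
  have [even|odd] := boolP (odd (q - p)).
    have hn : (p + (q - p)./2).+1 = (q - (q - p)./2)%N.
      by have := odd_double_half (q - p); rewrite even; lia.
    have := step _ hq; rewrite -hn => -[/linv_sym e _].
    by case/negP: (l_red (p + (q - p)./2)); exact/eqP.
  have hn : (p + (q - p)./2)%N = (q - (q - p)./2)%N.
    by have := odd_double_half (q - p); rewrite (negbTE odd); lia.
  have := step _ hq; rewrite -hn => -[e _].
  by case/negP: (linv_neq (l (p + (q - p)./2))); rewrite -e.
move=> p q fpq; apply: contrapT => ne.
have pL : (p + L.-1).+1 = (p + L)%N by rewrite -addnS prednK.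
have fpL : f (p + L.-1).+1 = f q by rewrite pL; case: fc => -> _ _.
have [e|e] := valence2 EV fpL; last by have := caseB q (p + L.-1)%N; rewrite e eqxx.
have {}e : out p = out q by rewrite e pL /out lL; case: fc => -> _ _.
(* A natural number congruent to -p modulo [L]. *)
pose c := (p * L - p)%N; have pc : (p + c = p * L)%N by rewrite subnKC // leq_pmulr.
pose d := ((q + c) %% L)%N.
have dL : (d < L)%N by rewrite ltn_mod.
apply: (@l_aper d).
  rewrite dL andbT lt0n; apply/negP => /eqP d0; apply: ne; apply/eqP.
  by rewrite -(eqn_modDr c) pc modnMl eq_sym -/d d0.
move=> m; rewrite -[LHS]letter_mod modnDmr letter_mod addnCA.
have [<- _] : out (p + (m + c))%N = out (q + (m + c))%N by exact: caseA.
by rewrite addnCA pc -[LHS]letter_mod addnC modnMDl letter_mod.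
Qed.

(* The quotient graph by the ties of [f] has more edges than vertices, so some nonzero
   edge weight integrates to 0 along the word up to [L] and up to the first position of
   every vertex. If its integral [h] were constant on ties, it would vanish, and so would
   the weight. *)
Lemma stack_potential : (nvert < nedge)%N -> exists h : nat -> rat,
  [/\ forall p, h (p + L)%N = h p,
      forall p q, l p = l q -> f p = f q -> (h p.+1 - h p = h q.+1 - h q)%R,
      forall p q, l p = linv (l q) -> f p = f q.+1 -> (h p.+1 - h p = h q - h q.+1)%R &
      exists p q, f p = f q /\ h p != h q].
Proof.
move=> VE; pose Es := undup (map edge_color pos); pose Vs := undup (map f pos).
pose c0 := edge_color 0.
pose eps p : rat := (if (l p).2 then -1 else 1)%R.
(* For the vertex of position 0 the integral up to the first visit is empty; the full period takes
   its place and makes [h] periodic. *)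
pose len (c : 'I_nvert) :=
  let v := nth 0%N Vs c in if v == f 0 then L else index v (map f pos).
pose M : 'M[rat]_(nedge, nvert) := (\matrix_(i, c)
  \sum_(0 <= j < len c) eps j *+ (edge_color j == nth c0 Es i))%R.
have kerM : kermx M != 0%R.
  rewrite -mxrank_eq0 mxrank_ker subn_eq0 -ltnNge.
  exact: leq_ltn_trans (rank_leq_col M) VE.
pose phi0 := nz_row (kermx M).
have phi0M : (phi0 *m M = 0)%R by apply/sub_kermxP/nz_row_sub.
pose phi (c : I * nat) : rat := (\sum_i phi0 0 i *+ (c == nth c0 Es i))%R.
pose h p : rat := (\sum_(0 <= j < p) eps j * phi (edge_color j))%R.
have hS p : (h p.+1 = h p + eps p * phi (edge_color p))%R by rewrite /h big_nat_recr.
have hlen c : h (len c) = 0%R.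
  have /rowP/(_ c) := phi0M; rewrite !mxE => <-.
  rewrite /h; under [RHS]eq_bigr => i _ do rewrite mxE big_distrr /=.
  rewrite exchange_big /=; apply: eq_bigr => j _; rewrite /phi big_distrr /=.
  by apply: eq_bigr => i _; case: eqP => _; rewrite ?mulr0n ?mulr0 // !mulr1n mulrC.
have fV p : f p \in Vs by rewrite mem_undup -stack_mod map_f // mem_pos_mod.
have ixV p : (index (f p) Vs < nvert)%N by rewrite index_mem.
have hL : h L = 0%R.
  by have := hlen (Ordinal (ixV 0)); rewrite /len /= nth_index // eqxx.
have hper p : h (p + L)%N = h p.
  have ecL j : edge_color (j + L) = edge_color j.
    by rewrite /edge_color /src lL addnAC; case: fc => -> _ _.
  have epsL j : eps (j + L)%N = eps j by rewrite /eps lL.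
  elim: p => [|p IH]; first by rewrite add0n hL /h big_geq.
  by rewrite addSn !hS IH ecL epsL.
exists h; split=> //.
- move=> p q e fpq; have : edge_color p = edge_color q.
    rewrite /edge_color /src e; congr (_, _); apply/eqP.
    by case: (l q).2; rewrite ?addn0 ?addn1 -?stack_eq ?fpq.
  by rewrite !hS /eps e => ->; rewrite addrC addKr addrC addKr.
- move=> p q e fpq; have : edge_color p = edge_color q.
    rewrite /edge_color /src e /=; congr (_, _); apply/eqP.
    by case: (l q).2; rewrite /= ?addn0 ?addn1 -?stack_eqV ?fpq.
  rewrite !hS /eps e /linv /= => ->; case: (l q).2 => /=; first by rewrite !mul1r !mulN1r; ring.
  by rewrite !mul1r !mulN1r; ring.
apply: contrapT => none.
have hz p : h p = 0%R.
  have : h p = h (len (Ordinal (ixV p))).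
    apply/eqP; apply: contraT => ne; case: none; exists p, (len (Ordinal (ixV p))); split=> //.
    rewrite /len /= nth_index //; case: eqP => [->|_].
      by case: fc => fL _ _; rewrite -[in RHS](add0n L) fL.
    have fpV : f p \in map f pos by rewrite -stack_mod map_f // mem_pos_mod.
    have vi : (index (f p) (map f pos) < L)%N.
      by rewrite -[X in (_ < X)%N](size_iota 0) -(size_map f) index_mem.
    by have := nth_index 0%N fpV; rewrite (nth_map 0%N) ?size_iota // nth_iota.
  by move=> ->; exact: hlen.
have phiz p : phi (edge_color p) = 0%R.
  have := hS p; rewrite !hz add0r => /esym/eqP; rewrite mulf_eq0 /eps.
  by case: (l p).2; rewrite ?oppr_eq0 oner_eq0 => /eqP.
have : phi0 != 0%R by rewrite nz_row_eq0.
case/eqP; apply/rowP => i; rewrite mxE.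
have : nth c0 Es i \in map edge_color pos by rewrite -mem_undup mem_nth.
case/mapP=> p _ ep; have := phiz p; rewrite -ep /phi (bigD1 i) //= eqxx mulr1n big1 ?addr0 // => j ji.
by rewrite (nth_uniq c0) ?undup_uniq // eq_sym val_eqE (negbTE ji) mulr0n.
Qed.

(** Ties of [f] are broken by the potential [h]. On edges that [f] identifies [h] has equal
    increments, so both ends are ordered alike. *)
Lemma stack_refine : (nvert < nedge)%N -> exists f' : nat -> nat,
  [/\ stack_consistent f', forall p q, f' p = f' q -> f p = f q &
      exists p q, f p = f q /\ f' p != f' q].
Proof.
move=> /stack_potential[h [hL h1 h2 [p1 [q1 [fpq hpq]]]]].
pose lt p q := (f p < f q)%N || (f p == f q) && (h p < h q)%R.
have nlt p : ~~ lt p p by rewrite /lt ltnn eqxx ltxx.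
have lt_trans q p r : lt p q -> lt q r -> lt p r.
  rewrite /lt => /orP[a|/andP[/eqP-> b]] /orP[c|/andP[/eqP e d]].
  - by rewrite (ltn_trans a c).
  - by rewrite -e a.
  - by rewrite c.
  - by rewrite e eqxx (lt_trans b d) orbT.
have lt_tot p q : ~~ lt p q -> ~~ lt q p -> f p = f q /\ h p = h q.
  rewrite /lt; case: (ltngtP (f p) (f q)) => //= e; rewrite -!leNgt => a b.
  by split=> //; apply/eqP; rewrite eq_le a b.
have lt_or p q r : lt p q -> lt p r || lt r q.
  move=> pq; apply: contraT; rewrite negb_or => /andP[pr rq].
  have [rp|rp] := boolP (lt r p); first by rewrite (lt_trans _ _ _ rp pq) in rq.
  have [qr|qr] := boolP (lt q r); first by rewrite (lt_trans _ _ _ pq qr) in pr.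
  have [f1 e1] := lt_tot _ _ pr rp; have [f2 e2] := lt_tot _ _ qr rq.
  by move: pq; rewrite /lt f1 e1 f2 e2 ltnn ltxx andbF.
(* The rank in the lexicographic order of [f] and [h] over one period is again a natural number. *)
pose f' p := count (fun i => lt i p) pos.
have ltL p q : lt (p %% L)%N q = lt p q.
  have hmod : h (p %% L) = h p.
    rewrite {2}(divn_eq p L) addnC; elim: (p %/ L) => [|n IH]; first by rewrite addn0.
    by rewrite mulSn addnCA addnC hL.
  by rewrite /lt stack_mod hmod.
have f'P p q : (f' p < f' q)%N = lt p q.
  apply/idP/idP => [|pq].
    apply: contraLR => pq; rewrite -leqNgt; apply: sub_count => i iq.
    by have := lt_or _ _ p iq; rewrite (negbTE pq) orbF.
  rewrite /f' -[ltnRHS]size_filter -(count_predC (fun i => lt i p)) count_filter.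
  have -> : count (predI (fun i => lt i p) (fun i => lt i q)) pos =
            count (fun i => lt i p) pos.
    apply: eq_count => i /=; apply: andb_idr => ip; exact: lt_trans ip pq.
  rewrite -[ltnLHS]addn0 ltn_add2l -has_count; apply/hasP; exists (p %% L)%N.
    by rewrite mem_filter ltL pq mem_pos_mod.
  by rewrite /= ltL (negbTE (nlt p)).
have f'E p q : f' p = f' q -> f p = f q /\ h p = h q.
  by move=> e; apply: lt_tot; rewrite -f'P e ltnn.
case: fc => fL fS fR.
exists f'; split.
- split=> [p|p q e|p q e].
  + by rewrite /f'; apply: eq_count => i; rewrite /lt fL hL.
  + rewrite !f'P /lt (fS _ _ e) (stack_eq e); case: eqP => //= /eqP fe; congr (_ || _).
    have := h1 p q e; rewrite -(eqP (_ : f p == f q)); last by rewrite stack_eq.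
    by move=> /(_ erefl); lra.
  + rewrite !f'P /lt (fR _ _ e) (stack_eqV e); case: eqP => //= /eqP fe; congr (_ || _).
    have := h2 p q e; rewrite -(eqP (_ : f p == f q.+1)); last by rewrite stack_eqV.
    by move=> /(_ erefl); lra.
- by move=> p q /f'E[].
- exists p1, q1; split=> //; apply/negP => /eqP /f'E[_ e]; by rewrite e eqxx in hpq.
Qed.

End Consistent.

(** Start from the constant map, which is consistent. Each refinement lowers the number of ties, and
    a map that cannot be refined is injective. *)
Theorem stack_order : exists f : nat -> nat,
  stack_consistent f /\ forall p q, f p = f q -> p = q %[mod L].
Proof.
pose ties (f : nat -> nat) := #|[set x : 'I_L * 'I_L | f x.1 == f x.2]|.
suff main n f : (ties f < n)%N -> stack_consistent f -> exists f : nat -> nat,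
    stack_consistent f /\ forall p q, f p = f q -> p = q %[mod L].
  by apply: (main (ties (fun=> 0%N)).+1 (fun=> 0%N)) => //; split.
elim: n f => // n IH f; rewrite ltnS => hn fc.
have [VE|/(stack_injective fc) inj] := ltnP (nvert f) (nedge f); last by exists f.
have [f' [fc' f'f [p [q [fpq f'pq]]]]] := stack_refine fc VE.
apply: (IH f') => //; apply: leq_trans hn; apply/proper_card/fintype.properP; split.
  by apply/fintype.subsetP => -[i j]; rewrite !inE /= => /eqP/f'f ->.
exists (Ordinal (ltn_pmod p L0), Ordinal (ltn_pmod q L0)); rewrite inE /=.
  by rewrite !(stack_mod fc) fpq.
by rewrite !(stack_mod fc').
Qed.

End StackOrder.

(** * Cycles of a word in random permutations *)

Lemma cycle_count_points N n (s : 'S_N) : (0 < n)%N ->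
  (n * cycle_count n s = #|[set x | #|porbit s x| == n]|)%N.
Proof.
move=> n0.
rewrite mulnC /cycle_count; apply/esym.
  apply: (@card_uniform_partition _ n [set c in porbits s | #|c| == n]).
    by move=> c; rewrite inE => /andP[_ /eqP].
  apply/and3P; split.
  - apply/eqP/setP => x; apply/bigcupP/idP => [[c]|].
      rewrite !inE => /andP[/imsetP[z _ ->] /eqP ct] xz.
      by move: xz; rewrite -eq_porbit_mem => /eqP ->; rewrite ct.
    rewrite inE => xt; exists (porbit s x); last exact: porbit_id.
    by rewrite inE xt andbT; apply: imset_f.
  - apply/finset.trivIsetP => c d; rewrite !inE => /andP[/imsetP[x _ ->] _] /andP[/imsetP[z _ ->] _].
    apply: contraNT => /pred0Pn[u /andP[/= ux uz]].
    by move: ux uz; rewrite -!eq_porbit_mem => /eqP -> /eqP ->.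
  - rewrite inE negb_and; apply/orP; right; rewrite cards0.
    by apply: contraTneq n0 => <-.
Qed.

Section CyclicPositions.
Variables (L t : nat).
Hypotheses (L0 : (0 < L)%N) (t0 : (0 < t)%N).

Lemma positions_gt0 : (0 < t * L)%N. Proof. by rewrite muln_gt0 t0. Qed.

(* The t * L positions of the closed walk repeating [t] times a word of length [L]; a strand
   consists of the [t] positions of the same letter. *)
Definition cpos (p : nat) : 'I_(t * L) := Ordinal (ltn_pmod p positions_gt0).
Definition strandn (p : nat) : 'I_L := Ordinal (ltn_pmod p L0).
Definition strand (p : 'I_(t * L)) : 'I_L := strandn p.

Lemma strand_cpos p : strand (cpos p) = strandn p.
Proof. by apply: val_inj; rewrite /= modn_dvdm // dvdn_mull. Qed.

Lemma cpos_cposD p n : cpos (cpos p + n)%N = cpos (p + n)%N.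
Proof. by apply: val_inj; rewrite /= modnDml. Qed.

Lemma cpos_val (p : 'I_(t * L)) : cpos p = p.
Proof. by apply: val_inj; rewrite /= modn_small. Qed.

Lemma strandn_val (k : 'I_L) : strandn k = k.
Proof. by apply: val_inj; rewrite /= modn_small. Qed.

Lemma strandnD p : strandn (p + L) = strandn p.
Proof. by apply: val_inj; rewrite /= modnDr. Qed.

Lemma card_strand k : #|[set p | strand p == k]| = t.
Proof.
pose f (i : 'I_t) := cpos (i * L + k).
have fE (i : 'I_t) : val (f i) = (i * L + k)%N.
  rewrite /= modn_small // (@leq_trans (i.+1 * L)) ?leq_mul2r ?ltn_ord ?orbT //.
  by rewrite mulSn addnC ltn_add2r.
have -> : [set p | strand p == k] = [set f i | i in [set: 'I_t]%SET].
  apply/setP => p; rewrite inE; apply/eqP/imsetP => [pk|[i _ ->]].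
    have pt : (p %/ L < t)%N by rewrite ltn_divLR.
    exists (Ordinal pt); rewrite ?inE //; apply: val_inj.
    by rewrite fE /= -pk /= -divn_eq.
  by apply: val_inj; rewrite strand_cpos /= modnMDl modn_small.
rewrite card_imset ?cardsT ?card_ord // => i j /(congr1 val); rewrite !fE.
by move/addIn/eqP; rewrite eqn_pmul2r // => /eqP /val_inj.
Qed.

Definition strand_inj N (y : {ffun 'I_(t * L) -> 'I_N}) :=
  [forall p, forall q, (strand p == strand q) && (y p == y q) ==> (p == q)].

Lemma strand_injP N (y : {ffun 'I_(t * L) -> 'I_N}) :
  reflect (forall p q, strand p = strand q -> y p = y q -> p = q) (strand_inj y).
Proof.
apply: (iffP forallP) => [H p q e1 e2|H p].
  by have /forallP/(_ q) := H p; rewrite e1 e2 !eqxx => /eqP.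
apply/forallP => q; apply/implyP => /andP[/eqP e1 /eqP e2]; apply/eqP; exact: H.
Qed.

Section Lifts.
Local Open Scope group_scope.
Variables (N : nat) (a : 'I_L -> 'S_N).

Definition lifts_path (y : {ffun 'I_(t * L) -> 'I_N}) :=
  [forall p : 'I_(t * L), y (cpos p.+1) == a (strand p) (y p)].

Let G p := \prod_(0 <= j < p) a (strandn j).
Let g := \prod_(k < L) a k.

Let GS p : G p.+1 = G p * a (strandn p).
Proof. by rewrite /G big_nat_recr. Qed.

Let GL : G L = g.
Proof. by rewrite /G big_mkord; apply: eq_bigr => k _; rewrite strandn_val. Qed.

Let GD p : G (p + L) = g * G p.
Proof.
elim: p => [|p IH]; first by rewrite add0n GL /G big_geq // mulg1.
by rewrite addSn !GS IH strandnD mulgA.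
Qed.

Let GX i s : G (i * L + s) = g ^+ i * G s.
Proof.
elim: i => [|i IH]; first by rewrite mul1g.
by rewrite mulSn -addnA addnC GD IH mulgA -expgS.
Qed.

Let G0 : G 0 = 1. Proof. by rewrite /G big_geq. Qed.

Lemma card_porbit_eq (s : 'S_N) x : #|porbit s x| = t ->
  (s ^+ t) x = x /\ forall i j, (i < t)%N -> (j < t)%N -> (s ^+ i) x = (s ^+ j) x -> i = j.
Proof.
move=> ot; have := iter_porbit s x; have := uniq_traject_porbit s x; rewrite ot => u e.
split=> [|i j it jt]; first by rewrite permX.
rewrite !permX -(nth_traject s it) -(nth_traject s jt) => /eqP.
by rewrite nth_uniq ?size_traject // => /eqP.
Qed.

Lemma lifts_path_porbit y : strand_inj y -> lifts_path y ->
  #|porbit g (y (cpos 0))| = t /\ forall p, y (cpos p) = G p (y (cpos 0)).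
Proof.
move=> /strand_injP yI /forallP yP.
have yG p : y (cpos p) = G p (y (cpos 0)).
  elim: p => [|p IH]; first by rewrite G0 perm1.
  rewrite GS permM -IH -strand_cpos -(eqP (yP (cpos p))).
  by congr (y _); apply: val_inj; rewrite /= -[in RHS]addn1 modnDml addn1.
split=> //; set x := y (cpos 0).
have gi i : (g ^+ i) x = y (cpos (i * L)) by rewrite yG -[(i * L)%N]addn0 GX G0 mulg1.
have gt : (g ^+ t) x = x.
  by rewrite gi; congr (y _); apply: val_inj; rewrite /= modnn mod0n.
have gI i : (0 < i < t)%N -> (g ^+ i) x <> x.
  move=> /andP[i0 it]; rewrite gi => e.
  have st0 : strand (cpos (i * L)) = strand (cpos 0).
    by rewrite !strand_cpos; apply: val_inj; rewrite /= modnMl mod0n.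
  have := congr1 val (yI _ _ st0 e); rewrite /= mod0n modn_small ?ltn_pmul2r // => /eqP.
  by rewrite muln_eq0 !eqn0Ngt i0 L0.
have m0 : (0 < #|porbit g x|)%N by rewrite lt0n card_porbit_neq0.
have := iter_porbit g x; have := uniq_traject_porbit g x.
set m := #|porbit g x| in m0 * => u e.
case: (ltngtP m t) => // mt.
  by case: (gI m); rewrite ?m0 // permX.
have tm : (t < m)%N by [].
have : nth x (traject g x m) t == nth x (traject g x m) 0.
  by rewrite !nth_traject // -permX gt.
by rewrite nth_uniq ?size_traject // => /eqP t00; have := t0; rewrite t00.
Qed.

(** The label of position 0 determines the others; injectivity on its strand says that [g] returns
    there after [t] steps and not earlier. *)
Lemma card_lifts_path :
  #|[set y | strand_inj y && lifts_path y]| = (t * cycle_count t g)%N.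
Proof.
rewrite cycle_count_points //.
have -> : [set x | #|porbit g x| == t] =
   [set y (cpos 0) | y : {ffun 'I_(t * L) -> 'I_N} in [set y | strand_inj y && lifts_path y]].
  apply/setP => x; apply/idP/imsetP => [|[y]]; rewrite !inE.
    move=> /eqP /card_porbit_eq[gt gI].
    have GtL : G (t * L) x = x by rewrite -[(t * L)%N]addn0 GX G0 mulg1.
    exists [ffun p : 'I_(t * L) => G p x]; last by rewrite ffunE /= mod0n G0 perm1.
    rewrite inE; apply/andP; split.
      apply/strand_injP => p q; rewrite !ffunE => /(congr1 val) /= pq.
      rewrite (divn_eq p L) (divn_eq q L) !GX pq !permM => /perm_inj /gI e.
      apply: val_inj; rewrite /= (divn_eq p L) (divn_eq q L) pq e //.
        by rewrite ltn_divLR.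
      by rewrite ltn_divLR.
    apply/forallP => p; rewrite !ffunE -permM -GS /=.
    have := ltn_ord p; rewrite leq_eqVlt => /orP[/eqP e|lt].
      by rewrite e modnn G0 perm1 GtL.
    by rewrite modn_small.
  move=> /andP[yI yP] ->; have [-> _] := lifts_path_porbit yI yP; exact: eqxx.
rewrite card_in_imset // => y z; rewrite !inE => /andP[yI yP] /andP[zI zP] e.
have [_ yG] := lifts_path_porbit yI yP; have [_ zG] := lifts_path_porbit zI zP.
by apply/ffunP => p; rewrite -(cpos_val p) yG zG e.
Qed.

End Lifts.

Variable b : nat -> bool.
Hypothesis bL : forall p, b (p + L)%N = b p.

(* [b p] tells whether the [p]-th letter is the inverse of a generator. *)
Definition psrc (p : 'I_(t * L)) := cpos (p + b p).
Definition ptgt (p : 'I_(t * L)) := cpos (p + ~~ b p).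

Section Weights.
Local Open Scope ring_scope.
Variables (R : realFieldType) (N : nat).
Implicit Types (y : {ffun 'I_(t * L) -> 'I_N}) (S : {set 'I_L}).
Hypothesis NtL : (t * L <= N)%N.

(* The pairs (point, image) that the labelling [y] imposes on the permutation substituted
   for the [k]-th generator. *)
Definition pairs_of y (k : 'I_L) : {set 'I_N * 'I_N} :=
  [set (y (psrc p), y (ptgt p)) | p in [set p | strand p == k]].
Definition known y S := \bigcup_(j in S) pairs_of y j.
Definition compat (A B : {set 'I_N * 'I_N}) :=
  [forall a in A, forall b in B, (a.1 == b.1) == (a.2 == b.2)].

Lemma compatP (A B : {set 'I_N * 'I_N}) :
  reflect {in A & B, forall a b, (a.1 == b.1) = (a.2 == b.2)} (compat A B).
Proof.
apply: (iffP forallP) => [H a c aA cB|H a]; last first.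
  by apply/implyP => aA; apply/forallP => c; apply/implyP => cB; rewrite H.
by have /implyP/(_ aA)/forallP/(_ c)/implyP/(_ cB)/eqP := H a.
Qed.

Definition inv_ffact q n : R := ((N - q) ^_ n)%N%:R^-1.
(* The conditional probability that a uniform random permutation which maps the pairs of
   the strands in [S] as required also does so for strand [k]. *)
Definition step_weight y k S : R :=
  (compat (pairs_of y k) (known y S))%:R *
  inv_ffact #|known y S| #|pairs_of y k :\: known y S|.

Lemma sign_mod r : b (r %% L) = b r.
Proof.
rewrite {2}(divn_eq r L) addnC; elim: (r %/ L)%N => [|n IH]; first by rewrite addn0.
by rewrite mulSn addnCA addnC bL.
Qed.

Lemma strand_ends p q : strand p = strand q ->
  (strand (psrc p) = strand (psrc q)) /\ (strand (ptgt p) = strand (ptgt q)) /\ b p = b q.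
Proof.
move=> /(congr1 val) /= e.
have ebq : b p = b q by rewrite -sign_mod e sign_mod.
rewrite /psrc /ptgt !strand_cpos ebq; split; last split => //;
  by apply: val_inj; rewrite /= -modnDml e modnDml.
Qed.

Lemma psrc_inj p q : strand p = strand q -> psrc p = psrc q -> p = q.
Proof.
move=> /strand_ends[_ [_ ebq]] /(congr1 val) /=; rewrite ebq => /eqP.
by rewrite eqn_modDr !modn_small // => /eqP /val_inj.
Qed.

Lemma ptgt_inj p q : strand p = strand q -> ptgt p = ptgt q -> p = q.
Proof.
move=> /strand_ends[_ [_ ebq]] /(congr1 val) /=; rewrite ebq => /eqP.
by rewrite eqn_modDr !modn_small // => /eqP /val_inj.
Qed.

Lemma pinj_pairs y k : strand_inj y -> pinj (pairs_of y k).
Proof.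
move=> /strand_injP yI; apply/pinjP => _ _ /imsetP[p + ->] /imsetP[q + ->] /=.
rewrite !inE => /eqP pk /eqP qk; have pq : strand p = strand q by rewrite pk qk.
have [e1 [e2 _]] := strand_ends pq.
apply/eqP/eqP => e.
  by rewrite (psrc_inj pq (yI _ _ e1 e)).
by rewrite (ptgt_inj pq (yI _ _ e2 e)).
Qed.

Definition ext_count (A : {set 'I_N * 'I_N}) : R := #|[set s : 'S_N | extends s A]|%:R.

(** The chain rule: a permutation extending [A] still has N - #|A| free sources and images for the
    pairs of [B] outside [A]. *)
Lemma ext_countU (A B : {set 'I_N * 'I_N}) : pinj B -> (#|A :|: B| <= N)%N ->
  ext_count (A :|: B) = ext_count A * ((compat B A)%:R * inv_ffact #|A| #|B :\: A|).
Proof.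
move=> pB AB.
have zero (C : {set 'I_N * 'I_N}) : ~~ pinj C -> ext_count C = 0%R.
  move=> pC; rewrite /ext_count (_ : [set s | _] = finset.set0) ?cards0 //.
  by apply/setP => s; rewrite !inE; apply: contraNF pC; exact: extends_pinj.
have [pA|pA] := boolP (pinj A); last first.
  rewrite [in RHS]zero // mul0r zero //; apply: contra pA; apply: pinj_sub.
  exact: finset.subsetUl.
have [cBA|cBA] := boolP (compat B A); last first.
  rewrite mul0r mulr0 zero //; apply: contra cBA => /pinjP H.
  by apply/compatP => a c aB cA; apply: H; rewrite inE ?aB ?cA ?orbT.
have pAB : pinj (A :|: B).
  apply/pinjP => a c; rewrite !inE => /orP[aA|aB] /orP[cA|cB].
  - exact: (pinjP _ pA).
  - by rewrite eq_sym (compatP _ _ cBA) // eq_sym.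
  - exact: (compatP _ _ cBA).
  - exact: (pinjP _ pB).
have cU : #|A :|: B| = (#|A| + #|B :\: A|)%N.
  by have := subset_leq_card (finset.subsetIl B A); rewrite cardsU cardsD finset.setIC; lia.
rewrite mul1r /ext_count !card_extends // card_ord cU subnDA /inv_ffact.
have le : (#|B :\: A| <= N - #|A|)%N by move: AB; rewrite cU; lia.
rewrite -(ffact_fact le) natrM mulrC mulKr // unitfE pnatr_eq0 -lt0n ffact_gt0 //.
Qed.

Lemma card_known y S : (#|known y S| <= t * L)%N.
Proof.
have -> : known y S = [set (y (psrc p), y (ptgt p)) | p in [set p | strand p \in S]].
  apply/setP => x; apply/bigcupP/imsetP => [[j jS /imsetP[p + ->]]|[p + ->]].
    by rewrite inE => /eqP pj; exists p; rewrite // inE pj.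
  by rewrite inE => pS; exists (strand p) => //; apply/imsetP; exists p; rewrite ?inE.
by rewrite (leq_trans (leq_imset_card _ _)) // -[leqRHS]card_ord max_card.
Qed.

Lemma knownU1 y k S : known y (k |: S) = known y S :|: pairs_of y k.
Proof.
rewrite /known; have [kS|kS] := boolP (k \in S); last by rewrite big_setU1 //= finset.setUC.
have -> : k |: S = S by apply/finset.setUidPr; rewrite finset.sub1set.
by apply/esym/finset.setUidPl; exact: finset.bigcup_sup.
Qed.

Lemma ext_count_prod y (C : finType) (c : 'I_L -> C) (e : C) : strand_inj y ->
  ext_count (known y [set k | c k == e]) = (N`!)%:R *
  \prod_(k | c k == e) step_weight y k [set j : 'I_L | (j < k)%N && (c j == c k)].
Proof.
move=> yI.
have main m : (m <= L)%N -> ext_count (known y [set k : 'I_L | (k < m)%N && (c k == e)]) =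
   ((N`!)%:R * \prod_(k : 'I_L | (k < m)%N && (c k == e))
      step_weight y k [set j : 'I_L | (j < k)%N && (c j == c k)])%R.
  elim: m => [|m IH] mL.
    have S0 : [set k : 'I_L | (k < 0)%N && (c k == e)] = finset.set0.
      by apply/setP => k; rewrite !inE.
    rewrite big_pred0 // mulr1 /ext_count /known S0 big_set0 card_extends;
      last by apply/pinjP => a; rewrite inE.
    by rewrite cards0 subn0 card_ord.
  pose k0 := Ordinal mL; have kE (k : 'I_L) : (k < m.+1)%N = (k == k0) || (k < m)%N.
    by rewrite ltnS leq_eqVlt.
  have [ce|ce] := boolP (c k0 == e); last first.
    have E (k : 'I_L) : (k < m.+1)%N && (c k == e) = (k < m)%N && (c k == e).
      by rewrite kE; have [->|//] := eqVneq k k0; rewrite (negbTE ce) andbF /= andbF.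
    by under eq_bigl => k do rewrite E; under eq_finset => k do rewrite E; exact/IH/ltnW.
  have -> : [set k : 'I_L | (k < m.+1)%N && (c k == e)] =
      k0 |: [set k : 'I_L | (k < m)%N && (c k == e)].
    by apply/setP => k; rewrite !inE kE; have [->|//] := eqVneq k k0; rewrite ce.
  rewrite knownU1 ext_countU; last 2 first.
  - exact: pinj_pairs.
  - by rewrite -knownU1 (leq_trans (card_known _ _)).
  rewrite IH ?(ltnW mL) // -mulrA; congr (_ * _).
  rewrite [RHS](bigD1 k0) /=; last by rewrite ltnSn.
  rewrite mulrC; congr (_ * _).
    have -> // : [set k : 'I_L | (k < m)%N && (c k == e)] =
      [set j : 'I_L | (j < k0)%N && (c j == c k0)].
    by apply/setP => k; rewrite !inE (eqP ce).
  apply: eq_bigl => k; rewrite kE; have [->|] := eqVneq k k0; first by rewrite ltnn andbF.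
  by rewrite andbT.
have -> : [set k | c k == e] = [set k : 'I_L | (k < L)%N && (c k == e)].
  by apply/setP => k; rewrite !inE ltn_ord.
rewrite main //; congr (_ * _); apply: eq_bigl => k; by rewrite ltn_ord.
Qed.

(* Letters with the same colour receive the same permutation. *)
Definition color_sum (C : finType) (c : 'I_L -> C) : R :=
  \sum_(y | strand_inj y)
    \prod_k step_weight y k [set j : 'I_L | (j < k)%N && (c j == c k)].

Definition signed_perm (s : 'S_N) (e : bool) : 'S_N := (if e then s^-1 else s)%g.

(** The colour type is arbitrary because three colourings occur: by generators for the expectation,
    by edges of a Schreier graph for random homomorphisms, and by one colour for a single
    permutation. *)
Lemma expected_color_sum (C : finType) (c : 'I_L -> C) :
  ((\sum_(s : {ffun C -> 'S_N})
      t * cycle_count t (\prod_(k < L) signed_perm (s (c k)) (b k))%g)%N)%:R =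
  (N`!)%:R ^+ #|C| * color_sum c.
Proof.
rewrite natr_sum.
have liftE (s : {ffun C -> 'S_N}) y : lifts_path (fun k => signed_perm (s (c k)) (b k)) y =
    [forall e, extends (s e) (known y [set k | c k == e])].
  apply/forallP/forallP => [H e|H p].
    apply/extendsP => x /bigcupP[k]; rewrite inE => /eqP <- /imsetP[p + ->] /=.
    rewrite inE => /eqP <-; have /eqP := H p.
    have bp : b (strand p) = b p by exact: sign_mod.
    rewrite /psrc /ptgt /signed_perm bp; case: (b p) => /=; rewrite ?addn0 ?addn1 cpos_val.
      by move=> ->; rewrite permKV.
    by move=> ->.
  have bp : b (strand p) = b p by exact: sign_mod.
  have /extendsP/(_ (y (psrc p), y (ptgt p))) := H (c (strand p)); rewrite /signed_perm bp.
  have pk : (y (psrc p), y (ptgt p)) \in known y [set k | c k == c (strand p)].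
    by apply/bigcupP; exists (strand p); rewrite ?inE //; apply/imsetP; exists p; rewrite ?inE.
  move=> /(_ pk) /=; rewrite /psrc /ptgt; case: (b p) => /=; rewrite ?addn0 ?addn1 cpos_val.
    by move=> <-; rewrite permK.
  by move=> ->.
transitivity (\sum_(s : {ffun C -> 'S_N}) \sum_(y | strand_inj y)
    (lifts_path (fun k => signed_perm (s (c k)) (b k)) y)%:R : R)%R.
  apply: eq_bigr => s _; rewrite -card_lifts_path -sum1_card natr_sum.
  by rewrite [RHS]big_mkcond [LHS]big_mkcond; apply: eq_bigr => y _; rewrite inE;
    case: (strand_inj y); case: lifts_path.
rewrite exchange_big /= /color_sum big_distrr /=; apply: eq_bigr => y yI.
rewrite (partition_big c predT) //=.
have -> : ((N`!)%:R ^+ #|C| = \prod_(e : C) (N`!)%:R :> R)%R by rewrite prodr_const.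
rewrite -big_split /=.
transitivity (\prod_(e : C) ext_count (known y [set k | c k == e])); last first.
  by apply: eq_bigr => e _; exact: ext_count_prod.
under [RHS]eq_bigr => e _ do rewrite /ext_count -sum1_card natr_sum big_mkcond /=.
rewrite bigA_distr_bigA; apply: eq_bigr => s _; rewrite liftE.
under eq_bigr => e _ do rewrite inE.
have [/forallP H|/forallPn[e He]] :=
  boolP [forall e, extends (s e) (known y [set k | c k == e])].
  by rewrite big1 // => e _; rewrite H.
by rewrite (bigD1 e) //= (negbTE He) mul0r.
Qed.

End Weights.
End CyclicPositions.

(** * Bounds on the Moebius inverses of the weights *)

Section BooleanMoebius.
Local Open Scope ring_scope.
Variables (K : finType) (R : realFieldType).
Implicit Types (S H : {set K}) (F : {set K} -> R).

Definition toggle (j : K) S := if j \in S then S :\ j else j |: S.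

Lemma toggleK j : involutive (toggle j).
Proof.
move=> S; rewrite /toggle; have [jS|jS] := boolP (j \in S).
  by rewrite !inE eqxx /= finset.setD1K.
by rewrite !inE eqxx /= setU1K.
Qed.

(** Toggling [j] is a sign-reversing involution of the index sets. *)
Lemma sum_toggle0 (j : K) (P : pred {set K}) F :
  (forall S, j \notin S -> P (j |: S) = P S) ->
  (forall S, j \notin S -> P S -> F (j |: S) = - F S) ->
  \sum_(S | P S) F S = 0.
Proof.
move=> Pj Fj.
have Pt S : P (toggle j S) = P S.
  rewrite /toggle; case: ifPn => jS; last exact: Pj.
  by rewrite -[in RHS](finset.setD1K jS) Pj // !inE eqxx.
have Ft S : P S -> F (toggle j S) = - F S.
  rewrite /toggle; case: ifPn => jS PS; last exact: Fj.
  by rewrite -[in RHS](finset.setD1K jS) Fj ?opprK ?inE ?eqxx // -Pj ?inE ?eqxx // finset.setD1K.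
have : \sum_(S | P S) F S = - \sum_(S | P S) F S.
  rewrite {1}(reindex_inj (inv_inj (toggleK j))) /= -sumrN.
  by rewrite (eq_bigl P) //; apply: eq_bigr => S; exact: Ft.
by move=> e; lra.
Qed.

Definition moebius F S : R := \sum_(H : {set K} | H \subset S) (-1) ^+ #|S :\: H| * F H.

Lemma moebiusK F S : \sum_(H : {set K} | H \subset S) moebius F H = F S.
Proof.
rewrite /moebius (exchange_big_dep (fun H : {set K} => H \subset S)) /=; last first.
  by move=> H H' HS H'H; exact: fintype.subset_trans H'H HS.
rewrite (bigD1 S) //= [X in _ + X]big1 ?addr0 => [|H /andP[HS ne]].
  rewrite (big_pred1 S) => [|H]; first by rewrite finset.setDv cards0 mul1r.
  by rewrite -finset.eqEsubset pred1E.
have [j jS jH] : exists2 j, j \in S & j \notin H.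
  by apply/fintype.subsetPn; rewrite finset.eqEsubset HS in ne.
apply: (sum_toggle0 (j := j)) => [S' jS'|S' jS' _].
  rewrite finset.subUset finset.sub1set jS /= [RHS]andbC [LHS]andbC; congr (_ && _).
  apply/idP/idP => [HU|HS']; last exact: fintype.subset_trans HS' (finset.subsetUr _ _).
  apply/fintype.subsetP => x xH; have := fintype.subsetP HU x xH; rewrite !inE.
  by case/orP=> // /eqP xj; rewrite -xj xH in jH.
suff -> : #|(j |: S') :\: H| = #|S' :\: H|.+1 by rewrite exprS mulN1r mulNr.
rewrite (cardsD1 j (_ :\: H)) !inE eqxx jH /= add1n; congr (#|pred_of_set _|.+1).
by apply/setP => x; rewrite !inE; have [->|] := eqVneq x j; rewrite ?(negbTE jS') ?andbF.
Qed.

End BooleanMoebius.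

Section NewtonExpansion.
Local Open Scope ring_scope.
Variables (R : realFieldType) (N : nat).

Definition rising n m := (\prod_(i < m) (n + i))%N.
(* The coefficients of the Newton expansion of [q |-> 1 / (N - q)_n] in binomials of [q]. *)
Definition newton_coef n m : R := (rising n m)%:R / (N ^_ (n + m))%:R.

Lemma newton_coefS n m : newton_coef n m.+1 = n%:R * newton_coef n.+1 m.
Proof.
rewrite /newton_coef /rising big_ord_recl /= addn0 natrM -mulrA addnS addSn; congr (_ * (_%:R / _)).
by apply: eq_bigr => i _; rewrite addnS addSn.
Qed.

Lemma sum_subsetU1 (K : finType) (a : K) (Q : {set K}) (f : {set K} -> R) : a \notin Q ->
  \sum_(H : {set K} | H \subset a |: Q) f H =
    \sum_(H : {set K} | H \subset Q) f H + \sum_(H : {set K} | H \subset Q) f (a |: H).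
Proof.
move=> aQ; rewrite (bigID (fun H : {set K} => a \in H)) /= addrC; congr (_ + _).
  apply: eq_bigl => H; apply/andP/idP => [[HaQ aH]|HQ].
    by rewrite -(setU1K aQ) finset.subsetD1 HaQ.
  split; first exact: fintype.subset_trans HQ (finset.subsetU1 _ _).
  by apply: contra aQ; exact: (fintype.subsetP HQ).
rewrite (reindex_onto (fun H => a |: H) (fun H => H :\ a)) /=; last first.
  by move=> H /andP[_ aH]; rewrite finset.setD1K.
apply: eq_bigl => H; rewrite !inE eqxx andbT; apply/andP/idP => [[HaQ /eqP e]|HQ].
  by rewrite -e -(setU1K aQ) finset.setSD.
split; first exact: finset.setUS.
by apply/eqP/setU1K; apply: contra aQ; exact: (fintype.subsetP HQ).
Qed.

Lemma inv_ffactS q n : (q.+1 + n <= N)%N ->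
  inv_ffact R N q.+1 n = inv_ffact R N q n + n%:R * inv_ffact R N q n.+1.
Proof.
move=> qn; rewrite /inv_ffact; set M := (N - q.+1)%N.
have -> : (N - q = M.+1)%N by rewrite /M; lia.
have nM : (n <= M)%N by rewrite /M; lia.
rewrite ffactSS natrM.
have e1 : (M.+1 ^_ n)%:R = (M.+1)%:R * (M ^_ n)%:R / (M.+1 - n)%:R :> R.
  rewrite -natrM -ffactSS ffactnSr natrM mulfK // pnatr_eq0; lia.
have h1 : (M ^_ n)%:R != 0 :> R by rewrite pnatr_eq0 -lt0n ffact_gt0.
have h2 : (M.+1)%:R != 0 :> R by rewrite pnatr_eq0.
have h3 : (M.+1 - n)%:R = (M.+1)%:R - n%:R :> R by rewrite natrB //; lia.
have h4 : (M.+1)%:R - n%:R != 0 :> R by rewrite -h3 pnatr_eq0; lia.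
by rewrite e1 h3; field; rewrite nat1r h1 h2 h4.
Qed.

(** The sum runs over subsets instead of having binomial coefficients, so that one can ask which
    strands the subset [H] meets. *)
Lemma newton_expansion (K : finType) (Q : {set K}) n : (#|Q| + n <= N)%N ->
  inv_ffact R N #|Q| n = \sum_(H : {set K} | H \subset Q) newton_coef n #|H|.
Proof.
have [c] := ubnP #|Q|; elim: c Q n => // c IH Q n; rewrite ltnS => Qc Qn.
have [Q0|[a aQ]] := set_0Vmem Q.
  rewrite Q0 cards0 (big_pred1 finset.set0) => [|H]; last by rewrite finset.subset0.
  by rewrite cards0 /newton_coef /inv_ffact /rising big_ord0 mul1r addn0 subn0.
have aQ' : a \notin Q :\ a by rewrite !inE eqxx.
have cQ : #|Q| = #|Q :\ a|.+1 by rewrite (cardsD1 a Q) aQ.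
rewrite -{2}(finset.setD1K aQ) sum_subsetU1 // cQ inv_ffactS -?cQ //.
rewrite !IH; try (by move: Qc Qn; rewrite cQ; lia).
congr (_ + _); rewrite big_distrr /=; apply: eq_bigr => H HQ.
rewrite cardsU1 (contra (fintype.subsetP HQ a)) // add1n.
by rewrite newton_coefS.
Qed.

Lemma newton_coef_ge0 n m : 0 <= newton_coef n m.
Proof. by rewrite /newton_coef divr_ge0. Qed.

Lemma ffact_ge d : (2 * d <= N)%N -> (N ^ d <= 2 ^ d * N ^_ d)%N.
Proof.
elim: d => // d IH hd; rewrite expnSr expnS ffactnSr.
have := IH (leq_trans (leq_mul (leqnn 2) (leqnSn d)) hd).
have : (N <= 2 * (N - d))%N by lia.
move=> h1 h2; apply: leq_trans (leq_mul h2 h1) _.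
by apply: eq_leq; ring.
Qed.

(** The rising factorial has [m] factors at most [B]; the falling one is at least (N / 2)^(n + m)
    because [N] is at least 2 * B. *)
Lemma newton_coef_le B n m d : (n + m <= B)%N -> (2 * B <= N)%N -> (d <= n + m)%N -> (0 < N)%N ->
  newton_coef n m <= (B ^ B * 2 ^ B)%:R * N%:R ^- d.
Proof.
move=> nmB BN dnm N0.
have N1 : 1 <= N%:R :> R by rewrite ler1n.
have N0' : 0 < N%:R :> R by rewrite ltr0n.
have le_d : N%:R ^- (n + m) <= N%:R ^- d :> R.
  rewrite lef_pV2 ?qualifE /= ?exprn_gt0 //; exact: ler_weXn2l.
have rB : (rising n m <= B ^ B)%N.
  have -> : (B ^ B = B ^ m * B ^ (B - m))%N by rewrite -expnD subnKC //; lia.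
  have r1 : (rising n m <= B ^ m)%N.
    have -> : (B ^ m = \prod_(i < m) B)%N by rewrite prod_nat_const card_ord.
    by apply: leq_prod => i _; have := ltn_ord i; lia.
  by apply: leq_trans r1 _; rewrite leq_pmulr // expn_gt0; lia.
have fB : ((N ^_ (n + m))%:R)^-1 <= (2 ^ B)%:R * N%:R ^- d :> R.
  apply: le_trans (_ : (2 ^ (n + m))%:R * N%:R ^- (n + m) <= _); last first.
    by apply: ler_pM => //; rewrite ler_nat leq_pexp2l.
  have f0 : 0 < (N ^_ (n + m))%:R :> R by rewrite ltr0n ffact_gt0; lia.
  rewrite -[leLHS]mul1r ler_pdivrMr // -mulrA mulrCA ler_pdivlMl ?exprn_gt0 // mulr1.
  by rewrite -natrX -natrM ler_nat ffact_ge //; lia.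
by rewrite /newton_coef natrM -mulrA; apply: ler_pM => //; rewrite ler_nat.
Qed.

End NewtonExpansion.

Section WeightBound.
Local Open Scope ring_scope.
Variables (L t : nat) (L0 : (0 < L)%N) (t0 : (0 < t)%N) (b : nat -> bool).
Variables (R : realFieldType) (N : nat).
Let B := (t + t * L)%N.
Hypothesis NB : (2 * B <= N)%N.
Variable y : {ffun 'I_(t * L) -> 'I_N}.

Let Q k := pairs_of L0 t0 b y k.
Let QS S := known L0 t0 b y S.

Definition touches (k j : 'I_L) :=
  [exists a in Q k, exists c in Q j, (a.1 == c.1) || (a.2 == c.2)].

Definition weight_moebius (k : 'I_L) (S : {set 'I_L}) : R :=
  moebius (step_weight L0 t0 b R y k) S.

(** The factors count the subsets [H] of the known pairs and the subsets of [S], and bound one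
    Newton coefficient. In [B], [t] bounds the new pairs and [t * L] the size of [H]. *)
Definition weight_constant : nat := (2 ^ (t * L) * 2 ^ L * (B ^ B * 2 ^ B))%N.

Lemma card_pairs_of k : (#|Q k| <= t)%N.
Proof.
by rewrite /Q /pairs_of (leq_trans (leq_imset_card _ _)) // card_strand.
Qed.

(* After the Newton expansion over subsets [H] of the known pairs, adding to or removing
   from [S'] an index [j] which neither touches [k] nor meets [H] changes only the sign,
   so only the sets [H] hitting all such [j] contribute. *)
Lemma weight_moebius_bound k S d :
  (forall H : {set 'I_N * 'I_N}, H \subset QS S ->
     (forall j, j \in S -> touches k j || (H :&: Q j != finset.set0)) ->
     (d <= #|Q k :\: QS S| + #|H|)%N) ->
  `|weight_moebius k S| <= weight_constant%:R * N%:R ^- d.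
Proof.
move=> hit.
have B0 : (0 < B)%N by rewrite /B addn_gt0 t0.
have N0 : (0 < N)%N by lia.
have QSB (S' : {set 'I_L}) : (#|QS S'| <= t * L)%N by exact: card_known.
have nB (S' : {set 'I_L}) : (#|Q k :\: QS S'| <= t)%N.
  by rewrite (leq_trans (subset_leq_card (finset.subsetDl _ _))) // card_pairs_of.
have QSmono (S' S'' : {set 'I_L}) : S' \subset S'' -> QS S' \subset QS S''.
  move=> sub; apply/finset.bigcupsP => j jS; apply: finset.bigcup_sup.
  exact: (fintype.subsetP sub).
pose F (H : {set 'I_N * 'I_N}) (S' : {set 'I_L}) : R := (-1) ^+ #|S :\: S'| * ((compat (Q k) (QS S'))%:R *
  newton_coef R N #|Q k :\: QS S'| #|H|).
have -> : weight_moebius k S =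
   \sum_(H : {set _} | H \subset QS S) \sum_(S' : {set _} | (S' \subset S) && (H \subset QS S')) F H S'.
  rewrite /weight_moebius /moebius.
  transitivity (\sum_(S' : {set _} | S' \subset S) \sum_(H : {set _} | H \subset QS S') F H S').
    apply: eq_bigr => S' _; rewrite /step_weight -/(Q k) -/(QS S') newton_expansion.
      by rewrite !big_distrr.
    by have := QSB S'; have := nB S'; move: NB; rewrite /B; lia.
  rewrite (exchange_big_dep (fun H : {set _} => H \subset QS S)) //= => S' H S'S HS'.
  exact: fintype.subset_trans HS' (QSmono _ _ S'S).
have Fle (H : {set 'I_N * 'I_N}) (S' : {set 'I_L}) : S' \subset S ->
    (d <= #|Q k :\: QS S| + #|H|)%N -> (#|H| <= t * L)%N ->
    `|F H S'| <= (B ^ B * 2 ^ B)%:R * N%:R ^- d.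
  move=> S'S dH HL; rewrite /F normrM normrX normrN1 expr1n mul1r normrM normr_nat.
  rewrite ger0_norm ?newton_coef_ge0 //.
  have le : newton_coef R N #|Q k :\: QS S'| #|H| <= (B ^ B * 2 ^ B)%:R * N%:R ^- d.
    apply: newton_coef_le => //; first by have := nB S'; rewrite /B; lia.
    apply: leq_trans dH _; rewrite leq_add2r; apply/subset_leq_card/finset.setDS.
    exact: QSmono.
  apply: le_trans le; case: compat; first by rewrite mul1r.
  by rewrite mul0r newton_coef_ge0.
have inner (H : {set 'I_N * 'I_N}) : H \subset QS S ->
    `|\sum_(S' : {set _} | (S' \subset S) && (H \subset QS S')) F H S'| <=
    (2 ^ L)%:R * ((B ^ B * 2 ^ B)%:R * N%:R ^- d).
  move=> HS; have HL : (#|H| <= t * L)%N by rewrite (leq_trans (subset_leq_card HS)).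
  have c0 : 0 <= (B ^ B * 2 ^ B)%:R * N%:R ^- d :> R.
    by rewrite mulr_ge0 // invr_ge0 exprn_ge0.
  have [hits|] := boolP [forall j in S, touches k j || (H :&: Q j != finset.set0)].
    have dH : (d <= #|Q k :\: QS S| + #|H|)%N.
      by apply: hit => // j jS; have /forallP/(_ j)/implyP/(_ jS) := hits.
    apply: le_trans (ler_norm_sum _ _ _) _.
    apply: le_trans (_ : \sum_(S' : {set 'I_L}) ((B ^ B * 2 ^ B)%:R * N%:R ^- d) <= _).
      rewrite big_mkcond /=; apply: ler_sum => S' _; case: ifP => // /andP[S'S _].
      exact: Fle.
    have cS : #|{: {set 'I_L}}| = (2 ^ L)%N.
      by rewrite -cardsT -powersetT card_powerset cardsT card_ord.
    by rewrite sumr_const cS [leRHS]mulr_natl.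
  case/forallPn => j; rewrite negb_imply negb_or negbK => /and3P[jS /existsP nt /eqP HQ].
  have notouch a c : a \in Q k -> c \in Q j -> (a.1 == c.1) = false /\ (a.2 == c.2) = false.
    move=> aQ cQ; have : ~~ ((a.1 == c.1) || (a.2 == c.2)).
      apply/negP => e; apply: nt.
      by exists a; rewrite aQ; apply/existsP; exists c; rewrite cQ.
    by rewrite negb_or => /andP[/negbTE-> /negbTE->].
  have QSU (S' : {set 'I_L}) : QS (j |: S') = QS S' :|: Q j by exact: knownU1.
  rewrite (sum_toggle0 (j := j)) ?normr0 ?mulr_ge0 // => S' jS'.
    rewrite finset.subUset finset.sub1set jS /= QSU; congr (_ && _).
    apply/idP/idP => [HU|]; last by move=> h; apply: fintype.subset_trans h (finset.subsetUl _ _).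
    apply/fintype.subsetP => x xH; have := fintype.subsetP HU x xH; rewrite inE => /orP[//|xQ].
    have : x \in H :&: Q j by rewrite inE xH.
    by rewrite HQ inE.
  move=> _; rewrite /F QSU.
  have -> : Q k :\: (QS S' :|: Q j) = Q k :\: QS S'.
    apply/setP => x; rewrite !inE negb_or -andbA; congr (_ && _).
    apply: andb_idl => xk; apply/negP => xj; have [] := notouch x x xk xj; by rewrite eqxx.
  have -> : compat (Q k) (QS S' :|: Q j) = compat (Q k) (QS S').
    apply/compatP/compatP => H1 a c aQ cQ; first by apply: H1; rewrite // inE cQ.
    move: cQ; rewrite inE => /orP[cQ|cQ]; first exact: H1.
    by have [-> ->] := notouch a c aQ cQ.
  suff -> : #|S :\: S'| = #|S :\: (j |: S')|.+1 by rewrite exprS mulN1r mulNr opprK.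
  rewrite (cardsD1 j (S :\: S')) !inE jS jS' /= add1n; congr (#|pred_of_set _|.+1).
  by apply/setP => x; rewrite !inE; case: (x == j); rewrite ?andbF.
apply: le_trans (ler_norm_sum _ _ _) _.
apply: le_trans (ler_sum _ inner) _.
rewrite (eq_bigl (fun H => H \in powerset (QS S))) => [|H]; last by rewrite powersetE.
rewrite sumr_const card_powerset -[leLHS]mulr_natl /weight_constant !natrM -!mulrA.
have c0 : 0 <= (2 ^ L)%:R * ((B ^ B)%:R * ((2 ^ B)%:R * N%:R ^- d)) :> R.
  by rewrite !mulr_ge0 // invr_ge0 exprn_ge0.
apply: ler_pM => //; by rewrite ler_nat leq_pexp2l.
Qed.

End WeightBound.

(** * Ranks of the join groups *)

Section KeyLemma.
Local Open Scope group_scope.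
Local Open Scope classical_set_scope.
Variables (r L t : nat) (l : nat -> 'I_r * bool) (A : nat -> free_group 'I_r).
Hypotheses (L0 : (0 < L)%N) (t2 : (1 < t)%N).
Let t0 : (0 < t)%N := ltnW t2.
Hypothesis lL : forall p, l (p + L)%N = l p.
Hypothesis l_red : forall p, l p.+1 != linv (l p).
Hypothesis l_aper : forall d, (0 < d < L)%N -> ~ forall p, l (p + d)%N = l p.
Hypothesis AS : forall p, A p.+1 = A p * lval (l p).

Let w := A L * (A 0)^-1.
Let b p := (l p).2.
Let bL p : b (p + L)%N = b p. Proof. by rewrite /b lL. Qed.

Notation src := (lsrc l).
Notation tgt := (ltgt l).
Notation gen := (lgen l).
Notation T := 'I_(t * L).
Notation cpos := (cpos L0 t0).
Notation strand := (strand L0 (t := t)).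
Notation strandn := (strandn L0).
Notation psrc := (psrc L0 t0 b).
Notation ptgt := (ptgt L0 t0 b).

Lemma A_period p n : A (p + n * L)%N = w ^+ n * A p.
Proof.
have A1 q : A (q + L)%N = w * A q.
  elim: q => [|q IH]; first by rewrite add0n mulgKV.
  by rewrite addSn !AS IH lL mulgA.
elim: n => [|n IH]; first by rewrite addn0 mul1g.
by rewrite mulSn addnCA addnC A1 IH mulgA -expgS.
Qed.

Lemma A_modn (K : set (free_group 'I_r)) p q : is_subgroup K -> K w ->
  p = q %[mod L] -> K (A p * (A q)^-1).
Proof.
move=> gK Kw e.
have key p' : K (A p' * (A (p' %% L))^-1).
  by rewrite {1}(divn_eq p' L) addnC A_period mulgK; exact: subgroupX.
apply: (subgroup_div_trans gK (key p)); rewrite e; exact: subgroup_divC.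
Qed.

Variable D : {ffun 'I_L -> {set 'I_L}}.

(** The group is the least one containing [w] in whose Schreier graph the edges of the letters [k]
    and [j] have the same source whenever [j] is in [D k]. *)
Definition join_gens : set (free_group 'I_r) :=
  [set x | x = w \/ exists k j : 'I_L, j \in D k /\ x = A (src k) * (A (src j))^-1].
Definition join_group := gensub join_gens.

Hypothesis D_low : forall k j, j \in D k -> (j < k)%N /\ gen j = gen k.

Let K := join_group.
Let gK : is_subgroup K. Proof. exact: gensub_subgroup. Qed.
Let Kw : K w. Proof. by apply: sub_gensub; left. Qed.
Let KD (k j : 'I_L) : j \in D k -> vrel A K (src k) (src j).
Proof. by move=> jk; apply/asboolP; apply: sub_gensub; right; exists k, j. Qed.

Lemma vrel_mod p q : p = q %[mod L] -> vrel A K p q.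
Proof. by move=> e; apply/asboolP; exact: A_modn. Qed.

Lemma l_mod p : l (p %% L)%N = l p.
Proof.
rewrite {2}(divn_eq p L) addnC; elim: (p %/ L) => [|n IH]; first by rewrite addn0.
by rewrite mulSn addnCA addnC lL.
Qed.

Lemma l_strand (p : T) : l (strand p) = l p. Proof. exact: l_mod. Qed.

Lemma src_mod p q : p = q %[mod L] -> src p = src q %[mod L].
Proof.
move=> e; have el : l p = l q by rewrite -l_mod e l_mod.
by rewrite /lsrc el -modnDml e modnDml.
Qed.

Lemma tgt_mod p q : p = q %[mod L] -> tgt p = tgt q %[mod L].
Proof.
move=> e; have el : l p = l q by rewrite -l_mod e l_mod.
by rewrite /ltgt el -modnDml e modnDml.
Qed.

Lemma strand_mod (p : T) : strand p = p %[mod L]. Proof. by rewrite /= modn_mod. Qed.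

Lemma cpos_mod p : cpos p = p %[mod L].
Proof. by rewrite /= modn_dvdm // dvdn_mull. Qed.

Lemma psrcE (p : T) : psrc p = cpos (src p). Proof. by []. Qed.
Lemma ptgtE (p : T) : ptgt p = cpos (tgt p). Proof. by []. Qed.

Variables (N : nat) (y : {ffun T -> 'I_N}).
Hypothesis yI : strand_inj L0 y.
Notation Q := (pairs_of L0 t0 b y).
Notation QS := (known L0 t0 b y).

(* The labelling factors through the Schreier graph of [K] and the points: positions are
   identified when both their [K]-cosets and their labels agree. *)
Definition vclass (p : T) : T := class_rep (fun p q : T => vrel A K p q && (y p == y q)) p.

Lemma vclassP p q : (vclass p == vclass q) = vrel A K p q && (y p == y q).
Proof.
apply: class_repP => [p'|p' q'|q' p' r'].
- by rewrite vrelxx // eqxx.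
- by rewrite vrel_sym // eq_sym.
- by move=> /andP[h1 /eqP->] /andP[h2 ->]; rewrite (vrel_trans gK h1 h2).
Qed.

Lemma card_image_vclass : (#|[set y p | p : T]%SET| <= ncolors vclass)%N.
Proof.
rewrite card_image_ncolors.
apply: size_undup_map_le => p q _ _ /eqP; rewrite vclassP => /andP[_ /eqP//].
Qed.

Let pr (p : T) := (y (psrc p), y (ptgt p)).
Let isnew (p : T) := pr p \notin QS (D (strand p)).

Lemma mem_pairs_of (k : 'I_L) a : a \in Q k -> exists2 p : T, strand p = k & a = pr p.
Proof. by case/imsetP=> p; rewrite inE => /eqP pk ->; exists p. Qed.

Lemma mem_pr (p : T) : pr p \in Q (strand p).
Proof. by apply/imsetP; exists p; rewrite ?inE. Qed.

(* Descending along [D] to a strand where the pair is not already known. *)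
Lemma root_exists (p : T) : exists q : T,
  [/\ isnew q, pr q = pr p, gen q = gen p & vrel A K (src p) (src q)].
Proof.
have [m] := ubnP (strand p); elim: m p => // m IH p; rewrite ltnS => pm.
have [pnew|] := boolP (isnew p); first by exists p; rewrite vrelxx.
rewrite negbK => /bigcupP[j jD /mem_pairs_of[p' p'j e]].
have [jp gj] := D_low jD.
have [|q [qnew qe qg qv]] := IH p'; first by rewrite p'j (leq_trans jp).
have gp' : gen p' = gen p by rewrite /lgen -l_strand p'j -/(gen j) gj /lgen l_strand.
exists q; split; rewrite ?qe ?qg ?gp' //.
apply: (vrel_trans gK) qv; apply: (vrel_trans gK (y := src (strand p))).
  by apply/vrel_mod/src_mod; rewrite strand_mod.
apply: (vrel_trans gK (y := src j)); first exact: KD.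
by apply/vrel_mod/src_mod; rewrite -p'j strand_mod.
Qed.

Lemma card_new : (#|[set p | isnew p]%SET| <= \sum_k #|(Q k :\: QS (D k))%SET|)%N.
Proof.
rewrite -sum1_card (partition_big strand predT) //=; apply: leq_sum => k _.
rewrite sum1_card -(card_in_imset (f := pr)).
  apply/subset_leq_card/fintype.subsetP => a /imsetP[p + ->].
  rewrite !inE => /andP[pn /eqP pk]; move: pn; rewrite ?inE /isnew pk => ->.
  by rewrite -pk mem_pr.
move=> p q; rewrite !unfold_in => /andP[_ /eqP pk] /andP[_ /eqP qk] [e _].
have pq : strand p = strand q by rewrite pk qk.
have [es _] := strand_ends (L0 := L0) t0 bL pq.
by apply: (psrc_inj (L0 := L0) (t0 := t0) bL pq); exact: (strand_injP _ _ yI).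
Qed.

Lemma vclass_end (e : nat -> nat) p q :
  vrel A K (e p) (e q) -> y (cpos (e p)) = y (cpos (e q)) ->
  vclass (cpos (e p)) = vclass (cpos (e q)).
Proof.
move=> epq ypq; apply/eqP; rewrite vclassP ypq eqxx andbT.
apply: (vrel_trans gK (y := e p)); first by apply/vrel_mod/cpos_mod.
apply: (vrel_trans gK epq); rewrite vrel_sym //; exact/vrel_mod/cpos_mod.
Qed.

Variable root : T -> T.
Hypothesis rootP : forall p,
  [/\ isnew (root p), pr (root p) = pr p, gen (root p) = gen p & vrel A K (src p) (src (root p))].

Lemma root_sound p q : root p = root q ->
  [/\ gen p = gen q, pr p = pr q & vrel A K (src p) (src q) /\ vrel A K (tgt p) (tgt q)].
Proof.
move=> e; have [_ p1 p2 p3] := rootP p; have [_ q1 q2 q3] := rootP q.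
have eg : gen p = gen q by rewrite -p2 -q2 e.
have ev : vrel A K (src p) (src q).
  by apply: (vrel_trans gK p3); rewrite e vrel_sym.
split=> //; first by rewrite -p1 -q1 e.
split=> //; apply: (erel_tgt AS); by rewrite erelE eg eqxx.
Qed.

Lemma root_ends p q : root p = root q ->
  [/\ gen (strand p) = gen (strand q), vclass (psrc p) = vclass (psrc q) &
      vclass (ptgt p) = vclass (ptgt q)].
Proof.
move=> /root_sound[eg [es et] [vs vt]]; split.
- by rewrite /lgen !l_strand.
- exact: (vclass_end (e := src)).
- exact: (vclass_end (e := tgt)).
Qed.

Lemma root_inj p q : strand p = strand q -> root p = root q -> p = q.
Proof.
move=> pq /root_sound[_ [es _] _]; have [e1 _] := strand_ends (L0 := L0) t0 bL pq.
by apply: (psrc_inj (L0 := L0) (t0 := t0) bL pq); exact: (strand_injP _ _ yI).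
Qed.

Lemma strandn_mod p q : (strandn p = strandn q) <-> p = q %[mod L].
Proof. by split=> [/(congr1 val)//|e]; apply: val_inj. Qed.

Lemma end_onto (c : bool) (k : 'I_L) (p : T) : strand p = strandn (k + c) ->
  exists2 p', strand p' = k & cpos (p' + c) = p.
Proof.
move=> /(congr1 val) /= e; have tL : (0 < t * L)%N := positions_gt0 L0 t0.
exists (cpos (p + (t * L - c))%N).
  rewrite strand_cpos -[RHS]strandn_val; apply/strandn_mod/eqP.
  rewrite -(eqn_modDr c) -addnA subnK; last by case: (c).
  by rewrite -modnDmr modnMl addn0 e.
rewrite cpos_cposD -addnA subnK; last by case: (c).
by apply: val_inj; rewrite /= modnDr modn_small.
Qed.

Let first (k : 'I_L) : T := cpos k.

Lemma first_strand k : strand (first k) = k.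
Proof. by rewrite strand_cpos strandn_val. Qed.

Lemma root_dichotomy :
  (ncolors vclass + ncolors (mergeS strand first root [set: 'I_L]%SET) <
     ncolors (mergeS strand first vclass [set: 'I_L]%SET) + ncolors root)%N \/
  exists p1, forall p, root p = root p1 -> p = p1.
Proof.
have [f [fc f_inj]] := stack_order L0 lL l_red l_aper.
have fm p : f (p %% L)%N = f p by exact: (stack_mod fc).
pose M := (\max_(k < L) f (src k)).+1.
have fM (k : 'I_L) : (f (src k) < M)%N.
  by rewrite ltnS; exact: (@leq_bigmax _ (fun k : 'I_L => f (src k))).
(* Within a generator, edges are ordered by the stacking at their sources; the multiple of [M]
   separates the generators. *)
pose fE (k : 'I_L) := (gen k * M + f (src k))%N.
have fE_lt (k j : 'I_L) : gen k = gen j -> (fE k < fE j)%N = (f (src k) < f (src j))%N.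
  by move=> e; rewrite /fE e ltn_add2l.
have fE_inj : injective fE.
  move=> k j e; have M0 : (0 < M)%N by exact: ltn0Sn.
  have eg : gen k = gen j.
    apply: val_inj; have := congr1 (fun n => n %/ M)%N e.
    by rewrite /fE /= !divnMDl // !divn_small // !addn0.
  have ef : f (src k) = f (src j).
    by have := congr1 (fun n => n %% M)%N e; rewrite /fE !modnMDl !modn_small.
  have := f_inj _ _ ef; rewrite /lsrc; move: eg; rewrite /lgen.
  case El : (l k) => [i1 c]; case El' : (l j) => [i2 c'] /= ei; rewrite -{i2}ei in El' *.
  have small (x : 'I_L) : (x %% L)%N = x by rewrite modn_small.
  (* Different letters with the same generator and source would be consecutive and mutually
     inverse. *)
  case: c El => El; case: c' El' => El'; rewrite ?addn0 ?addn1.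
  - by move=> /eqP; rewrite -(addn1 k) -(addn1 j) eqn_modDr !small => /eqP /val_inj.
  - move=> e'; case/negP: (l_red k); rewrite -l_mod e' l_mod El El'; exact: eqxx.
  - move=> e'; case/negP: (l_red j); rewrite -l_mod -e' l_mod El El'; exact: eqxx.
  - by rewrite !small => /val_inj.
have fV_inj : injective (fun k : 'I_L => f k).
  by move=> k j /f_inj; rewrite !modn_small // => /val_inj.
have [_ fS fR] := fc.
apply: (stacked_cycle (t := t) (lg := fun k : 'I_L => gen k) (src := psrc) (tgt := ptgt)
  (ssrc := fun k => strandn (src k)) (stgt := fun k => strandn (tgt k))
  (nx := fun k => strandn k.+1) first_strand t2 _ _ _ _ _ _ _ fV_inj fE_inj).
- exact: card_strand.
- by move=> p; rewrite psrcE strand_cpos; apply/strandn_mod/src_mod; rewrite strand_mod.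
- by move=> p; rewrite ptgtE strand_cpos; apply/strandn_mod/tgt_mod; rewrite strand_mod.
- move=> k p /end_onto[p' p'k e]; exists p' => //; rewrite psrcE /lsrc -l_strand p'k; exact: e.
- move=> k p /end_onto[p' p'k e]; exists p' => //; rewrite ptgtE /ltgt -l_strand p'k; exact: e.
- exact: root_ends.
- exact: root_inj.
- by move=> k j e; rewrite fE_lt //= !fm.
- move=> k j e; rewrite fE_lt //= !fm; move: e (fS k j) (fS j k) (fR k j) (fR j k).
  rewrite /lgen /lsrc /ltgt.
  case El : (l k) => [i1 c]; case El' : (l j) => [i2 c'] /= ei; rewrite -{i2}ei in El' *.
  case: c El => El; case: c' El' => El'; rewrite ?addn0 ?addn1.
  + by move=> ->.
  + by move=> _ _ ->.
  + by move=> _ _ ->.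
  + by move=> ->.
- move=> k; rewrite /lsrc /ltgt; case: (l k).2; rewrite ?addn0 ?addn1 strandn_val; [right|left] => //.
- move=> k j; exists (j + (L - k))%N.
  have it n : iter n (fun k0 : 'I_L => strandn k0.+1) k = strandn (k + n).
    elim: n => [|n IH] /=; first by rewrite addn0 strandn_val.
    rewrite IH; apply/strandn_mod; rewrite /= -addn1 modnDml addn1 addnS //.
  rewrite it -[RHS]strandn_val; apply/strandn_mod.
  by rewrite addnCA subnKC ?modnDr // ltnW.
- exact: (strandn 0).
Qed.

Lemma path_colors_cpos (C : eqType) (c : T -> C) (s : seq nat) :
  (forall p, c p \in map (c \o cpos) s) -> path_colors (c \o cpos) s = ncolors c.
Proof.
move=> cs; apply/perm_size/uniq_perm; rewrite ?undup_uniq // => x; rewrite !mem_undup.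
apply/mapP/mapP => [[p _ ->]|[p _ ->]]; first by exists (cpos p); rewrite ?mem_enum.
exact/mapP/cs.
Qed.

Lemma ncolors_root : (ncolors root <= \sum_k #|(Q k :\: QS (D k))%SET|)%N.
Proof.
apply: leq_trans card_new; rewrite cardE; apply: uniq_leq_size; first exact: undup_uniq.
move=> x; rewrite mem_undup => /mapP[p _ ->]; rewrite mem_enum inE.
by have [] := rootP p.
Qed.

Variable H : 'I_L -> {set 'I_N * 'I_N}.
Hypothesis H_sub : forall k, H k \subset QS (D k).
Hypothesis H_hit : forall k j, j \in D k ->
  touches L0 t0 b y k j || ((H k :&: Q j)%SET != finset.set0).

(** One strand is selected for each pair in [H k], so that a pair costs a single generator however
    many strands contain it. *)
Let jsel (k : 'I_L) (a : 'I_N * 'I_N) : 'I_L := odflt k [pick j in D k | a \in Q j].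
Let hgens := [seq A (src k) * (A (src (jsel k a)))^-1 |
  k : 'I_L <- enum 'I_L, a : 'I_N * 'I_N <- enum (H k)].

Lemma size_hgens : size hgens = (\sum_k #|H k|)%N.
Proof.
rewrite size_allpairs_dep sumnE big_map big_enum /=.
by apply: eq_bigr => k _; rewrite cardE.
Qed.

Lemma jselP (k : 'I_L) a : a \in H k -> jsel k a \in D k /\ a \in Q (jsel k a).
Proof.
move=> aH; rewrite /jsel; case: pickP => [j /andP[]//|none].
have /bigcupP[j jD aQ] := fintype.subsetP (H_sub k) a aH.
by have := none j; rewrite jD aQ.
Qed.

Lemma hgens_sub g : g \in hgens -> K g.
Proof.
case/allpairsPdep=> k [a [_ aH ->]]; rewrite mem_enum in aH.
by have [jD _] := jselP aH; apply/asboolP; exact: KD.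
Qed.

(** A generator joining [k] to [j] is a loop of the vertex classes if the strands touch, and a touch
    at the targets is carried back along the common generator. Otherwise [H k] contains a pair of
    [j]: go from [k] to the strand selected for this pair, then to [j], which shares the pair. *)
Lemma join_group_sub (K' : set (free_group 'I_r)) : is_subgroup K' -> K' w ->
  (forall p q, vclass (cpos p) = vclass (cpos q) -> K' (A p * (A q)^-1)) ->
  (forall g, g \in hgens -> K' g) -> K `<=` K'.
Proof.
move=> gK' K'w loops hg.
have key (e : nat -> nat) (k j : 'I_L) (p q : T) :
    (forall p q, p = q %[mod L] -> e p = e q %[mod L]) ->
    strand p = k -> strand q = j -> vrel A K (e k) (e j) ->
    y (cpos (e p)) = y (cpos (e q)) -> K' (A (e k) * (A (e j))^-1).
  move=> em pk qj ekj epq.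
  have ep : e p = e k %[mod L] by apply: em; rewrite -pk strand_mod.
  have eq : e q = e j %[mod L] by apply: em; rewrite -qj strand_mod.
  apply: (subgroup_div_trans gK' (y := A (e p))); first by apply: A_modn => //; rewrite ep.
  apply: (subgroup_div_trans gK' (y := A (e q))); last exact: A_modn.
  apply: loops; apply: vclass_end => //.
  apply: (vrel_trans gK (vrel_mod ep)); apply: (vrel_trans gK ekj).
  by apply: vrel_mod; rewrite eq.
apply: gensub_min => // _ [->//|[k [j [jD ->]]]].
have [jk gjk] := D_low jD.
have [tch|hit] := orP (H_hit jD).
  case/existsP: tch => a /andP[/mem_pairs_of[p pk ->]].
  case/existsP=> c /andP[/mem_pairs_of[q qj ->]] /orP[]/eqP e.
    exact: (key src k j p q src_mod pk qj (KD jD) e).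
  have ekj : erel l A K k j by rewrite erelE gjk eqxx; exact: KD.
  have := key tgt k j p q tgt_mod pk qj (erel_tgt AS ekj) e.
  by rewrite !(A_ltgt AS) gjk invgM mulgA mulgK.
case/set0Pn: hit => a; rewrite inE => /andP[aH /mem_pairs_of[p pj ea]].
have [jsD /mem_pairs_of[q qj ea']] := jselP aH.
apply: (subgroup_div_trans gK' (y := A (src (jsel k a)))).
  by apply: hg; apply/allpairsPdep; exists k, a; rewrite !mem_enum.
apply: (key src _ _ q p src_mod qj pj).
  by apply: (vrel_trans gK (y := src k)); [rewrite vrel_sym //|]; exact: KD.
by move: ea'; rewrite ea => -[].
Qed.

Hypothesis w_nonprimitive : ~ primitive_in K w.

(* [K] is generated by the loops of the quotient graph obtained by merging all strands,
   together with [hgens]. In the first case of [root_dichotomy] these are few enough.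
   In the second case some edge class is a single edge: removing it from the graph leaves
   a connected path, so [w] can be taken as one of the generators, and since it is not
   primitive the rank is smaller than their number. *)
Lemma join_rank_bound : exists m, has_rank K m /\
  (m + #|[set y p | p : T]%SET| <= \sum_k (#|(Q k :\: QS (D k))%SET| + #|H k|))%N.
Proof.
rewrite big_split /= -size_hgens; set X := (\sum_k _)%N; set Y := #|_|.
have h1 : (ncolors root <= X)%N by exact: ncolors_root.
have h2 : (Y <= ncolors vclass)%N by exact: card_image_vclass.
(* One more generator is allowed if [w] is among them: as [w] is not primitive, the rank is then
   below their number. *)
suff [gs [Kgs szgs]] : exists gs : seq (free_group 'I_r), K = gensub [set x | x \in gs] /\
    (size gs + ncolors vclass <= ncolors root + size hgens + (w \in gs))%N.
  have := rank_gensub (l 0) gs; rewrite -Kgs => -[m [rk mgs prim]].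
  exists m; split=> //.
  move: szgs; have [wg|wg] := boolP (w \in gs); rewrite /= ?addn0 ?addn1 => szgs; last first.
    by move: h1 h2 mgs szgs; move: (size gs) (size hgens) (ncolors root) (ncolors vclass); lia.
  have ne : m != size gs by apply/eqP => e; apply: w_nonprimitive; exact: prim.
  move: (ltn_neqAle m (size gs)); rewrite ne mgs /= => lt.
  by move: h1 h2 lt szgs; move: (size gs) (size hgens) (ncolors root) (ncolors vclass); lia.
have [strict|[p1 uniq1]] := root_dichotomy.
  set XV := mergeS strand first vclass _ in strict; set XE := mergeS strand first root _ in strict.
  have XVs p q : strand p = strand q -> XV p = XV q.
    by move=> e; apply: (mergeS_strand _ vclass (k := strand q)); rewrite ?inE.
  have XVv p q : vclass p = vclass q -> XV p = XV q by exact: mergeS_color.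
  (* Positions of one strand differ by a power of [w], which lies in [K]. *)
  have XVr p q : XV p = XV q -> vrel A K p q.
    move=> e; pose h := class_rep (fun p q : T => vrel A K p q).
    have hP p' q' : (h p' == h q') = vrel A K p' q'.
      apply: class_repP => [x|x z|z x u].
      - exact: vrelxx.
      - exact: vrel_sym.
      - exact: vrel_trans.
    rewrite -hP; apply/eqP; move: e; apply: (mergeS_min first_strand) => [p' q' /eqP|k p' q' _ pk qk].
      by rewrite vclassP => /andP[hv _]; apply/eqP; rewrite hP.
    by apply/eqP; rewrite hP; apply: vrel_mod; apply/strandn_mod; exact: etrans pk (esym qk).
  have XEr p q : XE p = XE q -> [/\ gen p = gen q, XV (psrc p) = XV (psrc q) &
      XV (ptgt p) = XV (ptgt q)].
    pose h (x : T) := (gen x, (XV (psrc x), XV (ptgt x))).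
    move=> e; suff: h p = h q by case.
    move: e; apply: (mergeS_min first_strand) => [p' q' /root_ends[e1 /XVv e2 /XVv e3]|k p' q' _ pk qk].
      by rewrite /h e2 e3; congr (_, _); move: e1; rewrite /lgen !l_strand.
    have pq : strand p' = strand q' by rewrite pk qk.
    have [e1 [e2 _]] := strand_ends (L0 := L0) t0 bL pq.
    rewrite /h (XVs _ _ e1) (XVs _ _ e2); congr (_, _).
    by rewrite /lgen -!l_strand pq.
  have ncE (C : eqType) (c : T -> C) n : (forall p q, strand p = strand q -> c p = c q) ->
      (L <= n)%N -> path_colors (c \o cpos) (iota 0 n) = ncolors c.
    move=> cs Ln; apply: path_colors_cpos => p; apply/mapP; exists (strand p : nat).
      by rewrite mem_iota add0n leq0n (leq_trans (ltn_ord (strand p)) Ln).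
    by apply: cs; rewrite strand_cpos strandn_val.
  (* Once the strands are merged, a single period of length [L] traverses the whole graph. *)
  have [|gs [szgs gsP gsgen]] :=
      @path_generators _ _ _ A (XV \o cpos) (XE \o cpos) 0 L.
    move=> p q _ _ /= /XEr[e1 e2 e3].
    have ec (e : nat -> nat) n : (forall p q, p = q %[mod L] -> e p = e q %[mod L]) ->
        XV (cpos (e (cpos n))) = XV (cpos (e n)).
      move=> em; apply: XVs; rewrite !strand_cpos; apply/strandn_mod/em; exact: cpos_mod.
    have lc n : l (cpos n) = l n by rewrite -l_mod cpos_mod l_mod.
    apply: (erel_sound AS) => /=; first by move: e1; rewrite /lgen !lc.
      by move: e2; rewrite !psrcE !(ec src) //; exact: src_mod.
    by move: e3; rewrite !ptgtE !(ec tgt) //; exact: tgt_mod.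
  have XEs p q : strand p = strand q -> XE p = XE q.
    by move=> e; apply: (mergeS_strand _ root (k := strand q)); rewrite ?inE.
  rewrite !ncE // in szgs.
  pose Gs := gs ++ hgens; have gG := gensub_subgroup [set x | x \in Gs].
  have lift : gensub [set x | x \in gs] `<=` gensub [set x | x \in Gs].
    by apply: gensub_min => // x xgs; apply: sub_gensub; rewrite /= mem_cat xgs.
  have Gw : gensub [set x | x \in Gs] w.
    apply: lift; apply: gsgen; rewrite ?add0n //=; apply: XVs.
    by rewrite !strand_cpos; apply/strandn_mod; rewrite modnn mod0n.
  exists Gs; split; last first.
    rewrite size_cat; move: szgs strict; move: (nat_of_bool _).
    move: (size gs) (size hgens) (ncolors XV) (ncolors XE) (ncolors vclass) (ncolors root); lia.
  apply/seteqP; split; last first.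
    apply: gensub_min => // x; rewrite /= mem_cat => /orP[/gsP[p [q [_ _ e ->]]]|]; last exact: hgens_sub.
    apply/asboolP; have := XVr _ _ e; apply: contraTT => npq; apply: contraNN npq => pq.
    apply: (vrel_trans gK (y := cpos p)); first by apply: vrel_mod; rewrite cpos_mod.
    by apply: (vrel_trans gK pq); apply: vrel_mod; rewrite cpos_mod.
  apply: join_group_sub => // [p q e|g ghg]; last first.
    by apply: sub_gensub; rewrite /= mem_cat ghg orbT.
  apply: (subgroup_div_trans gG (y := A (p %% L)%N)); first by apply: A_modn => //; rewrite modn_mod.
  apply: (subgroup_div_trans gG (y := A (q %% L)%N)); last by apply: A_modn => //; rewrite modn_mod.
  apply: lift; apply: gsgen; rewrite ?add0n /= ?(ltnW (ltn_pmod _ _)) //.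
  rewrite (XVs (cpos (p %% L)) (cpos p)) ?(XVs (cpos (q %% L)) (cpos q)) //; first exact: XVv.
    by rewrite !strand_cpos; apply/strandn_mod; rewrite modn_mod.
  by rewrite !strand_cpos; apply/strandn_mod; rewrite modn_mod.
have tL := positions_gt0 L0 t0.
have cposM p q : p = q %[mod t * L] -> cpos p = cpos q by move=> e; apply: val_inj.
(* Starting after [p1] and stopping one edge short, the path visits all vertex classes and all edge
   classes but that of [p1]. *)
have [|gs [szgs gsP gsgen]] :=
    @path_generators _ _ _ A (vclass \o cpos) (root \o cpos) p1.+1 (t * L).-1.
  move=> p q _ _ /= /root_sound[e1 [e2 e3] [e4 e5]].
  have ec (e : nat -> nat) n : (forall p q, p = q %[mod L] -> e p = e q %[mod L]) ->
      (forall n, e (cpos n) = e n %[mod t * L]) -> cpos (e (cpos n)) = cpos (e n).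
    by move=> _ em; exact: cposM.
  have lc n : l (cpos n) = l n by rewrite -l_mod cpos_mod l_mod.
  have sc n : psrc (cpos n) = cpos (src n).
    by apply: cposM; rewrite /b lc /lsrc /= modnDml.
  have tc n : ptgt (cpos n) = cpos (tgt n).
    by apply: cposM; rewrite /b lc /ltgt /= modnDml.
  have vs : vrel A K (src p) (src q).
    apply: (vrel_trans gK (y := src (cpos p))); first by apply/vrel_mod/src_mod; rewrite cpos_mod.
    by apply: (vrel_trans gK e4); apply/vrel_mod/src_mod; rewrite cpos_mod.
  have vt : vrel A K (tgt p) (tgt q).
    apply: (vrel_trans gK (y := tgt (cpos p))); first by apply/vrel_mod/tgt_mod; rewrite cpos_mod.
    by apply: (vrel_trans gK e5); apply/vrel_mod/tgt_mod; rewrite cpos_mod.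
  apply: (erel_sound AS) => /=; first by move: e1; rewrite /lgen !lc.
    by apply: (vclass_end (e := src)) => //; move: e2; rewrite !sc.
  by apply: (vclass_end (e := tgt)) => //; move: e3; rewrite !tc.
have cover p : exists2 q, (p1.+1 <= q < p1.+1 + t * L)%N & p = q %[mod t * L].
  exists (p1.+1 + ((p + (t * L - p1.+1)) %% (t * L)))%N.
    by rewrite leq_addr ltn_add2l ltn_mod.
  by rewrite modnDmr addnCA subnKC // modnDr.
have cov (C : eqType) (c : T -> C) : path_colors (c \o cpos) (iota p1.+1 (t * L)) = ncolors c.
  apply: path_colors_cpos => p; have [q hq e] := cover p; apply/mapP; exists q; rewrite ?mem_iota //=.
  by rewrite -(cposM _ _ e) cpos_val.
rewrite prednK // cov in szgs.
have szE : (path_colors (root \o cpos) (iota p1.+1 (t * L).-1) + 1 = ncolors root)%N.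
  have iotaE m n : (0 < n)%N -> iota m n = rcons (iota m n.-1) (m + n.-1)%N.
    by case: n => // n _; rewrite -cats1 -[in LHS]addn1 iotaD.
  rewrite -cov (iotaE _ _ tL) path_colors_rcons.
  congr (_ + _)%N; apply/esym/eqP; rewrite eqb1; apply/mapP => -[q].
  rewrite mem_iota => hq /= e.
  have e1 : cpos (p1.+1 + (t * L).-1)%N = p1.
    rewrite -[RHS](cpos_val L0 t0); apply: cposM; rewrite addSnnS prednK // modnDr //.
  have := uniq1 (cpos q); rewrite -e e1 => /(_ erefl) /(congr1 val) /= /eqP.
  rewrite -[X in _ == X](modn_small (ltn_ord p1)) eqn_mod_dvd; last by lia.
  move=> /dvdnP[n]; case: n => [|n]; first by lia.
  by rewrite mulSn; lia.
pose Gs := w :: gs ++ hgens; have gG := gensub_subgroup [set x | x \in Gs].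
have wG : w \in Gs by rewrite mem_head.
have Gw : gensub [set x | x \in Gs] w by exact: sub_gensub.
have lift : gensub [set x | x \in gs] `<=` gensub [set x | x \in Gs].
  by apply: gensub_min => // x xgs; apply: sub_gensub; rewrite /= in_cons mem_cat xgs orbT.
exists Gs; split; last first.
  rewrite wG /= size_cat addn1; move: szgs; rewrite szE.
  move: (size gs) (size hgens) (ncolors vclass) (ncolors root); lia.
apply/seteqP; split; last first.
  apply: gensub_min => // x; rewrite /= in_cons mem_cat => /orP[/eqP->//|/orP[]].
    case/gsP=> p [q [_ _ /= /eqP + ->]]; rewrite vclassP => /andP[pq _].
    apply/asboolP; apply: (vrel_trans gK (y := cpos p)); first by apply: vrel_mod; rewrite cpos_mod.
    by apply: (vrel_trans gK pq); apply: vrel_mod; rewrite cpos_mod.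
  exact: hgens_sub.
apply: join_group_sub => // [p q e|g ghg]; last first.
  by apply: sub_gensub; rewrite /= in_cons mem_cat ghg !orbT.
have [p' hp' ep] := cover p; have [q' hq' eq] := cover q.
have mL n n' : n = n' %[mod t * L] -> n = n' %[mod L].
  move=> en; rewrite -(@modn_dvdm (t * L) n L) ?dvdn_mull // en modn_dvdm // dvdn_mull //.
apply: (subgroup_div_trans gG (y := A p')); first by apply: A_modn => //; exact: mL.
apply: (subgroup_div_trans gG (y := A q')); last by apply: A_modn => //; apply: mL.
apply: lift; apply: gsgen; rewrite ?prednK //; [by lia|by lia|].
by rewrite /= -(cposM _ _ ep) -(cposM _ _ eq).
Qed.

End KeyLemma.

(** * Cyclically reduced words *)

Section ConjugateCycles.
Local Open Scope group_scope.

Lemma cycle_count_conj N t (s a : 'S_N) : (0 < t)%N ->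
  cycle_count t (a * s * a^-1) = cycle_count t s.
Proof.
move=> t0; apply/eqP; rewrite -(eqn_pmul2l t0) !cycle_count_points //; apply/eqP.
have X i x : ((a * s * a^-1) ^+ i) x = a^-1 ((s ^+ i) (a x)).
  have -> : a * s * a^-1 = s ^ a^-1 by rewrite conjgE invgK mulgA.
  by rewrite -conjXg conjgE invgK !permM.
have E x : #|porbit (a * s * a^-1) x| = #|porbit s (a x)|.
  have -> : porbit s (a x) = [set a z | z in porbit (a * s * a^-1) x].
    apply/setP => z; apply/porbitP/imsetP => [[i ->]|[z' /porbitP[i ->] ->]].
      exists (a^-1 ((s ^+ i) (a x))); last by rewrite permKV.
      by apply/porbitP; exists i; rewrite X.
    by exists i; rewrite X permKV.
  by rewrite (card_imset _ (@perm_inj _ a)).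
rewrite -(card_imset _ (@perm_inj _ a)); apply: eq_card => z.
apply/imsetP/idP => [[x + ->]|]; rewrite !inE; first by rewrite E.
by move=> zt; exists (a^-1 z); rewrite ?inE ?E permKV.
Qed.

(** The case of a word with one letter: each of the (N)_t labellings has weight 1 / (N)_t. *)
Lemma sum_cycle_count N t : (0 < t)%N -> (t <= N)%N ->
  (\sum_(s : 'S_N) t * cycle_count t s = N`!)%N.
Proof.
move=> t0 tN; have tN1 : (t * 1 <= N)%N by rewrite muln1.
pose b (p : nat) := false; have bL p : b (p + 1)%N = b p by [].
have := expected_color_sum (ltnSn 0) t0 bL rat tN1 (fun _ => tt).
rewrite /color_sum (eq_bigr (fun=> (N ^_ t)%:R^-1)%R); last first.
  move=> y yI; rewrite big_ord1 /step_weight; set S := [set j | _].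
  have -> : S = finset.set0 by apply/setP => j; rewrite !inE ord1.
  rewrite /known big_set0 /inv_ffact cards0 subn0 finset.setD0.
  have -> : #|pairs_of (ltnSn 0) t0 b y ord0| = t.
    rewrite card_in_imset ?(card_strand (ltnSn 0) t0) // => p q; rewrite !inE.
    move=> /eqP ps /eqP qs [e _]; have pq : strand (ltnSn 0) p = strand (ltnSn 0) q by rewrite ps qs.
    apply: (psrc_inj bL pq); apply: (strand_injP _ _ yI) => //.
    by have [] := strand_ends t0 bL pq.
  have -> : compat (pairs_of (ltnSn 0) t0 b y ord0) finset.set0.
    by apply/compatP => a c _; rewrite inE.
  by rewrite mul1r.
rewrite sumr_const.
have -> : #|[pred y : {ffun 'I_(t * 1) -> 'I_N} | strand_inj (ltnSn 0) y]| = (N ^_ t)%N.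
  have := card_inj_ffuns 'I_(t * 1) 'I_N; rewrite !card_ord => e.
  have -> : (N ^_ t = N ^_ (t * 1))%N by rewrite muln1.
  rewrite -e cardsE; apply: eq_card => y; rewrite !inE; apply/strand_injP/injectiveP => H p q.
    by apply: H; apply: val_inj; rewrite /= !modn1.
  by move=> _; exact: H.
rewrite -[X in (_ * X)%R]mulr_natl mulfV ?mulr1; last first.
  by rewrite pnatr_eq0 -lt0n ffact_gt0.
rewrite card_unit expr1 => /eqP; rewrite eqr_nat => /eqP <-.
rewrite (reindex_onto (fun s : {ffun unit -> 'S_N} => s tt) (fun s => [ffun=> s])) /=.
  apply: eq_big => [s|s _]; last by rewrite big_ord1.
  by apply/eqP/ffunP => -[]; rewrite ffunE.
by move=> s _; rewrite ffunE.
Qed.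

End ConjugateCycles.

Section CyclicReduction.
Local Open Scope group_scope.
Variable I : choiceType.

Lemma cyclic_reduction (w : free_group I) : w <> 1 ->
  exists (u : free_group I) (x : I * bool) (s : seq (I * bool)),
    [/\ w = u * \prod_(l <- x :: s) lval l * u^-1, reduced (x :: s) & x != linv (last x s)].
Proof.
have [n] := ubnP (size (fword w)); elim: n w => // n IH w; rewrite ltnS => wn w1.
case Ew : (fword w) (fword_reduced w) wn => [|x s] red szn.
  by case: w1; apply: val_inj.
have wE : w = \prod_(l <- x :: s) lval l by rewrite -Ew prod_lval.
have [xl|xl] := eqVneq x (linv (last x s)); last first.
  by exists 1, x, s; rewrite invg1 mulg1 mul1g.
case/lastP: s => [|s z] in Ew red szn wE xl.
  by case/eqP: (linv_neq x); rewrite {2}xl.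
rewrite last_rcons in xl.
have zx : z = linv x by rewrite xl linvK.
have reds : reduced s.
  by move: red; rewrite /reduced /= rcons_path => /andP[/path_sorted].
pose w' := FreeGroup reds.
have w'E : w = lval x * w' * (lval x)^-1.
  rewrite wE big_cons -cats1 big_cat big_seq1 /= zx lval_linv mulgA; congr (_ * _ * _).
  by rewrite -[RHS]prod_lval.
have [||u [x' [s' [e1 e2 e3]]]] := IH w'.
- by move: szn; rewrite /= size_rcons; lia.
- move=> w'1; apply: w1; by rewrite w'E w'1 mulg1 mulgV.
exists (lval x * u), x', s'; split=> //.
by rewrite w'E {1}e1 invgM !mulgA.
Qed.

Variables (x0 : I * bool) (s : seq (I * bool)).
Let S := x0 :: s.
Let L := size S.
Definition cyc_letter p := nth x0 S (p %% L).

Lemma cyc_letter_period p : cyc_letter (p + L) = cyc_letter p.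
Proof. by rewrite /cyc_letter modnDr. Qed.

Lemma cyc_letter_reduced : reduced S -> x0 != linv (last x0 s) ->
  forall p, cyc_letter p.+1 != linv (cyc_letter p).
Proof.
move=> red x0l p; rewrite /cyc_letter.
have hp : (p %% L < L)%N by rewrite ltn_mod.
have e : (p.+1 %% L = (p %% L).+1 %% L)%N by rewrite -addn1 -modnDml addn1.
rewrite e; move: (p %% L)%N hp => q; rewrite leq_eqVlt => /orP[/eqP qL|qL].
  rewrite qL modnn /=; have -> : q = L.-1 by rewrite -qL.
  by rewrite nth_last.
by rewrite modn_small //; have /(sortedP x0) := red; apply.
Qed.

Lemma prod_cyc_letter : \prod_(0 <= p < L) lval (cyc_letter p) = \prod_(l <- S) lval l.
Proof.
rewrite [RHS](big_nth x0); apply: eq_big_nat => p /andP[_ hp].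
by rewrite /cyc_letter modn_small.
Qed.

(** By Bezout a period [d] yields the period gcd(L, d), a proper divisor of [L], which makes the
    word a power. *)
Lemma cyc_letter_aperiodic (u : free_group I) :
  non_power (u * \prod_(l <- S) lval l * u^-1) ->
  forall d, (0 < d < L)%N -> ~ forall p, cyc_letter (p + d) = cyc_letter p.
Proof.
move=> np d /andP[d0 dL] per; apply: np.
pose g := gcdn L d; have g0 : (0 < g)%N by rewrite gcdn_gt0.
have [a _ /dvdnP[c ac]] := @Bezoutl L d isT.
have gL : (g %| L)%N by exact: dvdn_gcdl.
have gd : (g <= d)%N by rewrite dvdn_leq // dvdn_gcdr.
have perg p : cyc_letter (p + g) = cyc_letter p.
  have pd q n : cyc_letter (q + n * d) = cyc_letter q.
    by elim: n => [|n IHn]; rewrite ?addn0 // mulSn addnCA addnC per.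
  rewrite -(pd (p + g)%N a) -addnA ac.
  by elim: c {ac} => [|c IHc]; rewrite ?addn0 // mulSn addnCA addnC cyc_letter_period.
pose P p := \prod_(0 <= j < p) lval (cyc_letter j).
have PS p : P p.+1 = P p * lval (cyc_letter p) by rewrite /P big_nat_recr.
have P0 : P 0%N = 1 by rewrite /P big_geq.
have Pg p : P (p + g)%N = P g * P p.
  elim: p => [|p IHp]; first by rewrite add0n P0 mulg1.
  by rewrite addSn !PS IHp perg mulgA.
have PX n : P (n * g)%N = P g ^+ n.
  elim: n => [|n IHn]; first by rewrite /P big_geq.
  by rewrite mulSn addnC Pg IHn -expgS.
exists (u * P g * u^-1), (L %/ g)%N; split.
  rewrite leq_divRL // mul2n -addnn; have /dvdnP[m Lm] := gL.
  move: Lm gd dL; move: (L) (g) => L' g'.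
  by case: m => [|[|m]] ->; rewrite ?mulSn; lia.
have -> : u * P g * u^-1 = P g ^ u^-1 by rewrite conjgE invgK mulgA.
by rewrite -conjXg -PX divnK // conjgE invgK mulgA /P prod_cyc_letter.
Qed.

End CyclicReduction.

(** Labellings with a given kernel and [j] values number at most N^j, so each kernel contributes at
    most 1; [rho] encodes kernels as maps from [T] to itself. *)
Lemma sum_image_le (R : realFieldType) (T : finType) (N : nat) : (0 < N)%N ->
  (\sum_(y : {ffun T -> 'I_N}) (N%:R : R) ^- #|[set y p | p : T]| <= (#|T| ^ #|T|)%:R)%R.
Proof.
move=> N0; pose rho (y : {ffun T -> 'I_N}) := [ffun p => class_rep (fun p q => y p == y q) p].
have repP y p q : (rho y p == rho y q) = (y p == y q).
  rewrite !ffunE; apply: class_repP => [p'|p' q'|q' p' r'] /=.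
  - by rewrite eqxx.
  - exact: eq_sym.
  - by move=> /eqP->.
have im_rho (y : {ffun T -> 'I_N}) : #|[set y p | p : T]| = #|[set rho y p | p : T]|.
  by rewrite !card_image_ncolors; apply: size_undup_map_eq => p q _ _; exact: repP.
rewrite (partition_big rho predT) //=.
have -> : (#|T| ^ #|T| = \sum_(f : {ffun T -> T}) 1)%N by rewrite sum1_card card_ffun.
rewrite natr_sum; apply: ler_sum => f _.
rewrite (eq_bigr (fun=> (N%:R : R) ^- #|[set f p | p : T]|)%R); last first.
  by move=> y /eqP <-; rewrite im_rho.
rewrite sumr_const; set Y := #|_|; set X := #|_|.
suff XY : (X <= N ^ Y)%N.
  rewrite -(mulr_natl _ X) ler_pdivrMr ?exprn_gt0 ?ltr0n // mul1r -natrX ler_nat //.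
pose z0 := Ordinal N0; pose g (y : {ffun T -> 'I_N}) : {ffun T -> 'I_N} :=
  [ffun p => if p \in [set f p | p : T] then y p else z0].
have <- : #|pffun_on z0 (mem [set f p | p : T]) (predT : pred 'I_N)| = (N ^ Y)%N.
  by rewrite card_pffun_on card_ord.
have -> : X = #|[set y | rho y == f]| by apply: eq_card => y; rewrite inE.
rewrite -(card_in_imset (f := g) (D := mem [set y | rho y == f])).
  apply/subset_leq_card/fintype.subsetP => _ /imsetP[y _ ->]; apply/pffun_onP; split=> //.
  by apply/fintype.subsetP => p; rewrite inE ffunE; case: ifP => //; rewrite eqxx.
move=> y y'; rewrite !inE => /eqP yf /eqP y'f /ffunP e; apply/ffunP => p.
have yp (z : {ffun T -> 'I_N}) : rho z = f -> z p = z (f p).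
  move=> <-; apply/eqP; rewrite ffunE.
  by apply: (class_rep_rel (R := fun p q => z p == z q)) => q; rewrite eqxx.
by have := e (f p); rewrite !ffunE imset_f // (yp y) // (yp y').
Qed.
(** * The expansion of the expectation *)

Section HolonomyUniform.
Local Open Scope group_scope.
Local Open Scope classical_set_scope.
Variables (I : choiceType) (lett : nat -> I * bool) (A : nat -> free_group I).
Hypothesis AS : forall p, A p.+1 = A p * lval (lett p).
Variables (K : set (free_group I)) (T : nat).
Hypothesis gK : is_subgroup K.
Hypothesis Kgen : K `<=` gensub (path_loops A K T).

(** All homomorphisms from [K] to [Q] arise from equally many labellings, which transfers uniformity
    from homomorphisms to labellings. *)
Lemma holonomy_uniform (w0 : free_group I) (Q : finGroupType) (q : Q) : primitive_in K w0 ->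
  (#|[set sg : {ffun 'I_T -> Q} | holonomy lett A K sg w0 == q]%SET| * #|Q| = #|Q| ^ T)%N.
Proof.
move=> prim; have [k [b [bI bK bU]]] := schreier_basis AS gK Kgen.
have bKi i : K (b i) by rewrite -bK; exists (fgen i) => //; rewrite flift_gen.
have [x xw] : exists x, flift b x = w0.
  have [B [BI BK] Bw] := prim.
  have : K w0.
    rewrite -BK; exists (fgen (exist _ w0 (mem_set Bw))) => //.
    by rewrite flift_gen.
  by rewrite -bK => -[x _ <-]; exists x.
pose tau_of (sg : {ffun 'I_T -> Q}) : {ffun 'I_k -> Q} := [ffun i => holonomy lett A K sg (b i)].
have hE (sg : {ffun 'I_T -> Q}) : holonomy lett A K sg w0 = flift (tau_of sg) x.
  rewrite -xw (flift_hom (K := K)) //; last by move=> u v Ku _; exact: holonomyM.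
  by apply: eq_flift => i; rewrite /= ffunE.
have Q0 : (0 < #|Q|)%N by apply/card_gt0P; exists 1.
apply/eqP; rewrite -(eqn_pmul2l (_ : 0 < #|Q| ^ k)%N) ?expn_gt0 ?Q0 //; apply/eqP.
suff S : (#|[set sg : {ffun 'I_T -> Q} | holonomy lett A K sg w0 == q]%SET| * #|Q| ^ k
    = #|[set tau : {ffun 'I_k -> Q} | flift tau x == q]%SET| * #|Q| ^ T)%N.
  rewrite -[in RHS](primitive_word_uniform gK bI bK prim q xw) mulnA [(_ ^ k * _)%N]mulnC S.
  by rewrite mulnAC.
rewrite -[#|[set sg | _]%SET|]sum1_card (partition_big tau_of (fun tau => flift tau x == q)) /=; last first.
  by move=> sg; rewrite inE hE.
rewrite -[#|[set tau | _]%SET|]sum1_card !big_distrl /=.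
rewrite [RHS](eq_bigl (fun tau : {ffun 'I_k -> Q} => flift tau x == q)) => [|tau]; last by rewrite inE.
apply: eq_bigr => tau tauq; rewrite mul1n -(bU Q tau); congr (_ * _)%N.
rewrite -sum1_card; apply: eq_bigl => sg; rewrite !inE hE.
have -> : [forall i, holonomy lett A K sg (b i) == tau i] = (tau_of sg == tau).
  apply/forallP/eqP => [H|<- i]; last by rewrite ffunE.
  by apply/ffunP => i; rewrite ffunE; exact/eqP.
by apply/andb_idl => /eqP->.
Qed.
End HolonomyUniform.

Lemma has_rank0 (G : groupType) (H : set G) : has_rank H 0 -> (H `<=` [set 1%g])%classic.
Proof.
case=> B [_ BH]; rewrite II0 card_eq0 -BH => /eqP B0 x [c _ <-] /=.
case: c => -[|[[a Ba] e] s] rc; first by rewrite /flift big_nil.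
by have : B a := set_mem Ba; rewrite {1}B0.
Qed.

Section Expansion.
Local Open Scope ring_scope.
Variables (R : realType) (r L t : nat) (l : nat -> 'I_r * bool) (A : nat -> free_group 'I_r).
Hypotheses (L0 : (0 < L)%N) (t2 : (1 < t)%N).
Let t0 : (0 < t)%N := ltnW t2.
Hypothesis lL : forall p, l (p + L)%N = l p.
Hypothesis l_red : forall p, l p.+1 != linv (l p).
Hypothesis l_aper : forall d, (0 < d < L)%N -> ~ forall p, l (p + d)%N = l p.
Hypothesis AS : forall p, A p.+1 = (A p * lval (l p))%g.

Let w := (A L * (A 0%N)^-1)%g.
Let b p := (l p).2.
Let bL p : b (p + L)%N = b p. Proof. by rewrite /b lL. Qed.
Notation joins := {ffun 'I_L -> {set 'I_L}}.
Notation JG := (join_group l A).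
Notation T := 'I_(t * L).

Definition valid_joins (D : joins) :=
  [forall k, D k \subset [set j : 'I_L | (j < k)%N && (lgen l j == lgen l k)]].

(* The contribution to [color_sum] of prescribing which earlier strands [D k] the weight of
   strand [k] genuinely depends on. *)
Definition join_sum N (D : joins) : R :=
  \sum_(y : {ffun T -> 'I_N} | strand_inj L0 y) \prod_k weight_moebius L0 t0 b R y k (D k).

Definition le_joins (D D' : joins) := valid_joins D && `[< (JG D `<=` JG D')%classic >].

Lemma color_sum_joins (C : finType) (c : 'I_L -> C) N : color_sum L0 t0 b R N c =
  \sum_(D : joins | [forall k, D k \subset [set j : 'I_L | (j < k)%N && (c j == c k)]])
    join_sum N D.
Proof.
rewrite /color_sum /join_sum exchange_big /=; apply: eq_bigr => y _.
under eq_bigr => k _ do rewrite -moebiusK.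
rewrite bigA_distr_big_dep; apply: eq_bigl => D.
by apply/familyP/forallP => H k; have := H k.
Qed.

Lemma valid_joinsP (D : joins) (k j : 'I_L) : valid_joins D -> j \in D k -> (j < k)%N /\ lgen l j = lgen l k.
Proof.
move=> /forallP/(_ k)/fintype.subsetP H /H; rewrite inE => /andP[-> /eqP->] //.
Qed.

Let gJ (D : joins) : is_subgroup (JG D). Proof. exact: gensub_subgroup. Qed.
Let wJ (D : joins) : JG D w. Proof. by apply: sub_gensub; left. Qed.
Let JD (D : joins) (k j : 'I_L) : j \in D k -> JG D (A (lsrc l k) * (A (lsrc l j))^-1)%g.
Proof. by move=> jk; apply: sub_gensub; right; exists k, j. Qed.

Lemma join_group_min (D : joins) (J : set (free_group 'I_r)) : is_subgroup J -> J w ->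
  (forall k j : 'I_L, j \in D k -> J (A (lsrc l k) * (A (lsrc l j))^-1)%g) ->
  (JG D `<=` J)%classic.
Proof. by move=> gJ' Jw H; apply: gensub_min => // x [->//|[k [j [jk ->]]]]; exact: H. Qed.

(** Joining only letters on the same edge of the Schreier graph of [JG D'] is the same as generating
    a subgroup of [JG D']; so the colour sum of this graph is a sum over a down-set. *)
Lemma le_joinsE (D D' : joins) :
  [forall k, D k \subset [set j : 'I_L | (j < k)%N &&
     (ecolor l A (JG D') j == ecolor l A (JG D') k)]] = le_joins D D'.
Proof.
apply/forallP/andP => [H|[vD /asboolP sub] k].
  have HP k j : j \in D k -> (j < k)%N /\ erel l A (JG D') j k.
    move=> jk; have := fintype.subsetP (H k) j jk; rewrite inE => /andP[-> e].
    by rewrite -(ecolorP _ _ (gJ D')).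
  split.
    apply/forallP => k; apply/fintype.subsetP => j /HP[jk /andP[e _]].
    by rewrite inE jk e.
  apply/asboolP; apply: join_group_min => // k j /HP[_ /andP[_ /asboolP e]].
  exact: (subgroup_divC (gJ D')).
apply/fintype.subsetP => j jk; have [lt e] := valid_joinsP vD jk.
rewrite inE lt (ecolorP _ _ (gJ D')) erelE e eqxx /=.
by apply/asboolP; apply: (subgroup_divC (gJ D')); apply: sub; exact: JD.
Qed.

(* Colouring the letters by the edges of the Schreier graph of [JG D] amounts to taking a
   random homomorphism from [JG D] to the symmetric group, for which a primitive element
   has a uniform value. *)
Lemma join_sum_uniform (D : joins) N : primitive_in (JG D) w -> (t * L <= N)%N ->
  \sum_(D' | le_joins D' D) join_sum N D' = 1.
Proof.
move=> prim tLN; set K := JG D in prim *.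
under eq_bigl => D' do rewrite -le_joinsE.
rewrite -(color_sum_joins (ecolor l A K (T := L))).
have tN : (t <= N)%N by apply: leq_trans tLN; rewrite leq_pmulr.
have Nf0 : ((N`!)%:R : R) != 0 by rewrite pnatr_eq0 -lt0n fact_gt0.
have := expected_color_sum L0 t0 bL R tLN (ecolor l A K (T := L)); rewrite card_ord.
set S := (X in X%:R = _) => eS.
suff SE : (S = N`! ^ L)%N.
  by apply: (mulfI (expf_neq0 L Nf0)); rewrite -eS SE natrX mulr1.
pose g (s : {ffun 'I_L -> 'S_N}) := (\prod_(k < L) signed_perm (s (ecolor l A K k)) (b k))%g.
have gE s : g s = holonomy l A K s w.
  have -> : holonomy l A K s w = gauge l A K s L.
    by rewrite /holonomy /gauge /w mulgA mulgKV.
  pose F p := signed_perm (s (ecolor l A K (strandn L0 p))) (b p).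
  have -> : g s = (\prod_(0 <= p < L) F p)%g.
    by rewrite big_mkord; apply: eq_bigr => k _; rewrite /F strandn_val.
  suff H n : (n <= L)%N -> (\prod_(0 <= p < n) F p)%g = gauge l A K s n by exact: H.
  elim: n => [|n IH] nL; first by rewrite big_nil gauge0.
  rewrite big_nat_recr //= IH 1?ltnW // (gaugeS AS (gJ D) s (Ordinal nL)).
  by rewrite /F (_ : strandn L0 n = Ordinal nL) //; apply: val_inj; rewrite /= modn_small.
have Kgen : (K `<=` gensub (path_loops A K L))%classic.
  apply: join_group_min; first exact: gensub_subgroup.
    by apply: sub_gensub; exists L, 0%N; split=> //; exact: wJ.
  move=> k j jk; apply: sub_gensub; exists (lsrc l k), (lsrc l j).
  have le (i : 'I_L) : (lsrc l i <= L)%N.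
    by have := ltn_ord i; rewrite /lsrc; case: (l i).2 => /=; lia.
  by split=> //; exact: JD.
have uni := holonomy_uniform AS (gJ D) Kgen (Q := 'S_N) _ prim; rewrite card_Sn in uni.
have Sg : S = (\sum_(s : {ffun 'I_L -> 'S_N}) t * cycle_count t (g s))%N by [].
(* Grouped by the value of [w], the labellings give every permutation equally often, which leaves
   the count for one uniform permutation. *)
apply/eqP; rewrite -(eqn_pmul2r (fact_gt0 N)) Sg (partition_big g predT) //= big_distrl /=.
rewrite -[X in (_ ^ _ * X)%N](sum_cycle_count t0 tN) big_distrr /=; apply/eqP/eq_bigr => q _.
rewrite (eq_bigr (fun=> t * cycle_count t q)%N) => [|s /eqP-> //].
rewrite sum_nat_const mulnAC; congr (_ * _)%N; rewrite -(uni q); congr (_ * _)%N.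
by apply: eq_card => s; rewrite !inE -gE.
Qed.

(** The exponents of the [L] weights add up to at least the rank plus the number of values of [y];
    the sum over [y] absorbs the latter and leaves the factor (t * L)^(t * L). *)
Lemma join_sum_bound (D : joins) m0 : valid_joins D -> ~ primitive_in (JG D) w ->
  (forall m, has_rank (JG D) m -> (m0 <= m)%N) ->
  forall N, (2 * (t + t * L) <= N)%N ->
  `|join_sum N D| <= (weight_constant L t)%:R ^+ L * ((t * L) ^ (t * L))%:R * N%:R ^- m0.
Proof.
move=> vD npr m0P N NB; have N0 : (0 < N)%N by lia.
set C := (weight_constant L t)%:R.
have step (y : {ffun T -> 'I_N}) : strand_inj L0 y ->
    `|\prod_k weight_moebius L0 t0 b R y k (D k)| <=
    C ^+ L * (N%:R ^- m0 * N%:R ^- #|[set y p | p : T]%SET|).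
  move=> yI.
  pose Q := pairs_of L0 t0 b y; pose QS := known L0 t0 b y.
  pose hits k (H : {set 'I_N * 'I_N}) := (H \subset QS (D k)) &&
    [forall (j | j \in D k), touches L0 t0 b y k j || ((H :&: Q j)%SET != finset.set0)].
  have hits0 k : hits k (QS (D k)).
    rewrite /hits subxx /=; apply/forallP => j; apply/implyP => jD; apply/orP; right.
    apply/set0Pn; exists (y (psrc L0 t0 b (cpos L0 t0 j)), y (ptgt L0 t0 b (cpos L0 t0 j))).
    have inQ : (y (psrc L0 t0 b (cpos L0 t0 j)), y (ptgt L0 t0 b (cpos L0 t0 j))) \in Q j.
      by apply/imsetP; exists (cpos L0 t0 j); rewrite // inE strand_cpos strandn_val.
    by rewrite inE inQ andbT; apply/bigcupP; exists j.
  (* A smallest hitting set gives the best exponent valid for all hitting sets, and is also what the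
     rank bound takes as input. *)
  pose H k := [arg min_(H < QS (D k) | hits k H) #|H|].
  have [Hh Hmin] : (forall k, hits k (H k)) /\ (forall k H', hits k H' -> (#|H k| <= #|H'|)%N).
    by split=> k; rewrite /H; case: arg_minnP.
  have [H_sub H_hit] : (forall k, H k \subset QS (D k)) /\
      (forall k j, j \in D k -> touches L0 t0 b y k j || ((H k :&: Q j)%SET != finset.set0)).
    split=> k; first by case/andP: (Hh k).
    by move=> j jD; case/andP: (Hh k) => _ /forallP/(_ j); rewrite jD.
  have DP (k j : 'I_L) : j \in D k -> (j < k)%N /\ lgen l j = lgen l k by exact: valid_joinsP.
  have [root rootP] := boolp.choice (root_exists L0 t2 lL AS DP y).
  have [m [rk mle]] := join_rank_bound lL l_red l_aper AS DP yI rootP H_sub H_hit npr.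
  pose d k := (#|Q k :\: QS (D k)| + #|H k|)%N.
  have wb k : `|weight_moebius L0 t0 b R y k (D k)| <= C * N%:R ^- d k.
    apply: weight_moebius_bound => // H' sub hit; rewrite leq_add2l; apply: Hmin.
    by rewrite /hits sub; apply/forallP => j; apply/implyP => /hit.
  apply: (le_trans (y := \prod_(k < L) (C * N%:R ^- d k))).
    by rewrite normr_prod; apply: ler_prod => k _; rewrite normr_ge0 wb.
  rewrite big_split /= prodr_const card_ord ler_wpM2l ?exprn_ge0 ?ler0n //.
  rewrite -invfM -exprD prodfV -expr_sum lef_pV2 ?posrE ?exprn_gt0 ?ltr0n //.
  rewrite ler_weXn2l ?ler1n //; apply: leq_trans mle; rewrite leq_add2r; exact: m0P.
apply: le_trans (ler_norm_sum _ _ _) _; apply: (le_trans (ler_sum _ step)).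
rewrite -big_distrr -mulrA ler_wpM2l ?exprn_ge0 ?ler0n //= -big_distrr /= [leRHS]mulrC.
rewrite ler_wpM2l ?invr_ge0 ?exprn_ge0 ?ler0n //.
have := sum_image_le R (fintype_ordinal__canonical__fintype_Finite (t * L)) N0.
rewrite card_ord; apply: le_trans.
rewrite [leRHS](bigID (fun y : {ffun T -> 'I_N} => strand_inj L0 y)) /= lerDl.
by apply: sumr_ge0 => y _; rewrite invr_ge0 exprn_ge0 ?ler0n.
Qed.

Let gens (D : joins) := w :: [seq (A (lsrc l k) * (A (lsrc l j))^-1)%g |
  k : 'I_L <- enum 'I_L, j : 'I_L <- enum (D k)].

Lemma join_group_rank (D : joins) : exists m, [/\ has_rank (JG D) m,
  (m <= (\sum_k #|D k|).+1)%N & m = (\sum_k #|D k|).+1 -> primitive_in (JG D) w].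
Proof.
have -> : JG D = gensub [set x | x \in gens D]%classic.
  congr gensub; apply/seteqP; split=> x /=; rewrite in_cons.
    case=> [->|[k [j [jk ->]]]]; first by rewrite eqxx.
    by apply/orP; right; apply/allpairsPdep; exists k, j; rewrite !mem_enum.
  case/orP=> [/eqP->|/allpairsPdep[k [j [_ jk ->]]]]; first by left.
  by right; exists k, j; rewrite mem_enum in jk.
have szE : size (gens D) = (\sum_k #|D k|).+1.
  rewrite /= size_allpairs_dep sumnE big_map big_enum /=.
  by congr _.+1; apply: eq_bigr => k _; rewrite cardE.
have [m [rk ms prim]] := rank_gensub (l 0%N) (gens D); exists m; rewrite -szE; split=> // /prim.
by apply; rewrite in_cons eqxx.
Qed.

Definition no_joins : joins := [ffun=> finset.set0].

Lemma le_no_joins (D : joins) : le_joins no_joins D.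
Proof.
apply/andP; split; first by apply/forallP => k; rewrite ffunE finset.sub0set.
apply/asboolP; apply: join_group_min => // k j; by rewrite ffunE finset.inE.
Qed.

(** The group is generated by [w] alone, and its rank is not 0 since [w] is not 1. *)
Lemma no_joins_primitive : w <> 1%g -> primitive_in (JG no_joins) w.
Proof.
move=> w1; have [m []] := join_group_rank no_joins.
rewrite big1 => [|k _]; last by rewrite ffunE cards0.
move=> rk; rewrite leq_eqVlt => /orP[/eqP-> /(_ erefl)//|].
rewrite ltnS leqn0 => /eqP m0 _; rewrite m0 in rk.
by case: w1; exact: (has_rank0 rk (@wJ no_joins)).
Qed.

Definition negligible (f : nat -> R) := exists C N0, forall N, (N0 <= N)%N ->
  `|f N| <= C * inv_pow R (primitivity_rank w) N.

Lemma negligible_near f g N0 : (forall N, (N0 <= N)%N -> f N = g N) ->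
  negligible f -> negligible g.
Proof.
move=> fg [C [N1 H]]; exists C, (maxn N0 N1) => N; rewrite geq_max => /andP[N0N N1N].
by rewrite -fg //; exact: H.
Qed.

Lemma negligible0 : negligible (fun=> 0).
Proof. by exists 0, 0%N => N _; rewrite normr0 mul0r. Qed.

Lemma negligibleD f g : negligible f -> negligible g -> negligible (fun N => f N + g N).
Proof.
move=> [C [N0 fC]] [C' [N1 gC]]; exists (C + C'), (maxn N0 N1) => N.
rewrite geq_max => /andP[N0N N1N]; rewrite mulrDl (le_trans (ler_normD _ _)) //.
by rewrite lerD // ?fC ?gC.
Qed.

Lemma negligibleN f : negligible f -> negligible (fun N => - f N).
Proof. by move=> [C [N0 fC]]; exists C, N0 => N; rewrite normrN; exact: fC. Qed.

Lemma negligible_sum (I : finType) (P : pred I) (f : I -> nat -> R) :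
  (forall i, P i -> negligible (f i)) -> negligible (fun N => \sum_(i | P i) f i N).
Proof.
move=> H; apply: (negligible_near (N0 := 0%N) (f := \sum_(i | P i) f i)).
  by move=> N _; rewrite fct_sumE.
apply: (big_ind negligible) => //; [exact: negligible0|exact: negligibleD].
Qed.

(** The group itself witnesses that the primitivity rank is finite and at most its rank; so for
    infinite primitivity rank there is no such [D]. *)
Lemma join_sum_negligible (D : joins) : valid_joins D -> ~ primitive_in (JG D) w ->
  negligible (fun N => join_sum N D).
Proof.
move=> vD npr; have nonprim m : has_rank (JG D) m -> nonprimitive_in_rank w m.
  by move=> rk; exists (JG D); split.
have [m [rk _ _]] := join_group_rank D.
rewrite /negligible /primitivity_rank; case: pselect => [ex|[]]; last first.
  by exists m; apply/asboolP; exact: nonprim.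
case: ex_minnP => k _ kmin.
exists ((weight_constant L t)%:R ^+ L * ((t * L) ^ (t * L))%:R), (2 * (t + t * L))%N => N NB.
by apply: join_sum_bound => // m' /nonprim H; apply: kmin; apply/asboolP.
Qed.

Lemma le_joins_trans (D D' D'' : joins) : le_joins D D' -> le_joins D' D'' -> le_joins D D''.
Proof.
move=> /andP[vD /asboolP s] /andP[_ /asboolP s']; rewrite /le_joins vD.
by apply/asboolP => x /s /s'.
Qed.

Lemma le_joinsxx (D : joins) : valid_joins D -> le_joins D D.
Proof. by rewrite /le_joins => ->; apply/asboolP. Qed.

Definition down_closed (U : {set joins}) := (forall D, D \in U -> valid_joins D) /\
  forall D D', D \in U -> le_joins D' D -> D' \in U.

Lemma down_closedD (U : {set joins}) (D0 : joins) : down_closed U ->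
  (forall D, D \in U -> le_joins D0 D -> le_joins D D0) ->
  down_closed (U :\: [set D | le_joins D D0 & le_joins D0 D])%SET.
Proof.
move=> [vU dU] maxD0; split=> [D|D D']; rewrite !finset.inE; first by case/andP=> _ /vU.
case/andP=> ncl DU D'D; rewrite (dU D D') // andbT; apply: contra ncl => /andP[_ D0D'].
have D0D := le_joins_trans D0D' D'D.
by rewrite D0D andbT; exact: maxD0.
Qed.

(* Remove the class of a maximal [D0]. If [w] is primitive in its group, the whole down-set of
   [D0] sums to 1, which reduces the class to the strictly smaller down-set. *)
Lemma down_closed_sum (U : {set joins}) : w <> 1%g -> down_closed U ->
  negligible (fun N => \sum_(D in U) join_sum N D - (no_joins \in U)%:R).
Proof.
move=> w1; have [n] := ubnP #|U|; elim: n U => // n IH U; rewrite ltnS => Un dcU.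
have [vU dU] := dcU.
have [->|[D1 D1U]] := finset.set_0Vmem U.
  apply: (negligible_near (N0 := 0%N) _ negligible0) => N _.
  by rewrite big_set0 finset.inE subr0.
pose down D := [set D' | le_joins D' D]%SET.
(* [le_joins] is only a preorder; an element with the largest down-set is maximal for it. *)
have [D0 D0U D0max] : exists2 D0, D0 \in U & forall D, D \in U -> le_joins D0 D -> le_joins D D0.
  case: (@arg_maxnP _ D1 (mem U) (fun D => #|down D|) D1U) => D0 D0U D0max.
  exists D0 => // D DU D0D; have /eqP e : down D0 == down D.
    rewrite eqEcard; apply/andP; split; last exact: D0max.
    apply/fintype.subsetP => D'.
    by rewrite !finset.inE => /le_joins_trans; apply.
  have : D \in down D by rewrite finset.inE le_joinsxx ?vU.
  by rewrite -e finset.inE.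
have vD0 := vU _ D0U.
pose cl := [set D | le_joins D D0 & le_joins D0 D]%SET.
have D0cl : D0 \in cl by rewrite finset.inE le_joinsxx.
have dcU' : down_closed (U :\: cl)%SET by exact: down_closedD.
have clU : cl \subset U.
  by apply/fintype.subsetP => D; rewrite finset.inE => /andP[/(dU D0 _ D0U)].
have U'n : (#|U :\: cl| < n)%N.
  apply: leq_trans Un; apply/proper_card/properP; split; first exact: finset.subsetDl.
  by exists D0 => //; rewrite finset.inE D0cl.
have splitU (W : {set joins}) N : cl \subset W ->
    \sum_(D in W) join_sum N D = \sum_(D in cl) join_sum N D + \sum_(D in (W :\: cl)%SET) join_sum N D.
  by move=> clW; rewrite (big_setID cl) /= (finset.setIidPr clW).
have [prim|nprim] := EM (primitive_in (JG D0) w); last first.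
  have JE D : D \in cl -> JG D = JG D0.
    by rewrite finset.inE => /andP[/andP[_ /asboolP s] /andP[_ /asboolP s']]; apply/seteqP; split.
  have ncl : no_joins \notin cl.
    by apply/negP => /JE e; apply: nprim; rewrite -e; exact: no_joins_primitive.
  have clS : negligible (fun N => \sum_(D in cl) join_sum N D).
    apply: negligible_sum => D Dcl; apply: join_sum_negligible; last by rewrite JE.
    exact: vU (fintype.subsetP clU D Dcl).
  apply: (negligible_near (N0 := 0%N) _ (negligibleD clS (IH _ U'n dcU'))) => N _.
  by rewrite finset.inE ncl (splitU U) //= addrA.
have dcV : down_closed (down D0).
  split=> [D|D D']; rewrite !finset.inE; first by case/andP.
  by move=> DD0 D'D; exact: le_joins_trans D'D DD0.
have clV : cl \subset down D0 by apply/fintype.subsetP => D; rewrite !finset.inE => /andP[].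
have VU : down D0 \subset U.
  by apply/fintype.subsetP => D; rewrite finset.inE; exact: dU D0U.
have dcV' : down_closed (down D0 :\: cl)%SET.
  by apply: down_closedD => // D; rewrite finset.inE.
have V'n : (#|down D0 :\: cl| < n)%N.
  by apply: leq_ltn_trans U'n; apply: subset_leq_card; exact: finset.setSD.
have botV : no_joins \in down D0 by rewrite finset.inE le_no_joins.
have botU := fintype.subsetP VU _ botV.
apply: (negligible_near (N0 := (t * L)%N) _
  (negligibleD (IH _ U'n dcU') (negligibleN (IH _ V'n dcV')))) => N tLN.
rewrite !finset.in_setD botU botV !andbT (splitU U) //.
have := join_sum_uniform prim tLN.
rewrite (eq_bigl (fun D => D \in down D0)) => [|D]; last by rewrite finset.inE.
rewrite (splitU (down D0)) // => /(canRL (addrK _)) ->.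
by rewrite (_ : true%:R = 1 :> R) //; move: (_%:R) => c; ring.
Qed.

Lemma valid_joins_sum : w <> 1%g ->
  negligible (fun N => \sum_(D | valid_joins D) join_sum N D - 1).
Proof.
move=> w1; have : down_closed [set D | valid_joins D]%SET.
  by split=> [D|D D']; rewrite !finset.inE // => _ /andP[].
move/(down_closed_sum w1); rewrite finset.inE.
have /andP[-> _] := le_no_joins no_joins.
apply: (negligible_near (N0 := 0%N)) => N _.
by congr (_ - _); apply: eq_bigl => D; rewrite finset.inE.
Qed.

End Expansion.

(** * From the expansion to the theorem *)

Lemma expected_cyclic_word (R : realType) (r L t N : nat) (l : nat -> 'I_r * bool)
    (L0 : (0 < L)%N) (t0 : (0 < t)%N) (u w : free_group 'I_r) :
  (forall p, l (p + L)%N = l p) -> (t * L <= N)%N ->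
  w = (u * (\prod_(0 <= p < L) lval (l p)) * u^-1)%g ->
  (t%:R * expected_cycles R w t N =
   color_sum L0 t0 (fun p => (l p).2) R N (fun k : 'I_L => lgen l k))%R.
Proof.
move=> lL tLN wE; have bL p : (l (p + L)%N).2 = (l p).2 by rewrite lL.
have := expected_color_sum L0 t0 bL R tLN (fun k : 'I_L => lgen l k).
have NN : #|{ffun 'I_r -> 'S_N}| = (N`! ^ r)%N by rewrite card_ffun card_Sn card_ord.
rewrite card_ord /expected_cycles NN natrX mulrA.
have Nf0 : ((N`!)%:R ^+ r : R)%R != 0%R.
  by rewrite expf_neq0 // pnatr_eq0 -lt0n fact_gt0.
move=> e; apply: (mulIf Nf0); rewrite mulfVK // mulrC -[RHS]mulrC -e mulr_suml natr_sum.
apply: eq_bigr => s _; rewrite natrM mulrC; congr (_ * _%:R)%R.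
rewrite wE !fliftM fliftV cycle_count_conj //; congr cycle_count.
rewrite -(big_mkord xpredT (fun k => signed_perm (s (l k).1) (l k).2)) /=.
by rewrite -(big_map l xpredT (@lval _)) flift_prod big_map.

Qed.

Local Open Scope classical_set_scope.
Local Open Scope ring_scope.

Theorem corollary1p5 (R : realType) (r : nat) (hr : (1 <= r)%N)
    (t : nat) (ht : (2 <= t)%N) (w : free_group 'I_r) (hw : non_power w) :
  (fun N : nat => expected_cycles R w t N)
    = (fun _ : nat => 1 / t%:R) +O_\oo
      (fun N : nat => inv_pow R (primitivity_rank w) N).
Proof.
have w1 : w <> 1%g by move=> w1; apply: hw; exists 1%g, 2%N; rewrite w1 expg1n.
have [u [x [s [wE red cyc_red]]]] := cyclic_reduction w1.
pose L := size (x :: s); have L0 : (0 < L)%N by [].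
(* Starting the path at [u] makes [A L * (A 0)^-1] equal to [w] itself and not to its cyclic
   reduction, so the primitivity rank need not be carried through a conjugation. *)
pose A p := (u * \prod_(0 <= j < p) lval (cyc_letter x s j))%g.
have AS p : A p.+1 = (A p * lval (cyc_letter x s p))%g by rewrite /A big_nat_recr //= mulgA.
have Aw : (A L * (A 0%N)^-1)%g = w by rewrite /A (big_geq (leqnn 0)) mulg1 prod_cyc_letter -wE.
have lL := cyc_letter_period x s.
have l_aper : forall d, (0 < d < L)%N -> ~ forall p, cyc_letter x s (p + d)%N = cyc_letter x s p.
  by apply: (cyc_letter_aperiodic (u := u)); rewrite -wE.
have [|C [N0 bound]] :=
  valid_joins_sum R L0 ht lL (cyc_letter_reduced red cyc_red) l_aper AS; first by rewrite Aw.
rewrite Aw in bound; apply/eqaddOP.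
have t0 : (0 : R) < t%:R by rewrite ltr0n ltnW.
have est : \forall N \near \oo,
    `|expected_cycles R w t N - 1 / t%:R| <= C / t%:R * `|inv_pow R (primitivity_rank w) N|.
  near=> N; have tLN : (t * L <= N)%N by near: N; exact: nbhs_infty_ge.
  have N0N : (N0 <= N)%N by near: N; exact: nbhs_infty_ge.
  have inv0 : 0 <= inv_pow R (primitivity_rank w) N.
    by rewrite /inv_pow; case: primitivity_rank => // k; rewrite invr_ge0 exprn_ge0 ?ler0n.
  rewrite (ger0_norm inv0) mulrAC ler_pdivlMr // -[X in _ * X](gtr0_norm t0) -normrM.
  rewrite mulrBl divfK ?gt_eqF // mulrC.
  rewrite (@expected_cyclic_word R r L t N (cyc_letter x s) L0 (ltnW ht) u w) //; last first.
    by rewrite prod_cyc_letter.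
  by rewrite color_sum_joins; exact: bound.
near=> k; apply: filterS est => N /le_trans; apply; rewrite ler_wpM2r //.
Unshelve. all: by end_near.
Qed.
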